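(* The lattice count polynomials $N_{g,n}$ satisfy the following recursion relation, which determines them uniquely from $N_{0,3}$ and $N_{1,1}$. For all integers $g\ge 0$, $n\ge 1$ with $2g-2+n>0$ and $(g,n)\notin\{(0,3),(1,1)\}$, and all positive integers $b_1,\dots,b_n$, $$\begin{aligned}\left(\sum_{i=1}^n b_i\right)N_{g,n}(b_1,\dots,b_n)={}&\sum_{i\neq j}\ \sum_{\substack{p+q=b_i+b_j\\ q\ \mathrm{even}}}pq\,N_{g,n-1}\bigl(p,b_{\{1,\dots,n\}\setminus\{i,j\}}\bigr)\\ &+\sum_{i=1}^n\ \sum_{\substack{p+q+r=b_i\\ r\ \mathrm{even}}}pqr\Biggl[N_{g-1,n+1}\bigl(p,q,b_{\{1,\dots,n\}\setminus\{i\}}\bigr)\\ &\qquad\qquad+\sum_{\substack{g_1+g_2=g\\ I\sqcup J=\{1,\dots,n\}\setminus\{i\}}}N_{g_1,|I|+1}(p,b_I)\,N_{g_2,|J|+1}(q,b_J)\Biggr].\end{aligned}$$ Here the first sum is over unordered pairs of distinct indices $i\neq j$ in $\{1,\dots,n\}$; $p,q,r$ range over positive integers; the last sum is over all non-negative integers $g_1,g_2$ with $g_1+g_2=g$ and all (possibly empty) disjoint sets $I,J$ with the given union; and $b_S$ denotes the tuple $(b_s)_{s\in S}$.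
   Context: A fatgraph $\Gamma$ is a finite connected graph (loops and multiple edges allowed) with all vertices of valency $>2$, equipped with a cyclic ordering of the (half-)edges at each vertex. Equivalently: let $X$ be the set of oriented edges of $\Gamma$ (each edge appears twice), $\tau_1:X\to X$ the involution reversing orientation, and $\tau_0:X\to X$ the map cyclically permuting the oriented edges with a common source vertex. Then the vertices are $X_0=X/\tau_0$, the edges are $X_1=X/\tau_1$, and the boundary components are $X_2=X/\tau_2$ with $\tau_2=\tau_0\tau_1$. The genus $g$ of a fatgraph with $n=|X_2|$ boundary components is defined by $|X_0|-|X_1|+|X_2|=2-2g$. A labeled fatgraph is a fatgraph whose boundary components are labeled $1,\dots,n$. $\mathcal{F}at_{g,n}$ denotes the (finite) set of isomorphism classes of labeled fatgraphs of genus $g$ with $n$ boundary components. An automorphism of a labeled fatgraph is a permutation of $X$ commuting with $\tau_0$ and $\tau_1$ and acting trivially on $X_2$; $Aut\,\Gamma$ is the group of these. Let $e(\Gamma)=|X_1|$ and let $A_\Gamma$ be the $n\times e(\Gamma)$ incidence matrix that sends each edge to the sum of its two incident boundary components (if both sides of an edge lie on the same boundary component $i$, the corresponding column has the entry $2$ in row $i$). For positive integers $b_1,\dots,b_n$, write $\mathbf{b}=(b_1,\dots,b_n)$ and let $$N_\Gamma(b_1,\dots,b_n)=\#\{\mathbf{x}\in\mathbb{Z}_{>0}^{e(\Gamma)} : A_\Gamma\mathbf{x}=\mathbf{b}\},\qquad N_{g,n}(b_1,\dots,b_n)=\sum_{\Gamma\in\mathcal{F}at_{g,n}}\frac{1}{|Aut\,\Gamma|}N_\Gamma(b_1,\dots,b_n).$$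 The function $N_{g,n}$ is called the lattice count polynomial. Each $N_{g,n}$ is a symmetric function of its arguments and vanishes when $\sum_i b_i$ is odd. Conventions: $N_{g,n}=0$ if $g<0$ or $2g-2+n\le 0$ (in particular $N_{0,1}=N_{0,2}=0$). The initial functions are: $N_{0,3}(b_1,b_2,b_3)=1$ if $b_1+b_2+b_3$ is even and $0$ otherwise; $N_{1,1}(b_1)=\frac{1}{48}(b_1^2-4)$ if $b_1$ is even and $0$ otherwise.
   Formalization: A factor 1/2 is inserted before the sum over i and p+q+r=b_i, because the printed recursion is false: for (g,n)=(1,2), b=(4,2) the left side is 3 and the printed right side is 4; with 1/2 it is 3. *)

(* Defs.v *)
From mathcomp Require Import all_boot all_order all_algebra all_fingroup.
From mathcomp Require Import zify.

Set Implicit Arguments.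
Unset Strict Implicit.
Unset Printing Implicit Defensive.

Import GRing.Theory.
Local Open Scope ring_scope.

(* Combinatorial data of a labeled fatgraph with e edges and n boundary
   components.  The oriented edges are X = 'I_(e.*2): every finite set of
   oriented edges is in bijection with exactly one of these, so isomorphism
   classes may be computed inside this type. *)
Definition fatdata (n e : nat) : finType :=
  ({perm 'I_(e.*2)} * {perm 'I_(e.*2)} * {ffun 'I_(e.*2) -> 'I_n})%type.

Section Fatgraph.
Variables (n e : nat).
Implicit Types (G H : fatdata n e) (h : {perm 'I_(e.*2)}).

Definition tau0 G : {perm 'I_(e.*2)} := G.1.1.
Definition tau1 G : {perm 'I_(e.*2)} := G.1.2.
(* Products of permutations act left factor first: tau2 G x = tau0 (tau1 x). *)
Definition tau2 G : {perm 'I_(e.*2)} := (tau1 G * tau0 G)%g.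
(* The label of the boundary component that contains an oriented edge. *)
Definition lab G : {ffun 'I_(e.*2) -> 'I_n} := G.2.

Definition X0 G : {set {set 'I_(e.*2)}} := porbits (tau0 G).
Definition X1 G : {set {set 'I_(e.*2)}} := porbits (tau1 G).
Definition X2 G : {set {set 'I_(e.*2)}} := porbits (tau2 G).

(* [transitive A, on S | to] includes S != set0.  The last two clauses say that
   lab induces a bijection from X2 onto 'I_n. *)
Definition is_fatgraph G : bool :=
  [&& [forall x, (tau1 G x != x) && (tau1 G (tau1 G x) == x)],
      [transitive <<[set tau0 G; tau1 G]>>%g, on [set: 'I_(e.*2)] | 'P],
      [forall v in X0 G, (2 < #|v|)%N],
      [forall x, forall y,
         (lab G x == lab G y) == (porbit (tau2 G) x == porbit (tau2 G) y)]
    & [forall i, exists x, lab G x == i]].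

(* |X0| - |X1| + |X2| = 2 - 2g, written without subtraction. *)
Definition has_genus (g : nat) G : bool :=
  (#|X0 G| + #|X2 G| + 2 * g == #|X1 G| + 2)%N.

Definition fatgraphs (g : nat) : {set fatdata n e} :=
  [set G | is_fatgraph G && has_genus g G].

Definition is_isom G H h : bool :=
  [forall x, [&& h (tau0 G x) == tau0 H (h x), h (tau1 G x) == tau1 H (h x)
              & lab H (h x) == lab G x]].

Definition isom : rel (fatdata n e) := fun G H => [exists h, is_isom G H h].

Definition Aut_fat G : {set {perm 'I_(e.*2)}} :=
  [set h : {perm _} | [forall x, (h (tau0 G x) == tau0 G (h x)) &&
                      (h (tau1 G x) == tau1 G (h x))]
           && [forall S in X2 G, (h @: S) == S]].

(* Each of the two oriented edges making up an edge lies on one boundary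
   component, so each column has total weight 2. *)
Definition incidence G : 'M[nat]_(n, #|X1 G|) :=
  \matrix_(i < n, k < #|X1 G|) #|[set x in enum_val k | lab G x == i]|.

(* Every column of incidence G has a nonzero entry, so all entries of a solution
   are bounded by the sum of the b_i (incidence_bound below), and it is enough
   to count the solutions with entries in the finite type 'I_(sum b_i).+1. *)
Definition NGamma G (b : n.-tuple nat) : nat :=
  #|[set x : 'cV['I_(\sum_i tnth b i)%N.+1]_#|X1 G| |
      [forall k, (0 < val (x k ord0))%N] &&
      (incidence G *m map_mx val x == \col_i tnth b i)]|.

End Fatgraph.

Definition stable (g n : nat) : bool := (2 < 2 * g + n)%N.

(* The isomorphism classes are enumerated by number of edges (which is at most
   6g - 6 + 3n, see fatgraph_edges below), one representative per class. *)
Definition latN (g n : nat) (b : n.-tuple nat) : rat :=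
  if stable g n then
    \sum_(e < 6 * g + 3 * n)
      \sum_(G in transversal (equivalence_partition (@isom n e) (fatgraphs n e g))
                             (fatgraphs n e g))
        (#|Aut_fat G|%:R^-1 * (NGamma G b)%:R)
  else 0.

Definition subtup (n : nat) (b : n.-tuple nat) (S : {set 'I_n}) :
  #|S|.-tuple nat := [tuple of [seq tnth b i | i <- enum_tuple S]].

Definition positive (n : nat) (b : n.-tuple nat) : Prop :=
  forall i, (0 < tnth b i)%N.

Definition lattice_family := forall g n : nat, n.-tuple nat -> rat.

Section Recursion.
Variable N : lattice_family.

Definition glue_term (g n : nat) (b : n.-tuple nat) (i j : 'I_n) : rat :=
  let s := (tnth b i + tnth b j)%N in
  \sum_(p < s.+1)
    \sum_(q < s.+1 | [&& (0 < p)%N, (0 < q)%N, (p + q)%N == s & ~~ odd q])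
      (p * q)%N%:R * N g [tuple of val p :: subtup b (~: [set i; j])].

(* N_{g-1,n+1}(p, q, b_S), which is 0 for g = 0. *)
Definition loop_term (g n : nat) (b : n.-tuple nat) (S : {set 'I_n})
    (p q : nat) : rat :=
  if g is g'.+1 then N g' [tuple of p :: [tuple of q :: subtup b S]] else 0.

Definition split_term (g n : nat) (b : n.-tuple nat) (S : {set 'I_n})
    (p q : nat) : rat :=
  \sum_(g1 < g.+1) \sum_(I : {set 'I_n} | I \subset S)
    N g1 [tuple of p :: subtup b I] *
    N (g - g1)%N [tuple of q :: subtup b (S :\: I)].

Definition cut_term (g n : nat) (b : n.-tuple nat) (i : 'I_n) : rat :=
  let s := tnth b i in
  \sum_(p < s.+1) \sum_(q < s.+1)
    \sum_(r < s.+1 | [&& (0 < p)%N, (0 < q)%N, (0 < r)%N,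
                         (p + q + r)%N == s & ~~ odd r])
      (p * q * r)%N%:R *
      (loop_term g b [set~ i] p q + split_term g b [set~ i] p q).

(* Unordered pairs {i, j} are listed once, as i < j.  In cut_term the triples
   (p, q, r) and the splittings (g1, I), (g2, J) are ordered, so each way of
   cutting is met twice; this is the factor 1/2.  It cannot be dropped: for
   (g, n) = (1, 2) and b = (4, 2) one has N_{1,2}(4, 2) = 1/2, N_{1,1}(4) = 1/4
   and N_{0,3}(1, 1, 2) = 1, and the relation reads
   6 * 1/2 = 8 * 1/4 + 1/2 * (2 * 1). *)
Definition satisfies_recursion : Prop :=
  forall (g n : nat) (b : n.-tuple nat),
    (1 <= n)%N -> stable g n -> (g, n) != (0%N, 3%N) -> (g, n) != (1%N, 1%N) ->
    positive b ->
    (\sum_i tnth b i)%N%:R * N g b =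
      \sum_(i < n) \sum_(j < n | (i < j)%N) glue_term g b i j
      + 2^-1 * \sum_i cut_term g b i.

Definition vanishes_unstable : Prop :=
  forall (g n : nat) (b : n.-tuple nat),
    (1 <= n)%N -> ~~ stable g n -> positive b -> N g b = 0.

End Recursion.

Definition agree_at (M N : lattice_family) (g n : nat) : Prop :=
  forall b : n.-tuple nat, positive b -> M g n b = N g n b.

Lemma porbits_partition (T : finType) (s : {perm T}) :
  partition (porbits s) [set: T].
Proof.
have -> : porbits s = orbit 'P <[s]>%g @: [set: T].
  apply/setP=> S; apply/imsetP/imsetP; case=> x _ ->; exists x;
  by rewrite ?inE ?porbitE.
by apply: orbit_partition; apply/actsP=> a _ x; rewrite !inE.
Qed.

Section Adequacy.
Variables (n e : nat).
Implicit Types (G H : fatdata n e).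

Lemma isom_equivalence (D : {set fatdata n e}) :
  {in D & &, equivalence_rel (@isom n e)}.
Proof.
have isom_refl G : isom G G.
  by apply/existsP; exists 1%g; apply/forallP=> x; rewrite !perm1 !eqxx.
have isom_sym G H : isom G H -> isom H G.
  case/existsP=> h /forallP hP; apply/existsP; exists (h^-1)%g.
  apply/forallP=> x; have /and3P[/eqP h0 /eqP h1 /eqP h2] := hP (h^-1 x)%g.
  move: h0 h1 h2; rewrite !permKV => h0 h1 h2.
  by rewrite -h0 -h1 !permK h2 !eqxx.
have isom_trans G H K : isom G H -> isom H K -> isom G K.
  case/existsP=> h /forallP hP /existsP[k /forallP kP].
  apply/existsP; exists (h * k)%g; apply/forallP=> x; rewrite !permM.
  have /and3P[/eqP -> /eqP -> /eqP <-] := hP x.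
  exact: kP (h x).
move=> G H K _ _ _; split=> // GH; apply/idP/idP; last exact: isom_trans.
exact: isom_trans (isom_sym _ _ GH).
Qed.

Lemma card_X1 G : is_fatgraph G -> #|X1 G| = e.
Proof.
case/and5P=> /forallP t1P _ _ _ _.
have c2 v : v \in X1 G -> #|v| = 2%N.
  case/imsetP=> x _ ->; have /andP[n1 /eqP n2] := t1P x.
  have -> : porbit (tau1 G) x = [set x; tau1 G x].
    apply/setP=> y; rewrite !inE; apply/porbitP/orP.
      case=> i ->; elim: i => [|i IH]; first by left; rewrite expg0 perm1.
      rewrite expgSr permM; case: IH => /eqP ->; [right|left] => //.
      by rewrite n2.
    case=> /eqP ->; [by exists 0%N; rewrite expg0 perm1|].
    by exists 1%N; rewrite expg1.
  by rewrite cards2 eq_sym n1.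
have := card_partition (porbits_partition (tau1 G)).
rewrite cardsT card_ord (eq_bigr (fun _ => 2%N)); last by move=> v /c2.
rewrite sum_nat_const -/(X1 G); lia.
Qed.

Lemma card_X2 G : is_fatgraph G -> #|X2 G| = n.
Proof.
case/and5P=> _ _ _ /forallP labP /forallP labS.
have labE x y : (lab G x == lab G y) = (porbit (tau2 G) x == porbit (tau2 G) y).
  by have /forallP/(_ y)/eqP := labP x.
pose B (i : 'I_n) := [set x | lab G x == i].
have BE x : B (lab G x) = porbit (tau2 G) x.
  by apply/setP=> y; rewrite inE labE eq_porbit_mem porbit_sym porbit_sym.
have Binj : injective B.
  move=> i j Bij; have /existsP[x /eqP xi] := labS i.
  by move/setP/(_ x): Bij; rewrite !inE xi eqxx => /esym/eqP.
have -> : X2 G = B @: setT.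
  apply/setP=> S; apply/imsetP/imsetP => -[].
    by move=> x _ ->; exists (lab G x); rewrite ?BE.
  move=> i _ ->; have /existsP[x /eqP <-] := labS i.
  by exists x; rewrite ?BE.
by rewrite card_imset // cardsT card_ord.
Qed.

Lemma fatgraph_edges g G : G \in fatgraphs n e g -> (e < 6 * g + 3 * n)%N.
Proof.
rewrite inE => /andP[fG]; rewrite /has_genus (card_X1 fG) (card_X2 fG) => /eqP gE.
have X0_small : (#|X0 G| * 3 <= e.*2)%N.
  case/and5P: (fG) => _ _ /forall_inP val3 _ _.
  have := card_partition (porbits_partition (tau0 G)).
  rewrite cardsT card_ord => eE; rewrite -sum_nat_const [leqRHS]eE.
  exact: leq_sum.
lia.
Qed.

Lemma incidence_bound G (b : n.-tuple nat) (x : 'cV[nat]_#|X1 G|) :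
  incidence G *m x = \col_i tnth b i ->
  forall k, (x k ord0 <= \sum_i tnth b i)%N.
Proof.
move=> xP k; have /imsetP[y _ yk] := enum_valP k.
have : (incidence G *m x) (lab G y) ord0 = tnth b (lab G y) by rewrite xP mxE.
rewrite mxE => yE; apply: (@leq_trans (tnth b (lab G y))); last first.
  by rewrite (bigD1 (lab G y)) //= leq_addr.
rewrite -yE (bigD1 k) //= mxE.
apply: leq_trans (leq_addr _ _); apply: leq_pmull.
by apply/card_gt0P; exists y; rewrite inE yk porbit_id eqxx.
Qed.

End Adequacy.

(* Main.v *)
Require Import Defs.
From mathcomp Require Import all_boot all_algebra all_fingroup.
From mathcomp Require Import zify ring.

Set Implicit Arguments.
Unset Strict Implicit.
Unset Printing Implicit Defensive.

Import GRing.Theory Num.Theory.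

(** The recursion counts gluings of polygons in two ways.

    Take [n] disjoint polygons with [b_1, ..., b_n] sides and glue their sides
    in pairs, so that the result is a closed connected oriented surface of genus
    [g].  The glued sides form a graph on this surface.  If it has no vertex of
    valency one, then forgetting its bivalent vertices yields a fatgraph with
    positive integer edge lengths and boundary lengths [b_i]; conversely, an
    edge of length l is subdivided into l unit edges.  A gluing of given
    polygons has no automorphisms, and compared to a labeled fatgraph it is
    rooted at a unit step of each boundary component.  Hence the number of
    leafless gluings is the product of the [b_i] times [N_{g,n}(b)]: this is
    [card_gluings_latN], which rests on the orbit-stabilizer theorem for the
    weights 1 / #|Aut| ([transversal_sum]) and on the two constructions above
    ([reversal_exists], [smoothing_exists]).  Combinatorially, a gluing is a
    fixed-point free involution [al] of the set of sides, [phi] maps each side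
    to the next one on its polygon, and the vertices are the cycles of
    [al * phi].

    Multiplication of the number of gluings by the sum of the [b_i] chooses a
    side [x] of the polygons.  Delete the edge that contains [x].  If it joins
    two different polygons, these become one ([nedge_merge]).  If it has the
    same polygon on both sides, this polygon falls into two, and the surface
    either loses a handle or becomes disconnected ([nedge_split]).  In each case
    the ends of the deleted edge may have become leaves.  Removing the pendant
    path at a marked corner shortens a polygon by an even number, so the counts
    with marks are sums of leafless counts over the lengths of the same parity
    up to the given one ([one_mark], [two_marks], [same_polygon_marks]).
    Altogether this expresses the count for [(g, n)] by counts for smaller
    surfaces ([polygon_recursion]).

    Among the smaller surfaces there are unstable ones.  A disc has no leafless
    gluing, since a tree has leaves ([ngluings_disc]), but two polygons with the
    same number a of sides are glued to a circle in a ways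
    ([ngluings_annulus]).  The annuli that are split off from face [i] along
    face [j] have to be added to the terms that merge [i] and [j]; the total
    is the sum over even [q] in the statement ([merge_identity]).  The other
    splittings give the sum over even [r] ([split_identity]).  Division by the
    product of the [b_i] proves [latN_recursion].

    Uniqueness is an induction on [2 * g + n] ([recursion_unique]). *)

(** * Cycles of permutations on invariant sets *)

Section Permutations.
Variable D : finType.
Implicit Types (A S : {set D}) (s : {perm D}) (x y z : D).

Definition closed_by s S := [forall z in S, s z \in S].

Lemma closed_byP s S : reflect {in S, forall z, s z \in S} (closed_by s S).
Proof. exact: forall_inP. Qed.

Lemma closed_mem s S z : closed_by s S -> (s z \in S) = (z \in S).
Proof.
move/closed_byP=> sS; apply/idP/idP; last exact: sS.
have sSE : s @: S = S.
  apply/eqP; rewrite eqEcard card_imset ?leqnn ?andbT; last exact: perm_inj.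
  by apply/subsetP=> _ /imsetP[u uS ->]; exact: sS.
by rewrite -{1}sSE => /imsetP[u uS /perm_inj ->].
Qed.

Lemma closedC s S : closed_by s S -> closed_by s (~: S).
Proof. by move=> sS; apply/closed_byP=> z; rewrite !inE closed_mem. Qed.

Lemma closed_iter s S k z : closed_by s S -> (iter k s z \in S) = (z \in S).
Proof. by move=> sS; elim: k => //= k; rewrite closed_mem. Qed.

Lemma porbit_iterP s x y :
  reflect (exists k, y = iter k s x) (y \in porbit s x).
Proof.
by apply: (iffP (porbitP _ _ _)) => -[k ->]; exists k; rewrite permX.
Qed.

(** For an invariant [S], the number of cycles of [s] inside [S]. Restricting
    to a subset of a fixed type [D] allows sides to be deleted without changing
    the type. *)
Definition norb s S := #|porbit s @: S|.

Lemma norb_split s S : closed_by s S -> #|porbits s| = norb s S + norb s (~: S).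
Proof.
move=> sS; have -> : porbits s = porbit s @: S :|: porbit s @: (~: S).
  rewrite -imsetU setUCr; apply/setP=> P; apply/imsetP/imsetP => -[x _ ->];
  by exists x; rewrite ?inE.
rewrite /norb cardsU (_ : _ :&: _ = set0) ?cards0 ?subn0 //.
apply/setP=> P; rewrite !inE; apply/negP=> /andP[/imsetP[x xS ->]].
case/imsetP=> y; rewrite inE => yS /eqP; rewrite eq_porbit_mem.
by case/porbit_iterP=> k xE; move: xS; rewrite xE closed_iter // (negPf yS).
Qed.

Lemma eq_in_porbit s s' S x :
  closed_by s S -> {in S, s =1 s'} -> x \in S -> porbit s x = porbit s' x.
Proof.
move=> sS ss' xS; have it k : iter k s x = iter k s' x.
  by elim: k => //= k <-; rewrite ss' // closed_iter.
by apply/setP=> y; apply/porbit_iterP/porbit_iterP => -[k ->]; exists k.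
Qed.

Lemma eq_in_norb s s' S :
  closed_by s S -> {in S, s =1 s'} -> norb s S = norb s' S.
Proof.
move=> sS ss'; congr #|pred_of_set _|.
by apply: eq_in_imset => x xS; apply: eq_in_porbit sS ss' xS.
Qed.

Lemma eq_in_closed s s' S : {in S, s =1 s'} -> closed_by s S = closed_by s' S.
Proof.
by move=> ss'; apply/closed_byP/closed_byP => sS z zS;
  [rewrite -ss' | rewrite ss']; rewrite ?sS.
Qed.

Lemma norbU s S S' : closed_by s S -> [disjoint S & S'] ->
  norb s (S :|: S') = norb s S + norb s S'.
Proof.
move=> sS dSS'; rewrite /norb imsetU cardsU (_ : _ :&: _ = set0) ?cards0 ?subn0 //.
apply/setP=> P; rewrite !inE; apply/negP=> /andP[/imsetP[x xS ->]].
case/imsetP=> y yS' /eqP; rewrite eq_porbit_mem.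
case/porbit_iterP=> k xE; move: xS; rewrite xE closed_iter // => yS.
by move/pred0P/(_ y): dSS'; rewrite /= yS yS'.
Qed.

Lemma norb_set1 s x : norb s [set x] = 1.
Proof. by rewrite /norb imset_set1 cards1. Qed.

(** [skip x s] bypasses [x]: the cycle of [s] through [x] loses that point. *)
Definition skip x s := (s * tperm x (s x))%g.

Lemma skipE x s z :
  skip x s z = if z == x then x else if s z == x then s x else s z.
Proof.
rewrite permM; case: tpermP => [szx|/perm_inj ->|/eqP szx /eqP szsx].
- by rewrite szx eqxx; case: eqP szx => // -> ->.
- by rewrite eqxx.
by rewrite (negPf szx); case: (z =P x) szsx => [->|] //; rewrite eqxx.
Qed.

(** Multiplication by the transposition of two successive points of a cycle
    splits one of them off as a cycle of its own. *)
Lemma card_porbits_skip x s : #|porbits (skip x s)| = #|porbits s| + (s x != x).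
Proof.
have -> : skip x s = (tperm (s^-1 x) x * s)%g.
  by rewrite /skip -{1}(permKV s x) -tpermJ conjgE !mulgA mulgV mul1g.
have /= := porbits_mul_tperm s (s^-1 x)%g x.
have -> : ((s^-1)%g x \in porbit s x).
  by rewrite porbit_sym; apply/porbit_iterP; exists 1; rewrite /= permKV.
rewrite addn0 => ->; congr (_ + nat_of_bool (~~ _)).
by apply/eqP/eqP => E; [rewrite -{1}E permKV | rewrite -{1}E permK].
Qed.

Lemma closed_skip x s S : closed_by s S -> x \in S -> closed_by (skip x s) (S :\ x).
Proof.
move=> sS xS; apply/closed_byP=> z; rewrite in_setD1 => /andP[zx zS].
rewrite skipE (negPf zx) in_setD1; have [szx|->] := eqVneq (s z) x; last first.
  by rewrite closed_mem.
rewrite closed_mem // xS andbT; apply: contraNneq zx => sx.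
by rewrite -(inj_eq (@perm_inj _ s)) szx sx.
Qed.

Lemma norb_skip x s S : closed_by s S -> x \in S ->
  norb (skip x s) (S :\ x) + (s x == x) = norb s S.
Proof.
move=> sS xS; have cS' := closed_skip sS xS.
have := norb_split sS; have := norb_split cS'.
rewrite card_porbits_skip (_ : ~: (S :\ x) = ~: S :|: [set x]); last first.
  by apply/setP=> z; rewrite !inE negb_and negbK orbC.
have cC : closed_by (skip x s) (~: S).
  apply/closed_byP=> z; rewrite !inE => zS; rewrite skipE.
  case: eqP zS => [->|_ zS]; first by rewrite xS.
  by case: eqP => [szx|_]; rewrite ?closed_mem //; rewrite -szx closed_mem ?(negPf zS) // in xS.
rewrite norbU ?norb_set1; last first.
- by rewrite disjoint_sym disjoints1 inE xS.
- exact: cC.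
rewrite -(@eq_in_norb s (skip x s) (~: S)); last first.
- move=> z; rewrite inE => zS; rewrite skipE.
  case: eqP zS => [->|_ zS]; first by rewrite xS.
  by case: eqP => // szx; rewrite -szx closed_mem // (negPf zS) in xS.
- exact: closedC.
by case: eqP => /=; lia.
Qed.

End Permutations.

(** * Gluings of sides and their Euler characteristic *)

Section Gluings.
Variable D : finType.
Implicit Types (A M S : {set D}) (phi al s : {perm D}) (x y z : D).

(** Pairings of the elements of [A], extended by the identity to [D]. *)
Definition matchings A : {set {perm D}} :=
  [set al | perm_on A al & [forall x in A, (al x != x) && (al (al x) == x)]].

Lemma matchingsP A al :
  reflect [/\ perm_on A al, {in A, forall x, al x != x} & involutive al]
          (al \in matchings A).
Proof.
rewrite inE; apply: (iffP andP) => [[Aal /forall_inP alP]|[Aal alN alK]].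
  split=> // [x /alP/andP[] //|x]; have [/alP/andP[_ /eqP//]|xA] := boolP (x \in A).
  by rewrite !(out_perm Aal).
by split=> //; apply/forall_inP=> x xA; rewrite alN // alK eqxx.
Qed.

Definition connected A phi al :=
  (A != set0) && [forall S : {set D},
    [&& S \subset A, S != set0, closed_by phi S & closed_by al S] ==> (S == A)].

Lemma connectedP A phi al :
  reflect (A != set0 /\ forall S : {set D}, S \subset A -> S != set0 ->
             closed_by phi S -> closed_by al S -> S = A)
          (connected A phi al).
Proof.
apply: (iffP andP) => -[A0 AP]; split=> //.
  by move=> S SA S0 pS aS; apply/eqP/(implyP (forallP AP S)); rewrite SA S0 pS.
by apply/forallP=> S; apply/implyP=> /and4P[SA S0 pS aS]; apply/eqP/AP.
Qed.

(** A vertex is a cycle of [al * phi]; a leaf is a vertex of valency one, and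
    is represented by the side that follows its only corner. *)
Definition leaves A phi al := [set z in A | phi (al z) == z].

(** The equation V - E + F = 2 - 2 g with E = #|A| / 2 edges and [n] faces,
    doubled in order to avoid the division. *)
Definition euler A n phi al g := (norb (al * phi) A + n + 2 * g).*2 == #|A| + 4.

(** Connected surfaces of genus [g] made of [n] polygons, whose sides are the
    elements of [A] and follow each other by [phi]. Leaves are only allowed at
    the corners that precede the sides in [M]. *)
Definition gluings A n phi M g : {set {perm D}} :=
  [set al in matchings A |
    [&& connected A phi al, leaves A phi al \subset M & euler A n phi al g]].

Lemma closed_matching A al : al \in matchings A -> closed_by al A.
Proof. by case/matchingsP=> Aal _ _; apply/closed_byP=> z; rewrite perm_closed. Qed.

Lemma matchings0 al : (al \in matchings set0) = (al == 1%g).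
Proof.
apply/matchingsP/eqP => [[al0 _ _]|->].
  by apply/permP=> x; rewrite (out_perm al0) ?inE // perm1.
by split=> [|x|x]; rewrite ?inE ?perm1 ?perm_on1.
Qed.

(** A fixed-point free involution that exchanges [x] and [y] is the product of
    their transposition and a fixed-point free involution of the other
    sides. *)
Lemma matching_add_edge A x y al : x \in A -> y \in A -> x != y ->
  (al \in matchings (A :\: [set x; y])) =
  ((tperm x y * al)%g \in matchings A) && ((tperm x y * al)%g x == y).
Proof.
move=> xA yA xy; have yx : y != x by rewrite eq_sym.
apply/idP/andP.
  case/matchingsP=> pal alN alK.
  have alx : al x = x by rewrite (out_perm pal) // !inE eqxx.
  have aly : al y = y by rewrite (out_perm pal) // !inE eqxx orbT.
  rewrite permM tpermL aly eqxx; split=> //.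
  have tE z : (tperm x y * al)%g z =
    if z == x then y else if z == y then x else al z.
    by rewrite permM; case: tpermP => [->|->|/eqP zx /eqP zy];
       rewrite ?eqxx ?(negPf yx) ?(negPf zx) ?(negPf zy).
  have alxN z : z != x -> (al z == x) = false.
    by move=> zx; apply/negbTE; rewrite -alx (inj_eq perm_inj).
  have alyN z : z != y -> (al z == y) = false.
    by move=> zy; apply/negbTE; rewrite -aly (inj_eq perm_inj).
  apply/matchingsP; split=> [|z zA|z].
  - apply/subsetP=> z; rewrite inE tE.
    have [->//|zx] := eqVneq z x; have [->//|zy] := eqVneq z y => alz.
    by apply: (subsetP (subsetDl A [set x; y])); apply: (subsetP pal).
  - rewrite tE; have [->//|zx] := eqVneq z x; have [->//|zy] := eqVneq z y.
    by apply: alN; rewrite !inE negb_or zx zy.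
  rewrite !tE; have [->|zx] := eqVneq z x; first by rewrite (negPf yx) eqxx.
  have [->|zy] := eqVneq z y; first by rewrite eqxx.
  by rewrite alxN // alyN.
set be := (_ * al)%g => -[/matchingsP[pbe beN beK] /eqP bex].
have bey : be y = x by rewrite -bex beK.
have -> : al = (tperm x y * be)%g by rewrite /be mulgA tperm2 mul1g.
have tE z : (tperm x y * be)%g z = if z == x then x else if z == y then y else be z.
  by rewrite permM; case: tpermP => [->|->|/eqP zx /eqP zy];
     rewrite ?eqxx ?(negPf yx) ?(negPf zx) ?(negPf zy).
have bexN z : z != y -> (be z == x) = false.
  by move=> zy; apply/negbTE; rewrite -bey (inj_eq perm_inj).
have beyN z : z != x -> (be z == y) = false.
  by move=> zx; apply/negbTE; rewrite -bex (inj_eq perm_inj).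
apply/matchingsP; split=> [|z|z].
- apply/subsetP=> z; rewrite !inE tE.
  have [->|zx] := eqVneq z x; first by rewrite eqxx.
  have [->|zy] := eqVneq z y; first by rewrite eqxx.
  by move/(subsetP pbe).
- rewrite !inE negb_or tE => /andP[/andP[zx zy] zA].
  by rewrite (negPf zx) (negPf zy) beN.
rewrite !tE; have [->|zx] := eqVneq z x; first by rewrite eqxx.
have [->|zy] := eqVneq z y; first by rewrite (negPf yx) eqxx.
by rewrite bexN // beyN // beK.
Qed.

Lemma card_setD_edge A x y : x \in A -> y \in A -> x != y ->
  #|A| = (#|A :\: [set x; y]| + 2)%N.
Proof.
move=> xA yA xy; rewrite -(cardsID [set x; y] A) addnC (setIidPr _) ?cards2 ?xy //.
by apply/subsetP=> z; rewrite !inE => /orP[]/eqP->.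
Qed.

(** Edges are added one at a time while [f] keeps a name for each component:
    an edge joining two components merges two cycles of [al * phi], any other
    edge changes the number of cycles by one. *)
Lemma euler_components A phi al : al \in matchings A ->
  exists (f : D -> {set D}) h,
    [/\ forall z, f (phi z) = f z, forall z, f (al z) = f z &
        (#|porbits (al * phi)| + #|porbits phi| + 2 * h).*2
          = #|A| + 4 * #|f @: setT|].
Proof.
have [m] := ubnP #|A|; elim: m => // m IHm in A al *; rewrite ltnS => Am alA.
have [A0|[x xA]] := set_0Vmem A.
  exists (porbit phi), 0; move: alA; rewrite A0 matchings0 => /eqP ->.
  split=> [z|z|]; last first.
  - rewrite mul1g cards0 (_ : porbit phi @: setT = porbits phi); first by lia.
    by apply/setP=> P; apply/imsetP/imsetP => -[z _ ->]; exists z.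
  - by rewrite perm1.
  by apply/eqP; rewrite eq_porbit_mem; apply/porbit_iterP; exists 1.
have [pal alN alK] := matchingsP _ _ alA; pose y := al x.
have xy : x != y by rewrite eq_sym alN.
have yA : y \in A by rewrite perm_closed.
pose al' := (tperm x y * al)%g.
have alE : al = (tperm x y * al')%g by rewrite /al' mulgA tperm2 mul1g.
have al'A : al' \in matchings (A :\: [set x; y]).
  by rewrite matching_add_edge // -alE alA /y eqxx.
have cA := card_setD_edge xA yA xy.
have [|f [h [fphi fal hE]]] := IHm _ _ _ al'A; first by lia.
have porbE : #|porbits (al * phi)| + (x \notin porbit (al' * phi) y).*2
             = #|porbits (al' * phi)| + 1.
  by rewrite alE -mulgA (porbits_mul_tperm (al' * phi) x y) xy.
have [fxy|fxy] := eqVneq (f x) (f y).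
  exists f; case: (_ \notin _) porbE => porbE; [exists h.+1 | exists h];
  (split=> // [z|]; [by rewrite alE permM fal; case: tpermP => [->|->|] | lia]).
have xNy : x \notin porbit (al' * phi) y.
  apply: contraNN fxy => /porbit_iterP[k ->]; apply/eqP.
  by elim: k => //= k IH; rewrite permM fphi fal.
(* The new edge joins the components named [f x] and [f y]. *)
pose f' z := if f z == f y then f x else f z.
exists f', h; rewrite xNy in porbE; split=> [z|z|].
- by rewrite /f' fphi.
- rewrite /f' alE permM fal; case: tpermP => [->|->|//].
    by rewrite eqxx (negPf fxy).
  by rewrite eqxx (negPf fxy).
have imE : f' @: setT = (f @: setT) :\ f y.
  apply/setP=> P; rewrite inE; apply/imsetP/andP.
    case=> z _ ->; rewrite /f' inE; case: ifP => [_|/negbT fzy].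
      by rewrite fxy imset_f.
    by rewrite fzy imset_f.
  case=> Pfy /imsetP[z _ PE]; exists z => //.
  by rewrite /f' -PE; move: Pfy; rewrite inE => /negPf ->.
have : #|f @: setT| = #|f' @: setT| + 1.
  by rewrite imE (cardsD1 (f y)) imset_f // addnC.
lia.
Qed.

Lemma connected_const (T : eqType) A phi al (f : D -> T) :
  closed_by phi A -> al \in matchings A -> connected A phi al ->
  (forall z, f (phi z) = f z) -> (forall z, f (al z) = f z) ->
  {in A &, forall x y, f x = f y}.
Proof.
move=> phA alA /connectedP[A0 AP] fphi fal x y xA yA.
have alcA := closed_matching alA.
suff : y \in [set z in A | f z == f x] by rewrite inE => /andP[_ /eqP].
rewrite (AP [set z in A | f z == f x]) //.
- by apply/subsetP=> z; rewrite inE => /andP[].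
- by apply/set0Pn; exists x; rewrite inE xA eqxx.
- by apply/closed_byP=> z; rewrite !inE closed_mem // fphi.
by apply/closed_byP=> z; rewrite !inE closed_mem // fal.
Qed.

(** The names [f] given by [euler_components] are constant on [A], and there
    are at most as many other names as cycles of [phi] outside [A]; hence the
    Euler characteristic is even and at most two. *)
Lemma euler_exists A phi al :
  closed_by phi A -> al \in matchings A -> connected A phi al ->
  exists g, euler A (norb phi A) phi al g.
Proof.
move=> phA alA conA; have [f [h [fphi fal hE]]] := euler_components phi alA.
have fA := connected_const phA alA conA fphi fal.
have alcA := closed_matching alA.
have sgA : closed_by (al * phi) A.
  by apply/closed_byP=> z; rewrite permM !closed_mem.
have sgE : norb (al * phi) (~: A) = norb phi (~: A).
  apply: eq_in_norb; first exact: closedC.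
  move=> z; rewrite inE permM => zA.
  by have [pal _ _] := matchingsP _ _ alA; rewrite (out_perm pal).
move: hE; rewrite (norb_split sgA) (norb_split phA) sgE.
have [/set0Pn[x0 x0A] _] := connectedP _ _ _ conA.
have cf : #|f @: setT| <= 1 + norb phi (~: A).
  have -> : f @: setT = f @: A :|: f @: (~: A).
    by rewrite -imsetU setUCr.
  rewrite cardsU; apply: leq_trans (leq_subr _ _) _; apply: leq_add.
    rewrite (_ : f @: A = [set f x0]) ?cards1 //; apply/setP=> P; rewrite inE.
    by apply/imsetP/eqP => [[z zA ->]|->]; [exact: fA | exists x0].
  (* [f] is constant on the cycles of [phi]. *)
  pose k (P : {set D}) := if [pick z in P] is Some z then f z else set0.
  have -> : f @: (~: A) = k @: (porbit phi @: (~: A)).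
    rewrite -imset_comp; apply: eq_imset => x; rewrite /k /=.
    case: pickP => [z|/(_ x)]; last by rewrite porbit_id.
    by case/porbit_iterP=> j ->; elim: j => //= j ->; rewrite fphi.
  exact: leq_imset_card.
move=> hE; exists (h + (1 + norb phi (~: A) - #|f @: setT|)).
rewrite /euler; apply/eqP; move: cf hE.
set c := #|_ @: _|; set u := norb _ _; set v := norb _ _; set w := norb _ _; lia.
Qed.

Lemma euler_inj A n phi al g g' : euler A n phi al g -> euler A n phi al g' -> g = g'.
Proof. by rewrite /euler; move=> /eqP e1 /eqP e2; lia. Qed.

End Gluings.

(** * Deleting an edge of a gluing *)

Section EdgeDeletion.
Variable D : finType.
Implicit Types (A M S : {set D}) (phi al s : {perm D}) (x y z : D).

(** The face permutation left after deleting the edge made of the sides [x] and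
    [y]: composing with the transposition merges or splits the faces along
    that edge, after which both sides are bypassed. *)
Definition delete x y phi := skip y (skip x (tperm x y * phi)).

Lemma deleteE x y phi z : x != y -> z != x -> z != y ->
  delete x y phi z =
    if phi z == x then
      (if phi y == y then if phi x == x then phi y else phi x else phi y)
    else if phi z == y then (if phi x == x then phi y else phi x)
    else phi z.
Proof.
rewrite eq_sym => yx zx zy; rewrite !skipE (negPf zx) (negPf zy) (negPf yx).
have tz : tperm x y z = z by rewrite tpermD // eq_sym.
by rewrite !permM tpermL tpermR tz; case: (phi z =P x).
Qed.

Lemma delete_out x y phi z : x != y -> z != x -> z != y -> phi z != x -> phi z != y ->
  delete x y phi z = phi z.
Proof. by move=> xy zx zy /negPf pzx /negPf pzy; rewrite deleteE // pzx pzy. Qed.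

Lemma setD_edge A x y : A :\: [set x; y] = (A :\ x) :\ y.
Proof. by apply/setP=> z; rewrite !inE negb_or -andbA andbCA. Qed.

Lemma closed_delete A x y phi : closed_by phi A -> x \in A -> y \in A -> x != y ->
  closed_by (delete x y phi) (A :\: [set x; y]).
Proof.
move=> phA xA yA xy; rewrite setD_edge.
have tA : closed_by (tperm x y * phi) A.
  apply/closed_byP=> z zA; rewrite permM closed_mem //.
  by case: tpermP.
by apply: closed_skip; rewrite ?closed_skip // !inE eq_sym xy.
Qed.

Section OneEdge.
Variables (A : {set D}) (x y : D) (phi : {perm D}).
Hypotheses (xA : x \in A) (yA : y \in A) (xy : x != y) (phA : closed_by phi A).
Local Notation A' := (A :\: [set x; y]).
Local Notation phi' := (delete x y phi).
Local Notation t := (tperm x y).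

Let yx : y != x. Proof. by rewrite eq_sym. Qed.

Let in_A' z : (z \in A') = [&& z != x, z != y & z \in A].
Proof. by rewrite !inE negb_or andbA. Qed.

Let phA' : closed_by phi' A'. Proof. exact: closed_delete. Qed.

Lemma delete_cases u : u \in A' ->
  (phi u \in A' /\ phi' u = phi u) \/
  (phi u \in [set x; y] /\ phi' u \in [set phi x; phi y]).
Proof.
rewrite in_A' => /and3P[ux uy uA]; have [uxy|] := boolP (phi u \in [set x; y]).
  right; split=> //; move: uxy; rewrite deleteE // !inE.
  have [_ _|_] := eqVneq (phi u) x => /=.
    by case: (phi y == y); [case: (phi x == x)|]; rewrite eqxx ?orbT.
  by move=> ->; case: (phi x == x); rewrite eqxx ?orbT.
rewrite !inE negb_or => /andP[pux puy]; left.
by rewrite pux puy closed_mem // delete_out.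
Qed.

Section OneGluing.
Variable al : {perm D}.
Hypothesis al'M : al \in matchings A'.
Local Notation al1 := (t * al)%g.

Let al1M : al1 \in matchings A.
Proof. by have := al'M; rewrite (matching_add_edge _ xA yA xy) => /andP[]. Qed.

Let al1x : al1 x = y.
Proof. by have := al'M; rewrite (matching_add_edge _ xA yA xy) => /andP[_ /eqP]. Qed.

Let al1y : al1 y = x.
Proof. by have [_ _ alK] := matchingsP _ _ al1M; have := alK x; rewrite al1x. Qed.

Let al1A' u : u \in A' -> al1 u = al u.
Proof.
by rewrite in_A' => /and3P[ux uy _]; rewrite permM tpermD // eq_sym.
Qed.

(** The vertices after a deletion are the former vertices with [x] and [y]
    bypassed, because the transposition commutes with [al]. *)
Lemma vertices_delete : (al * phi')%g = skip y (skip x (al1 * phi)).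
Proof.
have tal : (al1 = al * t)%g.
  have [pal _ _] := matchingsP _ _ al'M.
  apply: (perm_onC (tperm_on x y) pal).
  by rewrite disjoint_sym; apply/pred0P=> z /=; rewrite !inE negb_or; case: (z == x); case: (z == y); rewrite ?andbF.
have sx : (al1 * phi)%g x = (t * phi)%g x by rewrite permM al1x permM tpermL.
have sy : skip x (al1 * phi) y = skip x (t * phi) y.
  have sy : (al1 * phi)%g y = (t * phi)%g y by rewrite permM al1y permM tpermR.
  by rewrite !skipE sx sy.
rewrite /delete [skip y _]/skip [in RHS]/(skip y _) -sy mulgA; congr (_ * _)%g.
by rewrite /skip -sx tal !mulgA.
Qed.

Hypothesis xy_open : ~~ closed_by phi [set x; y].

(** The deleted edge connected [phi x] to [phi y]. A union of components of the
    remaining gluing that avoids both was already separate before, and one that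
    contains both must be everything. *)
Lemma connected_delete :
  connected A phi al1 =
  (A' != set0) && [forall S : {set D},
    [&& S \subset A', S != set0, closed_by phi' S & closed_by al S] ==>
    ~~ [disjoint S & [set phi x; phi y]] &&
    ((A' :&: [set phi x; phi y] \subset S) ==> (S == A'))].
Proof.
have xyC : phi x \in A' \/ phi y \in A'.
  rewrite !in_A' !closed_mem // xA yA !andbT -!negb_or -!in_set2.
  apply/orP; apply: contraNT xy_open; rewrite negb_or !negbK => /andP[px py].
  by apply/closed_byP=> z; rewrite !inE => /orP[]/eqP->; rewrite -in_set2.
have A'A : A' \subset A by apply: subsetDl.
have alA := closed_matching al1M.
apply/connectedP/andP => [[_ AP]|[A'0 /forallP AP]].
  split.
    by apply/set0Pn; case: xyC => [px|py]; [exists (phi x) | exists (phi y)].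
  apply/forallP=> S; apply/implyP=> /and4P[SA' S0 pS aS].
  have SA := subset_trans SA' A'A.
  have alS z : z \in S -> al1 z \in S.
    by move=> zS; rewrite al1A' ?(subsetP SA') // closed_mem.
  apply/andP; split.
    apply/negP=> dS; suff SE : S = A.
      by move: xA; rewrite -SE => /(subsetP SA'); rewrite in_A' eqxx.
    apply: AP => //; last by apply/closed_byP.
    apply/closed_byP=> z zS; have [[_ <-]|[_ pN]] := delete_cases (subsetP SA' _ zS).
      by rewrite closed_mem.
    by move/pred0P/(_ (phi' z)): dS; rewrite /= pN closed_mem // zS.
  apply/implyP=> NS; suff SE : S :|: [set x; y] = A.
    rewrite eqEsubset SA' -SE; apply/subsetP=> z; rewrite !inE negb_or.
    by case/andP=> /andP[/negPf -> /negPf ->]; rewrite !orbF.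
  apply: AP.
  - by rewrite subUset SA; apply/subsetP=> z; rewrite !inE => /orP[]/eqP->.
  - by apply/set0Pn; exists x; rewrite !inE eqxx orbT.
  - apply/closed_byP=> z; rewrite in_setU => /orP[zS|zxy].
      have [[_ <-]|[pz _]] := delete_cases (subsetP SA' _ zS).
        by rewrite in_setU closed_mem // zS.
      by rewrite in_setU pz orbT.
    have pzN : phi z \in [set phi x; phi y].
      by move: zxy; rewrite !inE => /orP[]/eqP->; rewrite eqxx ?orbT.
    rewrite in_setU; have [pz|pz] := boolP (phi z \in [set x; y]); rewrite ?orbT //.
    rewrite (subsetP NS) // inE pzN andbT in_setD pz closed_mem //.
    by move: zxy; rewrite !inE => /orP[]/eqP->.
  apply/closed_byP=> z; rewrite in_setU => /orP[zS|]; rewrite inE ?alS //.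
  by rewrite !inE => /orP[]/eqP->; rewrite ?al1x ?al1y eqxx ?orbT.
split=> [|S SA S0 pS aS]; first by apply/set0Pn; exists x.
have xyS : (x \in S) = (y \in S) by rewrite -al1x closed_mem.
have S'S : S :&: A' \subset S by apply: subsetIl.
have S'0 : S :&: A' != set0.
  apply: contraNneq xy_open => S'0.
  have SE : S = [set x; y]; last by rewrite -SE.
  have Sxy : S \subset [set x; y].
    apply/subsetP=> z zS; have := in_set0 z; rewrite -S'0 !inE zS (subsetP SA) //=.
    by rewrite andbT => /negbFE.
  have [z zS] := set0Pn _ S0.
  have xS : x \in S.
    by have := subsetP Sxy _ zS; rewrite !inE => /orP[]/eqP zE; [rewrite -zE | rewrite xyS -zE].
  apply/eqP; rewrite eqEsubset Sxy; apply/subsetP=> u.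
  by rewrite !inE => /orP[]/eqP->; rewrite -?xyS.
have xSN : x \in S -> [set phi x; phi y] \subset S.
  move=> xS; apply/subsetP=> u.
  by rewrite !inE => /orP[]/eqP->; rewrite closed_mem // -xyS.
have /implyP := AP (S :&: A'); rewrite subsetIr S'0 /=.
have -> : closed_by phi' (S :&: A').
  apply/closed_byP=> u; rewrite inE => /andP[uS uA']; rewrite inE [_ \in A']closed_mem // uA' andbT.
  have [[_ ->]|[pu puN]] := delete_cases uA'; first by rewrite closed_mem.
  apply: (subsetP (xSN _)) => //; move: uS; rewrite -(closed_mem _ pS).
  by move: pu; rewrite !inE => /orP[]/eqP->; rewrite -?xyS.
have -> : closed_by al (S :&: A').
  apply/closed_byP=> u; rewrite inE => /andP[uS uA'].
  by rewrite inE [_ \in A']closed_mem ?closed_matching // uA' andbT -al1A' // closed_mem.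
case/(_ isT)/andP => SN /implyP SE.
have xS : x \in S.
  case/pred0Pn: SN => u /= /andP[]; rewrite !inE => /andP[uS _] /orP[]/eqP uE.
    by move: uS; rewrite uE closed_mem.
  by move: uS; rewrite uE closed_mem // -xyS.
have /SE/eqP S'E : A' :&: [set phi x; phi y] \subset S :&: A'.
  by rewrite setIC setSI // xSN.
apply/eqP; rewrite eqEsubset SA; apply/subsetP=> z zA.
have [->//|zx] := eqVneq z x; have [->|zy] := eqVneq z y; first by rewrite -xyS.
by apply: (subsetP S'S); rewrite S'E in_A' zx zy.
Qed.

Let sg := (al1 * phi)%g.

Let closed_sg : closed_by sg A.
Proof.
by apply/closed_byP=> z zA; rewrite permM !closed_mem // closed_matching.
Qed.

Let sgx : sg x = phi y. Proof. by rewrite permM al1x. Qed.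
Let sgy : sg y = phi x. Proof. by rewrite permM al1y. Qed.

Let norb_delete_raw :
  norb (al * phi') A' + (sg x == x) + (skip x sg y == y) = norb sg A.
Proof.
rewrite vertices_delete -/sg -(norb_skip closed_sg xA).
rewrite -(norb_skip (closed_skip closed_sg xA) (_ : y \in _)) -?setD_edge; first by rewrite addnAC.
by rewrite !inE eq_sym xy.
Qed.

Section NotLeaf.
Hypotheses (py : phi y != x) (px : phi x != y).

(** If neither end of the edge is a leaf, then no vertex disappears. *)
Lemma norb_delete : norb (al * phi') A' = norb (al1 * phi) A.
Proof.
rewrite -norb_delete_raw sgx (negPf py) skipE (negPf yx) sgx sgy.
rewrite (_ : (if _ then _ else _) == y = false) ?addn0 //; apply/negbTE.
have [pxx|//] := eqVneq (phi x) x; apply: contraNneq xy_open => pyy.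
by apply/closed_byP=> z; rewrite !inE => /orP[]/eqP->; rewrite ?pxx ?pyy eqxx ?orbT.
Qed.

(** Only the two ends of the deleted edge can become leaves. *)
Lemma leaves_delete :
  (leaves A phi al1 \subset set0) = (leaves A' phi' al \subset [set phi x; phi y]).
Proof.
have lA z : (z \in leaves A phi al1) = (z \in A) && (sg z == z).
  by rewrite [LHS]inE -(permM al1).
have lA' z : (z \in leaves A' phi' al) = (z \in A') && (skip y (skip x sg) z == z).
  by rewrite [LHS]inE -(permM al) vertices_delete.
apply/subsetP/subsetP => lP z.
  rewrite lA' in_A' => /andP[/and3P[zx zy zA]].
  have sz : sg z == z = false.
    by apply/negbTE/negP=> E; have := lP z; rewrite lA zA E inE => /(_ isT).
  rewrite !skipE (negPf zx) (negPf zy) (negPf yx) !sgx !sgy.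
  have [szx|szx] := eqVneq (sg z) x.
    have [pyy|pyy] := eqVneq (phi y) y; last by rewrite !inE => /eqP ->; rewrite eqxx orbT.
    by case: ifP => _ /eqP <-; rewrite !inE eqxx ?orbT.
  have [szy|szy] := eqVneq (sg z) y; last by rewrite sz.
  by case: ifP => _ /eqP <-; rewrite !inE eqxx ?orbT.
rewrite lA => /andP[zA /eqP sz].
have zx : z != x by apply: contraNneq py => zx; rewrite -sgx -zx sz.
have zy : z != y by apply: contraNneq px => zy; rewrite -sgy -zy sz.
have := lP z; rewrite lA' in_A' zx zy zA /= !skipE (negPf zx) (negPf zy) !sz.
rewrite (negPf zx) (negPf zy) eqxx => /(_ isT); rewrite !inE -sgx -sgy -{1 2}sz.
by rewrite !(inj_eq perm_inj) (negPf zx) (negPf zy).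
Qed.

End NotLeaf.

Section Leaf.
Hypotheses (py : phi y = x) (px : phi x != y).

Let pxx : phi x != x.
Proof.
apply: contraNneq xy => E; apply/eqP/(@perm_inj _ phi).
by rewrite E py.
Qed.

Lemma norb_delete_leaf : norb (al1 * phi) A = (norb (al * phi') A').+1.
Proof.
rewrite -norb_delete_raw sgx py eqxx skipE (negPf yx) sgx sgy (negPf pxx).
by rewrite (negPf px) addn0 addn1.
Qed.

(** The corner between [y] and [x] is a leaf at the end of a pendant edge. When
    this edge is deleted, its other end, just before [phi x], may become a leaf
    in turn. *)
Lemma leaves_delete_leaf M :
  (leaves A phi al1 \subset x |: M) = (leaves A' phi' al \subset phi x |: (M :\ y)).
Proof.
have lA z : (z \in leaves A phi al1) = (z \in A) && (sg z == z).
  by rewrite [LHS]inE -(permM al1).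
have lA' z : (z \in leaves A' phi' al) = (z \in A') && (skip y (skip x sg) z == z).
  by rewrite [LHS]inE -(permM al) vertices_delete.
have sx : sg x = x by rewrite sgx py.
have skipsgE z : z != x -> skip x sg z = sg z.
  move=> zx; rewrite skipE (negPf zx).
  by case: eqP => // szx; case/eqP: zx; apply: (@perm_inj _ sg); rewrite szx sx.
apply/subsetP/subsetP => lP z.
  rewrite lA' in_A' => /andP[/and3P[zx zy zA]].
  rewrite skipE (negPf zy) !skipsgE // sgy.
  have [szy|szy] := eqVneq (sg z) y; first by move/eqP <-; rewrite !inE eqxx.
  by move=> sz; have := lP z; rewrite lA zA sz !inE (negPf zx) zy /= => ->; rewrite ?orbT.
rewrite lA => /andP[zA /eqP sz]; rewrite !inE; have [//|zx] := eqVneq z x.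
have zy : z != y by apply: contraNneq px => zy; rewrite -sgy -zy sz.
have := lP z; rewrite lA' in_A' zx zy zA /= skipE (negPf zy) skipsgE // sz (negPf zy).
rewrite eqxx => /(_ isT); rewrite !inE -sgy -{1}sz (inj_eq perm_inj) (negPf zy).
by case/andP.
Qed.

End Leaf.
End OneGluing.

Lemma card_edge (P : pred {perm D}) :
  #|[set al in matchings A | (al x == y) && P al]| =
  #|[set al in matchings A' | P (t * al)%g]|.
Proof.
rewrite -[RHS](card_imset _ (mulgI t)); apply: eq_card => al; rewrite inE.
apply/and3P/imsetP => [[alM alx Pal]|[be]].
  exists (t * al)%g; last by rewrite mulgA tperm2 mul1g.
  by rewrite inE matching_add_edge // mulgA tperm2 mul1g alM alx.
rewrite inE => /andP[beM Pbe] ->; split=> //; move: beM;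
by rewrite (matching_add_edge _ xA yA xy) => /andP[].
Qed.

End OneEdge.
End EdgeDeletion.

(** * Gluings with two components *)

Lemma card_sum_unique (T I : finType) (X : {set T}) (P : I -> pred T) :
  (forall x, x \in X -> exists i, P i x) ->
  (forall x i j, x \in X -> P i x -> P j x -> i = j) ->
  #|X| = \sum_i #|[set x in X | P i x]|.
Proof.
move=> Pex Puniq; transitivity (\sum_(x in X) \sum_i (P i x : nat)).
  rewrite -sum1_card; apply: eq_bigr => x xX; have [i Pi] := Pex x xX.
  rewrite (bigD1 i) //= Pi big1 ?addn0 // => j ji.
  by case Pj: (P j x) => //; rewrite (Puniq x i j) ?eqxx in ji.
rewrite exchange_big; apply: eq_bigr => i _ /=.
rewrite -sum1_card [RHS](eq_bigl (fun x => (x \in X) && P i x)); last by move=> x; rewrite inE.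
by rewrite big_mkcondr; apply: eq_bigr => x _; case: (P i x).
Qed.

Section Restriction.
Variable D : finType.
Implicit Types (A B M S : {set D}) (phi al s : {perm D}) (x y z : D).

Lemma eq_in_connected A phi al al' :
  {in A, al =1 al'} -> connected A phi al = connected A phi al'.
Proof.
move=> eqal; congr (_ && _); apply: eq_forallb => S.
by case SA: (S \subset A) => //=; rewrite (@eq_in_closed _ al al' S) // => z zS;
  rewrite eqal // (subsetP SA).
Qed.

Lemma eq_in_norb_vertices A phi al al' :
  closed_by phi A -> closed_by al A -> {in A, al =1 al'} ->
  norb (al * phi) A = norb (al' * phi) A.
Proof.
move=> phA alA eqal; apply: eq_in_norb => [|z zA]; last by rewrite !permM eqal.
by apply/closed_byP=> z zA; rewrite permM !closed_mem.
Qed.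

Lemma restrict_closed S s : closed_by s S ->
  exists s', [/\ perm_on S s', {in S, s' =1 s} & {in ~: S, s' =1 id}].
Proof.
move=> sS; have injf : injective (fun z => if z \in S then s z else z).
  move=> u v; case: ifP => uS; case: ifP => vS E //; first exact: perm_inj E.
    by rewrite -E closed_mem // uS in vS.
  by rewrite E closed_mem // vS in uS.
exists (perm injf); split=> [|z zS|z]; rewrite ?permE ?zS //.
  by apply/subsetP=> z; rewrite inE permE; case: ifP => //; rewrite eqxx.
by rewrite inE => /negPf ->.
Qed.

Lemma matching_mul A B al be : [disjoint A & B] ->
  al \in matchings A -> be \in matchings B ->
  [/\ (al * be)%g \in matchings (A :|: B), {in A, (al * be)%g =1 al}
    & {in B, (al * be)%g =1 be}].
Proof.
move=> dAB alA beB; have [pal alN alK] := matchingsP _ _ alA.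
have [pbe beN beK] := matchingsP _ _ beB.
have AB z : z \in A -> z \notin B.
  by move=> zA; apply: contraTN dAB => zB; apply/pred0Pn; exists z; rewrite /= zA.
have eA : {in A, (al * be)%g =1 al}.
  by move=> z zA; rewrite permM (out_perm pbe) // AB // perm_closed.
have eB : {in B, (al * be)%g =1 be}.
  by move=> z zB; rewrite permM (out_perm pal) //; apply: contraL zB; apply: AB.
have eC z : z \notin A -> z \notin B -> (al * be)%g z = z.
  by move=> zA zB; rewrite permM (out_perm pal) // (out_perm pbe).
split=> //; apply/matchingsP; split=> [|z|z].
- apply/subsetP=> z; rewrite !inE; apply: contraNT; rewrite negb_or => /andP[zA zB].
  by rewrite eC.
- by rewrite inE => /orP[zA|zB]; [rewrite eA // alN | rewrite eB // beN].
have [zA|zA] := boolP (z \in A); first by rewrite !eA // perm_closed.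
have [zB|zB] := boolP (z \in B); first by rewrite !eB // perm_closed.
by rewrite !eC.
Qed.

Lemma matching_restrict A B al al' : B \subset A -> al \in matchings A ->
  closed_by al B -> perm_on B al' -> {in B, al' =1 al} -> al' \in matchings B.
Proof.
move=> BA alA alB pal' eqal; have [_ alN alK] := matchingsP _ _ alA.
apply/matchingsP; split=> // [z zB|z]; first by rewrite eqal // alN // (subsetP BA).
have [zB|zB] := boolP (z \in B); first by rewrite !eqal ?closed_mem // alK.
by rewrite !(out_perm pal').
Qed.

Lemma leavesU A B phi al : leaves (A :|: B) phi al = leaves A phi al :|: leaves B phi al.
Proof. by apply/setP=> z; rewrite !inE andb_orl. Qed.

Lemma eq_in_leaves A phi al al' : {in A, al =1 al'} -> leaves A phi al = leaves A phi al'.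
Proof. by move=> eqal; apply/setP=> z; rewrite !inE; case zA: (z \in A) => //=; rewrite eqal. Qed.

Lemma leaves_sub A phi al : leaves A phi al \subset A.
Proof. by apply/subsetP=> z; rewrite inE => /andP[]. Qed.

Lemma eq_in_gluings A n phi phi' M M' g : closed_by phi A ->
  {in A, phi =1 phi'} -> {in A, M =i M'} ->
  gluings A n phi M g = gluings A n phi' M' g.
Proof.
move=> phA eqphi eqM; apply/setP=> al; rewrite [LHS]inE [RHS]inE.
case alM: (al \in matchings A) => //=; have alA := closed_matching alM.
congr [&& _, _ & _].
- congr (_ && _); apply: eq_forallb => S.
  by case SA: (S \subset A) => //=; rewrite (@eq_in_closed _ phi phi' S) // => z zS;
    rewrite eqphi // (subsetP SA).
- have -> : leaves A phi al = leaves A phi' al.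
    apply/setP=> z; rewrite !inE; case zA: (z \in A) => //=.
    by rewrite eqphi // closed_mem.
  apply/subsetP/subsetP => lM z zl; have := lM z zl;
  by rewrite eqM // (subsetP (leaves_sub A phi' al)).
rewrite /euler; congr (((_ + _ + _).*2) == _); apply: eq_in_norb.
  by apply/closed_byP=> z zA; rewrite permM !closed_mem.
by move=> z zA; rewrite !permM eqphi // closed_mem.
Qed.

(** Such a gluing is a product of a gluing of [A] and a gluing of [B]. With
    [n.+1] faces its Euler characteristic is 4 - 2 g, the sum of 2 - 2 g1 and 2
    - 2 (g - g1). *)
Lemma card_two_components A B phi (x y : D) n g :
  closed_by phi A -> closed_by phi B -> [disjoint A & B] ->
  x \in A -> y \in B -> norb phi A + norb phi B = n.+1 ->
  #|[set al in matchings (A :|: B) |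
      [&& closed_by al A, connected A phi al, connected B phi al,
          leaves (A :|: B) phi al \subset [set x; y] &
          (norb (al * phi) (A :|: B) + n + 2 * g).*2 == #|A :|: B| + 6]]|
  = \sum_(g1 < g.+1) #|gluings A (norb phi A) phi [set x] g1| *
                     #|gluings B (norb phi B) phi [set y] (g - g1)|.
Proof.
move=> phA phB dAB xA yB nE; set X := [set al in _ | _].
have AB z : z \in A -> z \notin B.
  by move=> zA; apply: contraTN dAB => zB; apply/pred0Pn; exists z; rewrite /= zA.
have cAB : #|A :|: B| = #|A| + #|B|.
  by rewrite cardsU (disjoint_setI0 dAB) cards0 subn0.
have xB := AB _ xA; have yA : y \notin A by apply: contraL yB; apply: AB.
have lAB al : (leaves (A :|: B) phi al \subset [set x; y]) =
    (leaves A phi al \subset [set x]) && (leaves B phi al \subset [set y]).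
  rewrite leavesU subUset; congr (_ && _).
    apply/subsetP/subsetP => lP z zl; have := lP z zl; rewrite !inE; last by move->.
    case/orP=> // /eqP zy.
    by rewrite zy (negPf (contraNN (subsetP (leaves_sub A phi al) y) yA)) in zl.
  apply/subsetP/subsetP => lP z zl; have := lP z zl; rewrite !inE; last by move->; rewrite orbT.
  case/orP=> // /eqP zx.
  by rewrite zx (negPf (contraNN (subsetP (leaves_sub B phi al) x) xB)) in zl.
have splitX al : al \in X -> exists al1 al2,
    [/\ al1 \in matchings A, al2 \in matchings B, al = (al1 * al2)%g,
        {in A, al1 =1 al} & {in B, al2 =1 al}].
  rewrite inE => /andP[alM /and5P[alA _ _ _ _]].
  have alAB := closed_matching alM.
  have alB : closed_by al B.
    apply/closed_byP=> z zB; have : al z \in A :|: B by rewrite closed_mem // inE zB orbT.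
    by rewrite inE closed_mem // (negPf (contraL (AB z) zB)).
  have [al1 [p1 e1 o1]] := restrict_closed alA.
  have [al2 [p2 e2 o2]] := restrict_closed alB.
  have al1M := matching_restrict (subsetUl A B) alM alA p1 e1.
  have al2M := matching_restrict (subsetUr A B) alM alB p2 e2.
  exists al1, al2; split=> //; have [_ eA eB] := matching_mul dAB al1M al2M.
  apply/permP=> z; have [zA|zA] := boolP (z \in A); first by rewrite eA // e1.
  have [zB|zB] := boolP (z \in B); first by rewrite eB // e2.
  have [pal _ _] := matchingsP _ _ alM.
  by rewrite (out_perm pal) ?inE ?negb_or ?zA // permM (out_perm p1) // (out_perm p2).
have memX al1 al2 g1 : g1 <= g -> al1 \in matchings A -> al2 \in matchings B ->
    ((al1 * al2)%g \in X) && euler A (norb phi A) phi (al1 * al2)%g g1 =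
    (al1 \in gluings A (norb phi A) phi [set x] g1) &&
    (al2 \in gluings B (norb phi B) phi [set y] (g - g1)).
  move=> g1g al1M al2M; have [alM eA eB] := matching_mul dAB al1M al2M.
  have A1 := closed_matching al1M; have B2 := closed_matching al2M.
  have alA : closed_by (al1 * al2)%g A by rewrite (eq_in_closed eA).
  have alB : closed_by (al1 * al2)%g B by rewrite (eq_in_closed eB).
  rewrite [_ \in X]in_set [al1 \in _]in_set [al2 \in _]in_set alM al1M al2M /= alA (eq_in_connected _ eA) (eq_in_connected _ eB).
  rewrite lAB (eq_in_leaves _ eA) (eq_in_leaves _ eB) /euler.
  rewrite (eq_in_norb_vertices phA alA eA) norbU //; last first.
    by apply/closed_byP=> z zA; rewrite permM !closed_mem.
  rewrite (eq_in_norb_vertices phA alA eA) (eq_in_norb_vertices phB alB eB) cAB.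
  set V1 := norb _ _; set V2 := norb _ _.
  case: (connected A _ _) => //=; case: (connected B _ _) => //=; last by rewrite !andbF.
  case: (_ \subset _) => //=; case: (_ \subset _) => //=; last by rewrite !andbF.
  case: (boolP (_ == #|A| + 4)) => [/eqP E1|_]; rewrite ?andbT ?andbF //=.
  move: nE g1g E1; move: (norb phi A) (norb phi B) #|A| #|B| V1 V2.
  by clear=> n1 n2 a b v1 v2 nE g1g E1; apply/eqP/eqP => E2; lia.
rewrite (@card_sum_unique _ _ X
  (fun (g1 : 'I_g.+1) al => euler A (norb phi A) phi al g1)).
- apply: eq_bigr => g1 _; rewrite -cardsX.
  have g1g : g1 <= g by rewrite -ltnS ltn_ord.
  rewrite -(card_in_imset (f := fun p : {perm D} * {perm D} => (p.1 * p.2)%g)).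
    apply: eq_card => al; rewrite inE; apply/andP/imsetP => [[alX alE]|[[al1 al2]]].
      have [al1 [al2 [m1 m2 alE' _ _]]] := splitX _ alX.
      exists (al1, al2) => //; rewrite inE /= -memX //; rewrite -alE' alX; exact: alE.
    rewrite inE /= => /andP[p1 p2] ->; apply/andP; rewrite memX // ?p1 //.
      by case/setIdP: p1.
    by case/setIdP: p2.
  move=> [al1 al2] [be1 be2] /setXP[/= /setIdP[m1 _] /setIdP[m2 _]].
  case/setXP=> /= /setIdP[m3 _] /setIdP[m4 _] E.
  have [_ eA eB] := matching_mul dAB m1 m2; have [_ eA' eB'] := matching_mul dAB m3 m4.
  have [p1 _ _] := matchingsP _ _ m1; have [p2 _ _] := matchingsP _ _ m2.
  have [p3 _ _] := matchingsP _ _ m3; have [p4 _ _] := matchingsP _ _ m4.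
  congr (_, _); apply/permP=> z.
    have [zA|zA] := boolP (z \in A); first by rewrite -eA // -eA' // E.
    by rewrite (out_perm p1) // (out_perm p3).
  have [zB|zB] := boolP (z \in B); first by rewrite -eB // -eB' // E.
  by rewrite (out_perm p2) // (out_perm p4).
- move=> al alX; have [al1 [al2 [m1 m2 alE e1 e2]]] := splitX _ alX.
  move: (alX); rewrite inE => /andP[_ /and5P[alA conA conB _ /eqP gE]].
  have alB : closed_by al B by rewrite -(eq_in_closed e2) closed_matching.
  have c1 : connected A phi al1 by rewrite (eq_in_connected _ e1).
  have c2 : connected B phi al2 by rewrite (eq_in_connected _ e2).
  have [g1 /eqP E1] := euler_exists phA m1 c1.
  have [g2 /eqP E2] := euler_exists phB m2 c2.
  have A1 := closed_matching m1; have B2 := closed_matching m2.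
  rewrite (eq_in_norb_vertices phA A1 e1) in E1.
  rewrite (eq_in_norb_vertices phB B2 e2) in E2.
  move: gE; rewrite norbU // ?cAB; last first.
    by apply/closed_byP=> z zA; rewrite permM !closed_mem.
  move=> gE; have g1g : g1 < g.+1.
    move: nE gE E1 E2; move: (norb phi A) (norb phi B) (norb (al * phi) A) (norb (al * phi) B) #|A| #|B|.
    by clear=> n1 n2 v1 v2 a b; lia.
  by exists (Ordinal g1g); rewrite /euler E1.
by move=> al i j _ E1 E2; apply/val_inj/(euler_inj E1 E2).
Qed.

End Restriction.

(** * Systems of polygons *)

Section Polygons.
Variable D : finType.
Implicit Types (A M S : {set D}) (phi al s : {perm D}) (x y z : D).
Implicit Types (c : seq D) (cs r : seq (seq D)).

Definition sides cs : {set D} := [set z in flatten cs].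

(** Polygons are lists of sides in cyclic order, so that the head of a list
    marks a corner of the polygon. *)
Definition polygons phi cs :=
  [/\ uniq (flatten cs), [::] \notin cs & all (fcycle phi) cs].

Lemma polygons_cons phi c cs :
  polygons phi (c :: cs) <->
  [/\ polygons phi cs, c != [::], fcycle phi c, uniq c &
      {in c, forall z, z \notin flatten cs}].
Proof.
rewrite /polygons /= cat_uniq inE negb_or [_ == c]eq_sym.
split=> [[/and3P[uc hN ucs] /andP[c0 cs0] /andP[fc fcs]]|].
  split=> // z zc; apply: contra hN => zcs; apply/hasP; by exists z.
case=> -[-> -> ->] -> -> -> cN; split=> //; rewrite andbT /=.
by apply/hasPn => z; apply: contraL => /cN.
Qed.

Lemma sides_cons c cs : sides (c :: cs) = [set z in c] :|: sides cs.
Proof. by apply/setP=> z; rewrite !inE mem_cat. Qed.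

Lemma closed_cycle phi c : fcycle phi c -> closed_by phi [set z in c].
Proof.
move=> fc; apply/closed_byP=> z; rewrite !inE => zc.
by rewrite (eqP (next_cycle fc zc)) mem_next.
Qed.

Lemma closed_sides phi cs : polygons phi cs -> closed_by phi (sides cs).
Proof.
elim: cs => [|c cs IH]; first by move=> _; apply/closed_byP=> z; rewrite inE.
case/polygons_cons=> /IH csP _ fc _ _; rewrite sides_cons.
by apply/closed_byP=> z; rewrite inE => /orP[]zc; rewrite inE closed_mem ?zc ?orbT ?closed_cycle //;
   rewrite [X in _ || X]closed_mem ?zc ?orbT.
Qed.

Lemma porbit_cycle phi c z : fcycle phi c -> z \in c -> porbit phi z = [set u in c].
Proof.
move=> fc zc; apply/setP=> u; rewrite inE -(fconnect_cycle fc zc).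
by apply/porbit_iterP/idP => [[k ->]|/iter_findex <-]; [rewrite fconnect_iter | exists (findex phi z u)].
Qed.

Lemma norb_sides phi cs : polygons phi cs -> norb phi (sides cs) = size cs.
Proof.
elim: cs => [|c cs IH]; first by move=> _; rewrite /norb (_ : sides [::] = set0) ?imset0 ?cards0 //; apply/setP=> z; rewrite !inE.
case/polygons_cons=> csP c0 fc uc cN; rewrite sides_cons norbU ?closed_cycle //.
  rewrite IH // /norb (_ : _ @: _ = [set [set u in c]]) ?cards1 //.
  apply/setP=> P; rewrite inE; apply/imsetP/eqP => [[z]|->].
    by rewrite inE => zc ->; apply: porbit_cycle.
  by case: c c0 fc {uc cN} => // z c _ fc; exists z; rewrite ?inE ?eqxx // (porbit_cycle fc) ?inE ?eqxx.
by apply/pred0P=> z /=; rewrite !inE; case zc: (z \in c) => //=; apply/negbTE/cN.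
Qed.

Lemma polygons_perm phi cs cs' : perm_eq cs cs' -> polygons phi cs -> polygons phi cs'.
Proof.
move=> pcs [ucs cs0 fcs]; split.
- by rewrite -(perm_uniq (perm_flatten pcs)).
- by rewrite -(perm_mem pcs).
by rewrite -(perm_all _ pcs).
Qed.

Lemma sides_perm cs cs' : perm_eq cs cs' -> sides cs = sides cs'.
Proof. by move=> pcs; apply/setP=> z; rewrite !inE (perm_mem (perm_flatten pcs)). Qed.

Lemma polygons_rot phi k c r : polygons phi (c :: r) -> polygons phi (rot k c :: r).
Proof.
case/polygons_cons=> rP c0 fc uc cN; apply/polygons_cons; split=> //.
- by rewrite -size_eq0 size_rot size_eq0.
- by rewrite rot_cycle.
- by rewrite rot_uniq.
by move=> z; rewrite mem_rot; apply: cN.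
Qed.

Lemma sides_rot k c r : sides (rot k c :: r) = sides (c :: r).
Proof. by rewrite !sides_cons; congr (_ :|: _); apply/setP=> z; rewrite !inE mem_rot. Qed.

(** The leaves allowed by [M] lie at the corners that precede the sides in
    [M]. *)
Definition ngluings phi cs M g := #|gluings (sides cs) (size cs) phi M g|.

Lemma ngluings_perm phi cs cs' M g :
  perm_eq cs cs' -> ngluings phi cs M g = ngluings phi cs' M g.
Proof. by move=> pcs; rewrite /ngluings (sides_perm pcs) (perm_size pcs). Qed.

Lemma ngluings_rot phi k c r M g :
  ngluings phi (rot k c :: r) M g = ngluings phi (c :: r) M g.
Proof. by rewrite /ngluings sides_rot. Qed.

Lemma fpath_delete phi x y z c : x != y -> x \notin z :: c -> y \notin z :: c ->
  fpath phi z c -> fpath (delete x y phi) z c.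
Proof.
move=> xy; elim: c z => //= u c IH z; rewrite inE negb_or [y \in _]inE negb_or.
move=> /andP[xz xc] /andP[yz yc] /andP[/eqP zu uc]; rewrite IH // andbT.
move: xc yc; rewrite !inE !negb_or => /andP[xu _] /andP[yu _].
by rewrite delete_out ?zu // 1?eq_sym.
Qed.

Lemma fcycle_delete phi x y c : x != y -> x \notin c -> y \notin c ->
  fcycle phi c -> fcycle (delete x y phi) c.
Proof.
move=> xy; case: c => // z c; rewrite !in_cons => xc yc fc; apply: fpath_delete => //.
  by rewrite in_cons mem_rcons in_cons orbA orbb.
by rewrite in_cons mem_rcons in_cons orbA orbb.
Qed.

Lemma polygons_delete phi x y r : x != y -> x \notin flatten r -> y \notin flatten r ->
  polygons phi r -> polygons (delete x y phi) r.
Proof.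
move=> xy xr yr [ur r0 /allP fr]; split=> //; apply/allP=> c cr.
apply: fcycle_delete (fr c cr) => //.
  by apply: contra xr => xc; apply/flattenP; exists c.
by apply: contra yr => xc; apply/flattenP; exists c.
Qed.

Lemma fcycle_cons (f : D -> D) z c : fcycle f (z :: c) = fpath f z c && (f (last z c) == z).
Proof. by rewrite /= rcons_path. Qed.

End Polygons.

(** * Polygons after the deletion of an edge *)

Section DeletionSteps.
Variable D : finType.
Implicit Types (A M S : {set D}) (phi al s : {perm D}) (x y z h w : D).
Implicit Types (c : seq D) (cs r : seq (seq D)).

Lemma notin_cat z (s1 s2 : seq D) :
  (z \notin s1 ++ s2) = (z \notin s1) && (z \notin s2).
Proof. by rewrite mem_cat negb_or. Qed.

Lemma notin_cons (T : eqType) (z u : T) (s : seq T) :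
  (z \notin u :: s) = (z != u) && (z \notin s).
Proof. by rewrite in_cons negb_or. Qed.

Lemma fpath_rcons_delete phi x y h c : x != y -> x \notin h :: c -> y \notin h :: c ->
  fpath phi h c -> delete x y phi (last h c) = h -> fcycle (delete x y phi) (h :: c).
Proof. by move=> xy xc yc pc lc; rewrite fcycle_cons fpath_delete //= lc. Qed.

Lemma fcycle_fpath (f : D -> D) x h c : fcycle f [:: x, h & c] -> fpath f h c.
Proof. by rewrite fcycle_cons /= => /andP[/andP[]]. Qed.

(** An edge between two sides of one polygon cuts this polygon into two. *)
Lemma polygons_split phi x h1 c1 y h2 c2 r :
  polygons phi ((x :: (h1 :: c1) ++ y :: h2 :: c2) :: r) ->
  [/\ polygons (delete x y phi) ((h1 :: c1) :: (h2 :: c2) :: r),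
      [/\ x != y, phi x = h1, phi y = h2, phi (last h1 c1) = y & phi (last h2 c2) = x],
      x \notin (h1 :: c1) ++ (h2 :: c2) ++ flatten r &
      y \notin (h1 :: c1) ++ (h2 :: c2) ++ flatten r].
Proof.
case/polygons_cons=> rP _ fc uc cN.
move: fc; rewrite fcycle_cons /= cat_path last_cat /=.
case/andP=> /andP[/eqP px /andP[p1 /and3P[/eqP l1 /eqP py p2]]] /eqP l2.
have ucr : uniq ((x :: (h1 :: c1) ++ y :: h2 :: c2) ++ flatten r).
  case: (rP) => ur _ _; rewrite cat_uniq uc ur andbT.
  by apply/hasPn=> z; apply: contraL => /cN.
have perm1 : perm_eq ((x :: (h1 :: c1) ++ y :: h2 :: c2) ++ flatten r)
   (x :: y :: (h1 :: c1) ++ (h2 :: c2) ++ flatten r).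
  apply/seq.permP=> a; rewrite /= ?count_cat /= ?count_cat /=; lia.
move: ucr; rewrite (perm_uniq perm1) 2!cons_uniq => /and3P[xN yN uN].
move: xN; rewrite notin_cons => /andP[xy xN].
have [uN1 uN2] : uniq (h1 :: c1) /\ uniq ((h2 :: c2) ++ flatten r).
  by move: uN; rewrite cat_uniq => /and3P[].
have uN3 : uniq (h2 :: c2) by move: uN2; rewrite cat_uniq => /and3P[].
have := xN; rewrite !notin_cat => /and3P[xc1 xc2 xr].
have := yN; rewrite !notin_cat => /and3P[yc1 yc2 yr].
have h1x : h1 != x by move: xc1; rewrite notin_cons eq_sym => /andP[].
have h2y : h2 != y by move: yc2; rewrite notin_cons eq_sym => /andP[].
have neq u v c : u \notin v :: c -> last v c != u.
  by apply: contraNneq => <-; apply: mem_last.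
split; [split; first exact: uN | by split | by rewrite xc1 xc2 xr | by rewrite yc1 yc2 yr].
- by case: rP => _ r0 _; rewrite !in_cons.
rewrite [all _ _]/= -!/(fcycle _ (_ :: _)); apply/and3P; split.
- apply: fpath_rcons_delete => //; rewrite deleteE ?neq // l1 eq_sym (negPf xy) eqxx px.
  by rewrite (negPf h1x).
- apply: fpath_rcons_delete => //; rewrite deleteE ?neq // l2 eqxx py.
  by rewrite (negPf h2y).
by have [] := polygons_delete xy xr yr rP.
Qed.

(** The edge glues [z] to the preceding side [w]; its deletion removes both
    sides from the polygon. *)
Lemma polygons_leaf phi z h c w r :
  polygons phi ((z :: rcons (h :: c) w) :: r) ->
  [/\ polygons (delete z w phi) ((h :: c) :: r),
      [/\ z != w, phi z = h, phi w = z, z != h & w != h],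
      z \notin (h :: c) ++ flatten r & w \notin (h :: c) ++ flatten r].
Proof.
case/polygons_cons=> rP _ fc uc cN.
move: fc; rewrite fcycle_cons last_cons last_rcons -cats1 /= cat_path /=.
case/andP=> /andP[/eqP pz /and3P[p1 /eqP l1 _]] /eqP pw.
have ucr : uniq ((z :: rcons (h :: c) w) ++ flatten r).
  case: (rP) => ur _ _; rewrite cat_uniq uc ur andbT.
  by apply/hasPn=> u; apply: contraL => /cN.
have perm1 : perm_eq ((z :: rcons (h :: c) w) ++ flatten r)
   (z :: w :: (h :: c) ++ flatten r).
  by rewrite -cats1; apply/seq.permP=> a; rewrite /= ?count_cat /= ?count_cat /=; lia.
move: ucr; rewrite (perm_uniq perm1) 2!cons_uniq => /and3P[zN wN uN].
move: zN; rewrite notin_cons => /andP[zw zN].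
have uN1 : uniq (h :: c) by move: uN; rewrite cat_uniq => /and3P[].
have := zN; rewrite !notin_cat => /andP[zc zr].
have := wN; rewrite !notin_cat => /andP[wc wr].
have neq u v (t : seq D) : u \notin v :: t -> last v t != u.
  by apply: contraNneq => <-; apply: mem_last.
have hz : z != h by move: zc; rewrite notin_cons => /andP[].
have hw : w != h by move: wc; rewrite notin_cons => /andP[].
split; [split; first exact: uN | by split | by rewrite zc zr | by rewrite wc wr].
- by case: rP => _ r0 _; rewrite in_cons.
rewrite [all _ _]/= -!/(fcycle _ (_ :: _)); apply/andP; split.
- apply: fpath_rcons_delete => //; rewrite deleteE ?neq // l1 eq_sym (negPf zw) eqxx pz.
  by rewrite eq_sym (negPf hz).
by have [] := polygons_delete zw zr wr rP.
Qed.

(** An edge between two polygons turns them into one when it is deleted. The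
    polygon that is left is empty if both were monogons, which is excluded. *)
Lemma polygons_merge phi x c1 y c2 r : c1 ++ c2 != [::] ->
  polygons phi ((x :: c1) :: (y :: c2) :: r) ->
  [/\ polygons (delete x y phi) ((c1 ++ c2) :: r),
      [/\ x != y, phi x = head x c1 & phi y = head y c2],
      x \notin (c1 ++ c2) ++ flatten r & y \notin (c1 ++ c2) ++ flatten r].
Proof.
move=> c0 csP; case/polygons_cons: (csP) => rP1 _ f1 _ _.
case/polygons_cons: rP1 => rP _ f2 _ _.
have ucr : uniq ((x :: c1) ++ (y :: c2) ++ flatten r) by case: csP.
have perm1 : perm_eq ((x :: c1) ++ (y :: c2) ++ flatten r)
   (x :: y :: (c1 ++ c2) ++ flatten r).
  by apply/seq.permP=> a; rewrite /= ?count_cat /= ?count_cat /=; lia.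
move: ucr; rewrite (perm_uniq perm1) 2!cons_uniq => /and3P[xN yN uN].
move: xN; rewrite notin_cons => /andP[xy xN].
have uN1 : uniq (c1 ++ c2) by move: uN; rewrite cat_uniq => /and3P[].
have := xN; rewrite !notin_cat => /andP[/andP[xc1 xc2] xr].
have := yN; rewrite !notin_cat => /andP[/andP[yc1 yc2] yr].
have neq u v (t : seq D) : u \notin v :: t -> last v t != u.
  by apply: contraNneq => <-; apply: mem_last.
have yx : y == x = false by rewrite eq_sym (negPf xy).
have pE u (t : seq D) : fcycle phi (u :: t) -> phi u = head u t /\ phi (last u t) = u.
  case: t => [|v t]; rewrite fcycle_cons /=; first by move/eqP.
  by case/andP=> /andP[/eqP pu _] /eqP pl.
have [px lx] := pE _ _ f1; have [py ly] := pE _ _ f2.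
split; [split; first exact: uN | by split | by rewrite xc1 xc2 xr | by rewrite yc1 yc2 yr].
  by case: rP => _ r0 _; rewrite notin_cons eq_sym c0.
apply/andP; split; last by have [] := polygons_delete xy xr yr rP.
case: c1 c2 c0 {uN uN1 csP perm1} f1 f2 xN yN xc1 xc2 yc1 yc2 px lx py ly =>
  [|h1 c1] [|h2 c2] // _ f1 f2 xN yN xc1 xc2 yc1 yc2 px lx py ly.
- move: f2; rewrite fcycle_cons /= => /andP[/andP[_ f2] _].
  apply: fpath_rcons_delete => //; rewrite deleteE ?neq // [phi _]ly yx eqxx px eqxx.
  by rewrite py.
- rewrite cats0; move: f1; rewrite fcycle_cons /= => /andP[/andP[_ f1] _].
  apply: fpath_rcons_delete => //; rewrite deleteE ?neq // [phi (last _ _)]lx eqxx py eqxx px.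
  by move: xc1; rewrite notin_cons eq_sym => /andP[/negPf ->].
have h1x : (h1 == x) = false.
  by move: xc1; rewrite notin_cons eq_sym => /andP[/negPf ->].
have h2y : (h2 == y) = false.
  by move: yc2; rewrite notin_cons eq_sym => /andP[/negPf ->].
have {f1}f1 := fcycle_fpath f1; have {f2}f2 := fcycle_fpath f2.
rewrite cat_cons fcycle_cons cat_path last_cat /= !fpath_delete // !andbT.
rewrite !deleteE ?neq // [phi (last h1 c1)]lx [phi (last h2 c2)]ly eqxx yx eqxx.
by rewrite px py /= h1x h2y !eqxx.
Qed.

End DeletionSteps.

(** * Pendant edges and edges between two polygons *)

Section Steps.
Variable D : finType.
Implicit Types (A B M S : {set D}) (phi al s : {perm D}) (x y z h w : D).
Implicit Types (c : seq D) (cs r : seq (seq D)).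

Lemma mem_sides u c r : (u \in sides (c :: r)) = (u \in c) || (u \in sides r).
Proof. by rewrite sides_cons !inE. Qed.

Lemma cycle_sub_closed phi c S u : fcycle phi c -> closed_by phi S ->
  u \in c -> u \in S -> {subset c <= S}.
Proof.
move=> fc cS uc uS v vc; have : v \in porbit phi u by rewrite (porbit_cycle fc uc) inE.
by case/porbit_iterP=> k ->; rewrite closed_iter.
Qed.

(** If all that the deleted edge connected now lies on one polygon [c], then
    every invariant set that meets this polygon contains it, and the deletion
    preserves connectedness. *)
Lemma connected_delete_cycle A x y phi al c :
  x \in A -> y \in A -> x != y -> closed_by phi A ->
  al \in matchings (A :\: [set x; y]) -> ~~ closed_by phi [set x; y] ->
  fcycle (delete x y phi) c ->
  {in [set phi x; phi y], forall u, u \notin [set x; y] -> u \in c} ->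
  connected A phi (tperm x y * al)%g =
  connected (A :\: [set x; y]) (delete x y phi) al.
Proof.
move=> xA yA xy phA alM oxy fc Nc.
have [u uN uxy] : exists2 u, u \in [set phi x; phi y] & u \notin [set x; y].
  have [u uN|] := pickP [pred u in [set phi x; phi y] | u \notin [set x; y]].
    by case/andP: uN; exists u.
  move=> none; case/closed_byP: oxy => z zxy; have := none (phi z) => /=.
  have -> : phi z \in [set phi x; phi y].
    by move: zxy; rewrite !inE => /orP[]/eqP->; rewrite eqxx ?orbT.
  by move/negbFE.
have uA : u \in A by move: uN; rewrite !inE => /orP[]/eqP->; rewrite closed_mem.
rewrite connected_delete //; congr (_ && _); apply: eq_forallb => S.
case: (boolP [&& _, _, _ & _]) => //= /and4P[SA S0 pS aS].
apply/andP/idP => [[/pred0Pn[v /andP[/= vS vN]] /implyP]|/eqP ->].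
  apply; apply/subsetP=> v'; rewrite inE => /andP[]; rewrite inE => /andP[v'xy _] v'N.
  have vxy : v \notin [set x; y] by have := subsetP SA _ vS; rewrite inE => /andP[].
  exact: (cycle_sub_closed fc pS (Nc _ vN vxy) vS (Nc _ v'N v'xy)).
rewrite eqxx implybT; split=> //; apply/pred0Pn; exists u.
by rewrite /= uN andbT inE uxy uA.
Qed.

Definition nedge A n phi g x y := #|[set al in gluings A n phi set0 g | al x == y]|.

Lemma nedgeE A n phi g x y : x \in A -> y \in A -> x != y ->
  nedge A n phi g x y =
  #|[set al in matchings (A :\: [set x; y]) |
      [&& connected A phi (tperm x y * al)%g,
          leaves A phi (tperm x y * al)%g \subset set0 &
          euler A n phi (tperm x y * al)%g g]]|.
Proof.
move=> xA yA xy.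
rewrite -(card_edge xA yA xy (fun al => [&& connected A phi al, leaves A phi al \subset set0 & euler A n phi al g])).
by apply: eq_card => al; rewrite [LHS]inE [X in X && _ = _]inE [RHS]inE andbAC -andbA.
Qed.

(** The corner between a side and its successor becomes a leaf when the two are
    glued. *)
Lemma nedge_next A n phi g x y : x \in A -> phi y = x -> nedge A n phi g x y = 0.
Proof.
move=> xA py; apply: eq_card0 => al; rewrite inE; apply/negP=> /andP[].
rewrite inE => /andP[_ /and3P[_ /subsetP lP _]] /eqP alx.
by have := lP x; rewrite !inE xA alx py eqxx => /(_ isT).
Qed.

Lemma ngluings_no_leaf A n phi M g z : z \notin M ->
  (forall al, al \in gluings A n phi (z |: M) g -> phi (al z) != z) ->
  gluings A n phi (z |: M) g = gluings A n phi M g.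
Proof.
move=> zM noleaf; apply/setP=> al; apply/idP/idP => [alG|]; last first.
  rewrite !inE => /andP[-> /and3P[-> lP ->]]; rewrite andbT /=.
  exact: subset_trans lP (subsetUr _ _).
have lz := noleaf _ alG; move: alG.
rewrite !inE => /andP[-> /and3P[-> lP ->]]; rewrite andbT /=.
apply/subsetP=> u ul; have := subsetP lP u ul; rewrite in_setU1 => /orP[/eqP uz|//].
by move: ul; rewrite uz inE (negPf lz) andbF.
Qed.

Lemma sides_leaf z c w r : z \notin c ++ flatten r -> w \notin c ++ flatten r ->
  sides (c :: r) = sides ((z :: rcons c w) :: r) :\: [set z; w].
Proof.
rewrite !notin_cat => /andP[zc zr] /andP[wc wr]; rewrite !sides_cons; apply/setP=> u.
rewrite !(in_setU, in_setD, in_set, in_set1, in_cons, mem_rcons).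
have [->|uz] := eqVneq u z; first by rewrite (negPf zc) (negPf zr).
by have [->|uw] := eqVneq u w; first by rewrite (negPf wc) (negPf wr).
Qed.

(** Either the corner before [z] is not a leaf, or [z] is glued to the
    preceding side [w]. In the second case the deletion of this pendant edge
    moves the mark to the corner before [h], and [w] is no longer available as
    a mark. *)
Lemma leaf_step phi z h c w r M g :
  polygons phi ((z :: rcons (h :: c) w) :: r) -> z \notin M ->
  ngluings phi ((z :: rcons (h :: c) w) :: r) (z |: M) g =
  ngluings phi ((z :: rcons (h :: c) w) :: r) M g +
  ngluings (delete z w phi) ((h :: c) :: r) (h |: (M :\ w)) g.
Proof.
move=> csP zM; have [csP' [zw pz pw zh wh] zN wN] := polygons_leaf csP.
have phA := closed_sides csP; rewrite /ngluings (sides_leaf zN wN) /=.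
set A := sides (_ :: r); rewrite -/A in phA.
have zA : z \in A by rewrite mem_sides mem_head.
have wA : w \in A by rewrite mem_sides !in_cons mem_rcons mem_head !orbT.
have oxy : ~~ closed_by phi [set z; w].
  apply/negP=> /closed_byP/(_ z); rewrite !inE eqxx pz => /(_ isT).
  by rewrite ![h == _]eq_sym (negPf zh) (negPf wh).
rewrite -(cardsID [set al : {perm D} | phi (al z) == z]) addnC; congr (_ + _).
  apply: eq_card => al; rewrite in_setD in_set.
  apply/andP/idP => [[lz]|alG].
    rewrite !inE => /andP[-> /and3P[-> lP ->]]; rewrite andbT /=.
    apply/subsetP=> u ul; have := subsetP lP u ul; rewrite in_setU1 => /orP[/eqP uz|//].
 by move: ul; rewrite uz inE (negPf lz) andbF.
  move: alG; rewrite !inE => /andP[-> /and3P[-> lP ->]]; rewrite !andbT /=; split.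
    by apply: contraNN zM => lz; apply: (subsetP lP); rewrite inE zA.
  exact: subset_trans lP (subsetUr _ _).
pose P al := [&& connected A phi al, leaves A phi al \subset z |: M & euler A (size r).+1 phi al g].
transitivity #|[set al in matchings A | (al z == w) && P al]|.
  have lzE al : (phi (al z) == z) = (al z == w) by rewrite -[X in _ == X]pw (inj_eq perm_inj).
  apply: eq_card => al; apply/setIP/setIdP => [[/setIdP[alM alP]]|[alM /andP[lz alP]]].
    by rewrite in_set lzE => ->.
  by split; [apply/setIdP | rewrite in_set lzE].
rewrite (card_edge zA wA zw); apply: eq_card => al; rewrite [LHS]in_set [RHS]in_set.
case alM: (al \in matchings _) => //=; rewrite /P.
have fc : fcycle (delete z w phi) (h :: c) by case: csP' => _ _ /andP[].
rewrite (connected_delete_cycle zA wA zw phA alM oxy fc); last first.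
  move=> u; rewrite pz pw !inE => /orP[]/eqP->; first by rewrite eqxx.
  by rewrite eqxx.
have pzw : phi z != w by rewrite pz eq_sym.
rewrite (leaves_delete_leaf zA wA zw alM pw pzw) pz.
congr [&& _, _ & _]; rewrite /euler (norb_delete_leaf zA wA zw phA alM pw pzw).
rewrite (card_setD_edge zA wA zw).
by apply/eqP/eqP; move: (norb _ _) #|_| (size r); clear=> a b n; lia.
Qed.

(** When both sides of a digon are glued together, the result is a sphere with
    one edge, both ends of which are leaves. *)
Lemma leaf_step_digon phi z w r M g : polygons phi ([:: z; w] :: r) ->
  z \notin M -> (w \in M -> r != [::] \/ g != 0) ->
  ngluings phi ([:: z; w] :: r) (z |: M) g = ngluings phi ([:: z; w] :: r) M g.
Proof.
move=> csP zM wM; rewrite /ngluings ngluings_no_leaf // => al alG.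
have phA := closed_sides csP.
case/polygons_cons: (csP) => rP _ /=; rewrite andbT => /andP[/eqP pz /eqP pw].
rewrite inE andbT => zw cN.
move: alG; rewrite inE => /andP[alM /and3P[conA lP eA]].
have [pal alN alK] := matchingsP _ _ alM.
apply/negP=> /eqP lz; have alz : al z = w by apply: (@perm_inj _ phi); rewrite lz pw.
have alw : al w = z by rewrite -alz alK.
have zA : z \in sides ([:: z; w] :: r) by rewrite mem_sides mem_head.
have wA : w \in sides ([:: z; w] :: r) by rewrite mem_sides !inE eqxx orbT.
have wM' : w \in M.
  have := subsetP lP w; rewrite in_set wA alw pz eqxx => /(_ isT).
  by rewrite in_setU1 eq_sym (negPf zw).
have AE : [set z; w] = sides ([:: z; w] :: r).
  have [_ AP] := connectedP _ _ _ conA; apply: AP.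
  - by apply/subsetP=> u; rewrite !inE => /orP[]/eqP->; rewrite eqxx ?orbT.
  - by apply/set0Pn; exists z; rewrite !inE eqxx.
  - by apply/closed_byP=> u; rewrite !inE => /orP[]/eqP->; rewrite ?pz ?pw eqxx ?orbT.
  by apply/closed_byP=> u; rewrite !inE => /orP[]/eqP->; rewrite ?alz ?alw eqxx ?orbT.
have r0 : r = [::].
  case: r rP csP cN AE {wM phA alM conA lP eA pal alN alK zA wA} => // -[|u c] r.
    by case=> _.
  move=> _ _ cN AE; have : u \in sides ([:: z; w] :: (u :: c) :: r).
    by rewrite !mem_sides mem_head !orbT.
  rewrite -AE => uzw; have uzw' : u \in [:: z; w] by move: uzw; rewrite !inE.
  by have /negP[] := cN u uzw'; apply: mem_head.
case: (wM wM') => [|g0]; first by rewrite r0 eqxx.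
move: eA; rewrite /euler -AE cards2 (_ : z != w) // r0 /=.
have -> : norb (al * phi) [set z; w] = 2.
  rewrite norbU.
  - by rewrite !norb_set1.
  - by apply/closed_byP=> u; rewrite !inE => /eqP->; rewrite permM alz pw.
  by rewrite disjoints1 inE.
by move/eqP; move: g0; clear; lia.
Qed.

Lemma leaf_step_monogon phi z r M g : polygons phi ([:: z] :: r) -> z \notin M ->
  ngluings phi ([:: z] :: r) (z |: M) g = ngluings phi ([:: z] :: r) M g.
Proof.
move=> csP zM; rewrite /ngluings ngluings_no_leaf // => al.
rewrite inE => /andP[alM _]; have [_ alN _] := matchingsP _ _ alM.
case/polygons_cons: (csP) => rP _ /=; rewrite andbT => /eqP pz _ _.
by rewrite -[X in _ != X]pz (inj_eq perm_inj) alN // mem_sides mem_head.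
Qed.

Lemma sides_merge x c1 y c2 r :
  x \notin (c1 ++ c2) ++ flatten r -> y \notin (c1 ++ c2) ++ flatten r ->
  sides ((c1 ++ c2) :: r) = sides ((x :: c1) :: (y :: c2) :: r) :\: [set x; y].
Proof.
rewrite !notin_cat => /andP[/andP[xc1 xc2] xr] /andP[/andP[yc1 yc2] yr].
rewrite !sides_cons; apply/setP=> u.
rewrite !(in_setU, in_setD, in_set, in_set1, in_cons, mem_cat).
have [->|ux] := eqVneq u x; first by rewrite (negPf xc1) (negPf xc2) (negPf xr).
have [->|uy] := eqVneq u y; first by rewrite (negPf yc1) (negPf yc2) (negPf yr).
by rewrite orbA.
Qed.

(** Both ends of the deleted edge may become leaves, hence the two marks. *)
Lemma nedge_merge phi x c1 y c2 r g : c1 ++ c2 != [::] ->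
  polygons phi ((x :: c1) :: (y :: c2) :: r) ->
  nedge (sides ((x :: c1) :: (y :: c2) :: r)) (size r).+2 phi g x y =
  ngluings (delete x y phi) ((c1 ++ c2) :: r) [set phi x; phi y] g.
Proof.
move=> c0 csP; have [csP' [xy px py] xN yN] := polygons_merge c0 csP.
have phA := closed_sides csP; rewrite /ngluings (sides_merge xN yN) /=.
set A := sides (_ :: _ :: r); rewrite -/A in phA.
have xA : x \in A by rewrite mem_sides mem_head.
have yA : y \in A by rewrite !mem_sides mem_head orbT.
have pxN : phi x != x -> phi x \in c1 ++ c2.
  by rewrite px; case: c1 {c0 csP px csP' xN yN A phA xA yA} => [|h1 c1] /=; rewrite ?eqxx // inE eqxx.
have pyN : phi y != y -> phi y \in c1 ++ c2.
  rewrite py mem_cat; case: c2 {c0 csP py csP' xN yN A phA xA yA pxN} => [|h2 c2] /=; rewrite ?eqxx // inE eqxx.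
  by rewrite orbT.
have notc u : u \in c1 ++ c2 -> (u != x) && (u != y).
  move=> uc; apply/andP; split; apply: contraTneq uc => ->.
    by apply: contra xN => xc; rewrite mem_cat xc.
  by apply: contra yN => yc; rewrite mem_cat yc.
have pyx : phi y != x.
  have [->|/pyN/notc/andP[]//] := eqVneq (phi y) y; by rewrite eq_sym.
have pxy : phi x != y.
  by have [->|/pxN/notc/andP[]//] := eqVneq (phi x) x.
have oxy : ~~ closed_by phi [set x; y].
  have [h hc hE] : exists2 h, h \in c1 ++ c2 & h \in [set phi x; phi y].
    case: c1 c2 c0 px py {csP csP' xN yN A phA xA yA pxN pyN notc} => [|h1 c1] [|h2 c2] //= _ px py.
    - by exists h2; rewrite ?py !inE eqxx ?orbT.
    - by exists h1; rewrite ?px !inE eqxx ?orbT.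
    by exists h1; rewrite ?px !inE eqxx ?orbT.
  have /andP[hx hy] := notc _ hc; apply/negP=> /closed_byP cxy.
  move: hE; rewrite !inE => /orP[]/eqP hE.
    by have := cxy x; rewrite !inE -hE (negPf hx) (negPf hy) eqxx => /(_ isT).
  by have := cxy y; rewrite !inE -hE (negPf hx) (negPf hy) eqxx orbT => /(_ isT).
rewrite nedgeE //; apply: eq_card => al; rewrite [LHS]in_set [RHS]in_set.
case alM: (al \in matchings _) => //=.
have fc : fcycle (delete x y phi) (c1 ++ c2) by case: csP' => _ _ /andP[].
rewrite (connected_delete_cycle xA yA xy phA alM oxy fc); last first.
  move=> u; rewrite !inE negb_or => /orP[]/eqP -> /andP[ux uy]; [exact: pxN|exact: pyN].
rewrite (leaves_delete xA yA xy alM pyx pxy).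
congr [&& _, _ & _]; rewrite /euler (norb_delete xA yA xy phA alM oxy pyx pxy).
rewrite (card_setD_edge xA yA xy).
by apply/eqP/eqP; move: (norb _ _) #|_| (size r); clear=> a b n; lia.
Qed.

End Steps.

(** * Edges inside one polygon *)

Section SplitStep.
Variable D : finType.
Implicit Types (A B M S : {set D}) (phi al s : {perm D}) (x y z h w : D).
Implicit Types (c : seq D) (cs r : seq (seq D)).

Lemma sides_split x c1 y c2 r :
  x \notin c1 ++ c2 ++ flatten r -> y \notin c1 ++ c2 ++ flatten r ->
  sides (c1 :: c2 :: r) = sides ((x :: c1 ++ y :: c2) :: r) :\: [set x; y].
Proof.
rewrite !notin_cat => /and3P[xc1 xc2 xr] /and3P[yc1 yc2 yr].
rewrite !sides_cons; apply/setP=> u.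
rewrite !(in_setU, in_setD, in_set, in_set1, in_cons, mem_cat).
have [->|ux] := eqVneq u x; first by rewrite (negPf xc1) (negPf xc2) (negPf xr).
have [->|uy] := eqVneq u y; first by rewrite (negPf yc1) (negPf yc2) (negPf yr).
by rewrite /= orbA.
Qed.

(** When the deletion disconnects the surface, each end of the deleted edge
    lies in a component of its own. *)
Lemma connected_delete_components A x y phi al B :
  x \in A -> y \in A -> x != y -> closed_by phi A ->
  al \in matchings (A :\: [set x; y]) -> ~~ closed_by phi [set x; y] ->
  phi x \in A :\: [set x; y] -> phi y \in A :\: [set x; y] ->
  phi x \in B -> phi y \notin B -> B \subset A :\: [set x; y] ->
  closed_by (delete x y phi) B -> closed_by al B ->
  connected A phi (tperm x y * al)%g =
  connected B (delete x y phi) al && connected (A :\: [set x; y] :\: B) (delete x y phi) al.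
Proof.
move=> xA yA xy phA alM oxy; set A' := A :\: _; set phi' := delete x y phi.
move=> pxA pyA pxB pyB BA phB alB.
have phA' : closed_by phi' A' by apply: closed_delete.
have alA' := closed_matching alM; rewrite -/A' in alA'.
have closedD s S S' : closed_by s S -> closed_by s S' -> closed_by s (S :\: S').
  by move=> sS sS'; apply/closed_byP=> z; rewrite !inE !closed_mem.
rewrite connected_delete // -/A' -/phi'; apply/andP/andP => [[A'0 /forallP AP]|].
  have AP' S : S \subset A' -> closed_by phi' S -> closed_by al S -> S != set0 ->
      (phi x \in S) || (phi y \in S).
    move=> SA pS aS S0; have /implyP := AP S; rewrite SA S0 pS aS => /(_ isT)/andP[].
    by case/pred0Pn=> u /= /andP[uS]; rewrite !inE => /orP[]/eqP <-; rewrite uS ?orbT.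
  split.
    apply/connectedP; split=> [|S SB S0 pS aS]; first by apply/set0Pn; exists (phi x).
    have := AP' S (subset_trans SB BA) pS aS S0.
    rewrite (negPf (contraNN (subsetP SB _) pyB)) orbF => pxS.
    apply/eqP; rewrite eqEsubset SB -setD_eq0; apply/contraT => BS0.
    have := AP' (B :\: S) (subset_trans (subsetDl _ _) BA) (closedD _ _ _ phB pS) (closedD _ _ _ alB aS) BS0.
    by rewrite !inE pxS (negPf pyB) andbF.
  apply/connectedP; split=> [|S SB S0 pS aS].
    by apply/set0Pn; exists (phi y); rewrite inE pyB.
  have SA : S \subset A' := subset_trans SB (subsetDl _ _).
  have pxS : phi x \notin S by apply: contraTN pxB => /(subsetP SB); rewrite inE => /andP[].
  have := AP' S SA pS aS S0; rewrite (negPf pxS) /= => pyS.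
  apply/eqP; rewrite eqEsubset SB -setD_eq0; apply/contraT => BS0.
  have := AP' (A' :\: B :\: S) (subset_trans (subsetDl _ _) (subsetDl _ _))
     (closedD _ _ _ (closedD _ _ _ phA' phB) pS) (closedD _ _ _ (closedD _ _ _ alA' alB) aS) BS0.
  by rewrite in_setD (negPf pxS) in_setD pxB in_setD pyS.
case=> /connectedP[_ BP] /connectedP[_ CP]; split; first by apply/set0Pn; exists (phi x).
apply/forallP=> S; apply/implyP=> /and4P[SA S0 pS aS].
have closedI s S' : closed_by s S -> closed_by s S' -> closed_by s (S :&: S').
  by move=> sS sS'; apply/closed_byP=> z; rewrite !inE !closed_mem.
have SB : S :&: B != set0 -> B \subset S.
  move=> SB0; rewrite -(BP (S :&: B)) ?subsetIl ?subsetIr //; exact: closedI.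
have SC : S :&: (A' :\: B) != set0 -> A' :\: B \subset S.
  move=> SC0; rewrite -(CP (S :&: (A' :\: B))) ?subsetIl ?subsetIr //;
  by apply: closedI => //; apply: closedD.
apply/andP; split.
  have [SB0|/SB BS] := eqVneq (S :&: B) set0; last first.
    by apply/pred0Pn; exists (phi x); rewrite /= !inE eqxx andbT (subsetP BS).
  have CS : A' :\: B \subset S.
    apply: SC; have [u uS] := set0Pn _ S0; apply/set0Pn; exists u.
    have := in_set0 u; rewrite -SB0 !in_setI in_setD uS (subsetP SA) //= => ->.
    by [].
  by apply/pred0Pn; exists (phi y); rewrite /= !inE eqxx orbT andbT (subsetP CS) // inE pyB.
apply/implyP=> /subsetP NS; rewrite eqEsubset SA.
have pxS : phi x \in S by rewrite NS // in_setI pxA !inE eqxx.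
have pyS : phi y \in S by rewrite NS // in_setI pyA !inE eqxx orbT.
apply/subsetP=> u uA; have [uB|uB] := boolP (u \in B).
  by apply: (subsetP (SB _)) => //; apply/set0Pn; exists (phi x); rewrite inE pxS.
apply: (subsetP (SC _)); last by rewrite inE uB.
by apply/set0Pn; exists (phi y); rewrite inE pyS inE pyB.
Qed.

Lemma disconnected_component A phi al h1 h2 :
  closed_by phi A -> al \in matchings A -> h1 \in A -> h2 \in A ->
  (forall S : {set D}, S \subset A -> S != set0 -> closed_by phi S -> closed_by al S ->
     (h1 \in S) || (h2 \in S)) ->
  (forall S : {set D}, S \subset A -> h1 \in S -> h2 \in S ->
     closed_by phi S -> closed_by al S -> S = A) ->
  ~~ connected A phi al ->
  exists B : {set D}, [/\ B \subset A, closed_by phi B, h1 \in B, h2 \notin B & closed_by al B].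
Proof.
move=> phA alM h1A h2A meets both; rewrite negb_and negbK.
have -> : (A == set0) = false by apply/negbTE/set0Pn; exists h1.
have alA := closed_matching alM.
rewrite orFb negb_forall => /existsP[S]; rewrite negb_imply.
case/andP=> /and4P[SA S0 pS aS] SN.
have [h1S|h1S] := boolP (h1 \in S).
  exists S; split=> //; apply: contraNN SN => h2S.
  by rewrite (both S).
have h2S : h2 \in S by have := meets S SA S0 pS aS; rewrite (negPf h1S).
exists (A :\: S); split.
- exact: subsetDl.
- by apply/closed_byP=> z; rewrite !inE !closed_mem.
- by rewrite inE h1S.
- by rewrite inE h2S.
by apply/closed_byP=> z; rewrite !inE !closed_mem.
Qed.

(** If the surface stays connected after the deletion, then the number of faces
    has increased by one and the genus has dropped by one: this is the first
    term. Otherwise [B] is the set of sides of the component of [h1]. *)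
Lemma nedge_split phi x h1 c1 y h2 c2 r g :
  polygons phi ((x :: (h1 :: c1) ++ y :: h2 :: c2) :: r) ->
  let phi' := delete x y phi in
  let A' := sides ((h1 :: c1) :: (h2 :: c2) :: r) in
  nedge (sides ((x :: (h1 :: c1) ++ y :: h2 :: c2) :: r)) (size r).+1 phi g x y =
  (if g is g'.+1 then
     ngluings phi' ((h1 :: c1) :: (h2 :: c2) :: r) [set h1; h2] g' else 0) +
  \sum_(B : {set D} | [&& B \subset A', closed_by phi' B, h1 \in B & h2 \notin B])
    \sum_(g1 < g.+1) #|gluings B (norb phi' B) phi' [set h1] g1| *
      #|gluings (A' :\: B) (norb phi' (A' :\: B)) phi' [set h2] (g - g1)|.
Proof.
move=> csP phi' A'; have [csP' [xy px py l1 l2] xN yN] := polygons_split csP.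
have phA := closed_sides csP; have A'E := sides_split xN yN.
have phA' := closed_sides csP'; rewrite -/A' -/phi' in A'E phA'.
rewrite /ngluings -/A'.
set A := sides (_ :: r); rewrite -/A in phA A'E.
have xA : x \in A by rewrite mem_sides mem_head.
have yA : y \in A by rewrite mem_sides in_cons mem_cat mem_head !orbT.
have h1A : h1 \in A' by rewrite mem_sides mem_head.
have h2A : h2 \in A' by rewrite !mem_sides mem_head orbT.
have h12 : h1 != h2.
  have [u _ _] := csP'; move: u; rewrite /= => /andP[+ _].
  by apply: contraNneq => ->; rewrite mem_cat inE eqxx orbT.
have := h1A; rewrite A'E !inE negb_or => /andP[/andP[h1x h1y] _].
have := h2A; rewrite A'E !inE negb_or => /andP[/andP[h2x h2y] _].
have pyx : phi y != x by rewrite py.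
have pxy : phi x != y by rewrite px.
have oxy : ~~ closed_by phi [set x; y].
  by apply/negP=> /closed_byP/(_ x); rewrite !inE eqxx px (negPf h1x) (negPf h1y) => /(_ isT).
have nA' : norb phi' A' = (size r).+2 by rewrite norb_sides.
rewrite nedgeE // -A'E; set X := [set al in _ | _].
have memX al : (al \in X) = [&& al \in matchings A', connected A phi (tperm x y * al)%g,
    leaves A' phi' al \subset [set h1; h2] &
    (norb (al * phi') A' + (size r).+1 + 2 * g).*2 == #|A'| + 6].
  rewrite [LHS]in_set; case alM: (al \in matchings A') => //=.
  move: (alM); rewrite A'E => alM'; congr (_ && _).
  rewrite (leaves_delete xA yA xy alM' pyx pxy) -A'E px py; congr (_ && _).
  rewrite /euler -(norb_delete xA yA xy phA alM' oxy pyx pxy) (card_setD_edge xA yA xy).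
  by rewrite -A'E -(addnA _ 2 4).
rewrite -(cardsID [set al : {perm D} | connected A' phi' al]); congr (_ + _).
  case: g X memX => [|g] X memX.
    apply: eq_card0 => al; apply/negbTE; rewrite in_setI memX inE.
    apply/negP=> /andP[/and4P[alM _ _ /eqP E1] conA'].
    have [g' /eqP] := euler_exists phA' alM conA'; rewrite nA'; move: E1.
    by move: (norb _ _) (size r) #|A'|; clear=> a b c; lia.
  apply: eq_card => al; rewrite in_setI memX [in RHS]in_set inE.
  case alM: (al \in matchings A') => //=; rewrite andbC.
  case conA': (connected A' phi' al) => //=.
  have -> : connected A phi (tperm x y * al)%g.
    move: alM; rewrite A'E => alM'; rewrite (connected_delete xA yA xy phA alM' oxy) -A'E.
    have [A'0 AP] := connectedP _ _ _ conA'; rewrite A'0; apply/forallP=> S.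
    apply/implyP=> /and4P[SA S0 pS aS]; rewrite (AP S SA S0 pS aS) eqxx implybT andbT.
    by apply/pred0Pn; exists h1; rewrite /= h1A px !inE eqxx.
  rewrite /=; congr (_ && _); rewrite /euler.
  by apply/eqP/eqP; move: (norb _ _) (size r) #|A'|; clear=> a b c; lia.
have closedD s S S' : closed_by s S -> closed_by s S' -> closed_by s (S :\: S').
  by move=> sS sS'; apply/closed_byP=> z; rewrite !inE !closed_mem.
pose P (B : {set D}) (al : {perm D}) :=
  [&& B \subset A', closed_by phi' B, h1 \in B, h2 \notin B, closed_by al B,
      connected B phi' al & connected (A' :\: B) phi' al].
have conP (B : {set D}) al : [&& B \subset A', closed_by phi' B, h1 \in B & h2 \notin B] ->
    al \in matchings A' -> closed_by al B ->
    connected A phi (tperm x y * al)%g = connected B phi' al && connected (A' :\: B) phi' al.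
  case/and4P=> BA pB h1B h2B alM aB; move: alM BA; rewrite A'E => alM' BA.
  rewrite (@connected_delete_components A x y phi al B) // ?px ?py //.
    by rewrite -A'E.
  by rewrite -A'E.
rewrite (@card_sum_unique _ _ _ P); first last.
- move=> al B B' _ /and5P[BA pB h1B h2B /and3P[aB conB _]] /and5P[B'A pB' h1B' h2B' /and3P[aB' conB' _]].
  have closedI s : closed_by s B -> closed_by s B' -> closed_by s (B :&: B').
    by move=> sS sS'; apply/closed_byP=> z; rewrite !inE !closed_mem.
  have [_ BP] := connectedP _ _ _ conB; have [_ BP'] := connectedP _ _ _ conB'.
  have I0 : B :&: B' != set0 by apply/set0Pn; exists h1; rewrite inE h1B.
  transitivity (B :&: B').
    by apply/esym/BP; rewrite ?subsetIl ?closedI.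
  by apply/BP'; rewrite ?subsetIr ?closedI.
- move=> al; rewrite in_setD memX inE => /andP[disc /and4P[alM con _ _]].
  have conE := con; move: (alM); rewrite A'E => alM'.
  move: conE; rewrite (connected_delete xA yA xy phA alM' oxy) -A'E => /andP[_ /forallP AP].
  have [S SA S0 pS aS|S SA h1S h2S pS aS|B [BA pB h1B h2B aB]] :=
      disconnected_component phA' alM h1A h2A _ _ disc.
  + have /implyP := AP S; rewrite SA S0 pS aS => /(_ isT)/andP[/pred0Pn[u /= /andP[uS]]].
    by rewrite px py !inE => /orP[]/eqP<-; rewrite uS ?orbT.
  + have /implyP := AP S; rewrite SA pS aS andbT.
    have -> : S != set0 by apply/set0Pn; exists h1.
    case/(_ isT)/andP=> _ /implyP SP; apply/eqP/SP; apply/subsetP=> u.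
    by rewrite in_setI px py !inE => /andP[_ /orP[]/eqP->].
  have BB : [&& B \subset A', closed_by phi' B, h1 \in B & h2 \notin B] by apply/and4P.
  by exists B; rewrite /P BA pB h1B h2B aB /= -(conP B).
rewrite [RHS]big_mkcond /=; apply: eq_bigr => B _; case: ifP => BB; last first.
  apply: eq_card0 => al; rewrite in_set /P; apply/negP=> /andP[_ /and5P[b1 b2 b3 b4 _]].
  by rewrite b1 b2 b3 b4 in BB.
have [BA pB h1B h2B] := and4P BB.
have dB : [disjoint B & A' :\: B].
  by rewrite -setI_eq0; apply/eqP/setP=> u; rewrite !inE; case: (u \in B).
have BU : B :|: (A' :\: B) = A'.
  apply/setP=> u; rewrite in_setU in_setD; have [uB|//] := boolP (u \in B).
  by rewrite (subsetP BA).
have h2C : h2 \in A' :\: B by rewrite inE h2B.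
have nE : norb phi' B + norb phi' (A' :\: B) = (size r).+2.
  by rewrite -norbU // BU.
rewrite -(card_two_components g pB (closedD _ _ _ phA' pB) dB h1B h2C nE) BU.
apply: eq_card => al; rewrite in_set in_setD memX [RHS]in_set inE /P BA pB h1B h2B /=.
case alM: (al \in matchings A'); rewrite ?andbF //=.
case aB: (closed_by al B) => /=; rewrite ?andbF // (conP B) //.
case conB: (connected B phi' al); rewrite ?andbF //=.
case conC: (connected (A' :\: B) phi' al); rewrite ?andbF ?andbT //=.
rewrite (_ : connected A' phi' al = false) //=.
apply/negbTE/negP=> /connectedP[_ AP].
have B0 : B != set0 by apply/set0Pn; exists h1.
by have := AP B BA B0 pB aB => BE; rewrite BE h2A in h2B.
Qed.

End SplitStep.

(** * Gluings with marked corners *)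

Local Open Scope ring_scope.

(** The sum of [f p] over [0 < p <= m] with [p] congruent to [m] modulo 2: a
    pendant path of length k at a marked corner of a polygon with [m] sides
    uses 2 k of them and leaves a polygon with [p = m - 2 k] sides. *)
Fixpoint parity_sum (f : nat -> rat) (m : nat) : rat :=
  match m with
  | 0%N => 0
  | 1%N => f 1%N
  | (m'.+1).+1 => f m + parity_sum f m'
  end.

Lemma parity_sumSS f m : parity_sum f m.+2 = f m.+2 + parity_sum f m.
Proof. by []. Qed.

(** Two marked corners of one polygon, at distances [k] and [l] from each
    other: the pendant paths at both corners may share a segment, and each edge
    of this segment reduces both distances by one. *)
Fixpoint corner_sum (F : nat -> rat) (k l : nat) : rat :=
  F (k + l)%N +
  match k, l with k'.+1, l'.+1 => corner_sum F k' l' | _, _ => 0 end.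

Section Marks.
Variables (g n : nat) (K : seq nat -> rat).
Hypothesis KE : forall (D : finType) (phi : {perm D}) cs,
  polygons phi cs -> size cs = n -> (ngluings phi cs set0 g)%:R = K (shape cs).

Section OneType.
Variable D : finType.
Implicit Types (M : {set D}) (phi : {perm D}) (x y z h w : D).
Implicit Types (c : seq D) (cs r : seq (seq D)).

Lemma eq_in_ngluings phi cs M M' : polygons phi cs ->
  {in sides cs, M =i M'} -> ngluings phi cs M g = ngluings phi cs M' g.
Proof.
by move=> csP eqM; rewrite /ngluings (eq_in_gluings _ _ (closed_sides csP) (fun _ _ => erefl _) eqM).
Qed.

(** Repeated removal of the pendant edge at the marked corner. *)
Lemma one_mark phi z c r : polygons phi ((z :: c) :: r) -> (size r).+1 = n ->
  (ngluings phi ((z :: c) :: r) [set z] g)%:R =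
  parity_sum (fun p => K (p :: shape r)) (size c).+1.
Proof.
move=> csP rn; have [m] := ubnP (size c); elim: m => // m IHm in phi z c csP *.
rewrite ltnS => cm; rewrite -[[set z]]setU0.
case/lastP: c csP cm => [|c w] csP cm.
  by rewrite leaf_step_monogon ?inE // KE.
case: c csP cm => [|h c] csP cm.
  by rewrite leaf_step_digon ?inE // KE //= addr0.
have [csP' _ _ _] := polygons_leaf csP.
rewrite leaf_step ?inE // natrD KE // set0D setU0 IHm //; last first.
  by move: cm; rewrite size_rcons /=; lia.
by rewrite ?size_rcons /= ?size_rcons.
Qed.

(** The pendant paths at corners of different polygons are independent. *)
Lemma two_marks phi z1 c1 z2 c2 r :
  polygons phi ((z1 :: c1) :: (z2 :: c2) :: r) -> (size r).+2 = n ->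
  (ngluings phi ((z1 :: c1) :: (z2 :: c2) :: r) [set z1; z2] g)%:R =
  parity_sum (fun p => parity_sum (fun q => K (q :: p :: shape r)) (size c2).+1)
    (size c1).+1.
Proof.
move=> csP rn; have [m] := ubnP (size c1); elim: m => // m IHm in phi z1 c1 csP *.
rewrite ltnS => cm.
have z12 : z1 \notin [set z2].
  rewrite inE; case: csP => u _ _; move: u => /= /andP[+ _].
  by apply: contraNneq => ->; rewrite mem_cat mem_head orbT.
have swap : perm_eq ((z1 :: c1) :: (z2 :: c2) :: r) ((z2 :: c2) :: (z1 :: c1) :: r).
  by apply/seq.permP=> a /=; rewrite addnCA.
have base : (ngluings phi ((z1 :: c1) :: (z2 :: c2) :: r) [set z2] g)%:R =
  parity_sum (fun q => K (q :: (size c1).+1 :: shape r)) (size c2).+1.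
  by rewrite (ngluings_perm _ _ _ swap) one_mark //; apply: polygons_perm csP.
case/lastP: c1 csP cm {swap} base => [|c w] csP cm base.
  by rewrite leaf_step_monogon.
case: c csP cm base => [|h c] csP cm base.
  rewrite leaf_step_digon ?base ?[size (rcons _ _)]/= ?parity_sumSS ?addr0 //.
  by move=> _; left.
have [csP' _ _ wN] := polygons_leaf csP.
have wz2 : w != z2.
  by apply: contraNneq wN => ->; rewrite mem_cat /= mem_head orbT.
rewrite leaf_step // natrD base (_ : h |: _ = [set h; z2]); last first.
  by apply/setP=> u; rewrite !inE; case: (u =P z2) => [->|_]; rewrite ?andbT ?andbF // [z2 == w]eq_sym wz2.
rewrite IHm //; last by move: cm; rewrite size_rcons /=; lia.
by rewrite ?size_rcons /= ?size_rcons.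
Qed.

Lemma digon_sphere phi z w : polygons phi [:: [:: z; w]] ->
  gluings (sides [:: [:: z; w]]) 1 phi [set z; w] 0 = [set tperm z w].
Proof.
case/polygons_cons=> _ _ /=; rewrite andbT => /andP[/eqP pz /eqP pw].
rewrite inE andbT => zw _.
have -> : sides [:: [:: z; w]] = [set z; w] by apply/setP=> u; rewrite !inE.
have pzw : closed_by phi [set z; w].
  by apply/closed_byP=> u; rewrite !inE => /orP[]/eqP->; rewrite ?pz ?pw eqxx ?orbT.
have tM : tperm z w \in matchings [set z; w].
  apply/matchingsP; split; [exact: tperm_on | | exact: tpermK].
  by move=> u; rewrite !inE => /orP[]/eqP->; rewrite ?tpermL ?tpermR // eq_sym.
apply/setP=> al; rewrite [RHS]in_set1; apply/idP/eqP => [|->].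
  rewrite in_set => /andP[/matchingsP[pal alN alK] _].
  have alz : al z = w.
    have := perm_closed z pal; rewrite !inE eqxx /= => /orP[]/eqP // alz.
    by have := alN z; rewrite !inE eqxx alz eqxx => /(_ isT).
  apply/permP=> u; case: tpermP => [->|->|/eqP uz /eqP uw] //; first by rewrite -alz alK.
  by rewrite (out_perm pal) // !inE negb_or uz uw.
rewrite in_set tM andTb; apply/and3P; split.
- apply/connectedP; split=> [|S SA /set0Pn[u uS] pS aS]; first by apply/set0Pn; exists z; rewrite !inE eqxx.
  have /andP[zS wS] : (z \in S) && (w \in S).
    have := subsetP SA u uS; rewrite !inE => /orP[]/eqP uE; rewrite uE in uS.
      by rewrite uS -pz closed_mem.
    by rewrite uS -pw closed_mem ?uS.
  by apply/eqP; rewrite eqEsubset SA; apply/subsetP=> v; rewrite !inE => /orP[]/eqP->.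
- exact: leaves_sub.
rewrite /euler cards2 zw norbU; first last.
- by rewrite disjoints1 inE.
- by apply/closed_byP=> u; rewrite !inE => /eqP->; rewrite permM tpermL pw.
by rewrite !norb_set1.
Qed.

(** As long as the corner before [z1] is a leaf, its pendant edge is removed,
    which brings both marks closer on either side. The last term is the gluing
    of the whole polygon to a segment between the two corners. *)
Lemma same_polygon_marks phi z1 c1 z2 c2 r :
  polygons phi ((z1 :: c1 ++ z2 :: c2) :: r) -> (size r).+1 = n ->
  (ngluings phi ((z1 :: c1 ++ z2 :: c2) :: r) [set z1; z2] g)%:R =
  corner_sum (parity_sum (fun p => K (p :: shape r))) (size c1).+1 (size c2).+1
  + [&& g == 0%N, r == [::] & size c1 == size c2]%:R.
Proof.
move=> csP rn; set F := parity_sum _.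
have FE k z c phi' : polygons phi' ((z :: c) :: r) -> (size c).+1 = k ->
  (ngluings phi' ((z :: c) :: r) [set z] g)%:R = F k.
  by move=> cP <-; rewrite one_mark.
elim: c1 => [|h c1 IH] in phi z1 c2 csP *.
all: have z12 : z1 \notin [set z2] by
  rewrite inE; case: csP => u _ _; move: u => /= /andP[+ _];
  apply: contraNneq => ->; rewrite !(mem_cat, in_cons) eqxx ?orbT.
- have base : (ngluings phi ((z1 :: z2 :: c2) :: r) [set z2] g)%:R = F (size c2).+2.
    rewrite -(ngluings_rot phi 1) rot1_cons; apply: FE; last by rewrite size_rcons.
    by rewrite -rcons_cons -rot1_cons; apply: polygons_rot.
  case/lastP: c2 csP base => [|c2 w] csP base; last first.
    have [csP' _ _ wN] := polygons_leaf csP.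
    have wz2 : w != z2 by apply: contraNneq wN => ->; rewrite mem_head.
    rewrite -[_ ++ _]/(rcons (z2 :: c2) w) leaf_step // natrD base.
    rewrite (_ : z2 |: _ = [set z2]); last first.
      by apply/setP=> u; rewrite !inE; case: (u == z2); rewrite ?andbF.
    rewrite (FE (size c2).+1) // size_rcons /= !andbF !addr0.
    by [].
  have cs11 : corner_sum F 1 1 = F 2 by rewrite /corner_sum [F (0 + 0)%N](_ : _ = 0) ?addr0.
  have [rg|] := boolP ((r != [::]) || (g != 0%N)).
    rewrite leaf_step_digon //; last by move=> _; apply/orP.
    rewrite base cs11 (_ : [&& _, _ & _] = false) ?addr0 //.
    by move: rg; case: (r =P [::]) => //= _; [case: (g == 0%N) | rewrite andbF].
  rewrite negb_or !negbK => /andP[/eqP r0 /eqP g0].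
  move: (base) csP; rewrite r0 /ngluings g0 => base1 csP.
  rewrite digon_sphere // cards1 cs11.
  have -> : F 2 = 0.
    rewrite -[RHS](_ : 0%:R = 0) //= -base; apply: congr1; rewrite r0 g0; apply: eq_card0 => al.
    apply/negbTE/negP=> alG.
    have : al \in gluings (sides [:: [:: z1; z2]]) 1 phi [set z1; z2] 0.
      move: alG; rewrite !in_set => /andP[-> /and3P[-> lP ->]]; rewrite /= andbT.
      exact: subset_trans lP (subsetUr _ _).
    rewrite digon_sphere // inE => /eqP alE; move: alG; rewrite alE in_set => /andP[_ /and3P[_ lP _]].
    have := subsetP lP z1; rewrite in_set mem_sides mem_head tpermL /=.
    case/polygons_cons: csP => _ _ /=; rewrite andbT => /andP[_ /eqP ->] _ _.
    by rewrite eqxx => /(_ isT); rewrite (negPf z12).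
  by rewrite !eqxx add0r.
have base : (ngluings phi ((z1 :: (h :: c1) ++ z2 :: c2) :: r) [set z2] g)%:R = F ((size c1).+2 + (size c2).+1)%N.
  have rotE : rot (size (z1 :: h :: c1)) (z1 :: (h :: c1) ++ z2 :: c2) = z2 :: c2 ++ z1 :: h :: c1.
    by rewrite -cat_cons rot_size_cat.
  rewrite -(ngluings_rot phi (size (z1 :: h :: c1))) rotE; apply: FE.
    by rewrite -rotE; apply: polygons_rot.
  by rewrite size_cat /=; lia.
case/lastP: c2 csP base => [|c2 w] csP base.
  have csE : z1 :: (h :: c1) ++ [:: z2] = z1 :: rcons (h :: c1) z2 by rewrite cats1.
  rewrite csE in csP base *.
  have [csP' _ _ _] := polygons_leaf csP.
  rewrite leaf_step // natrD base (_ : h |: _ = [set h]); last first.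
    by apply/setP=> u; rewrite !inE andNb orbF.
  rewrite (FE (size c1).+1) // (_ : _ == size [::] = false) // !andbF addr0.
  by rewrite /= addn0 addr0.
have csE : z1 :: (h :: c1) ++ z2 :: rcons c2 w = z1 :: rcons (h :: c1 ++ z2 :: c2) w.
  by rewrite rcons_cons rcons_cat rcons_cons.
rewrite csE in csP base *.
have [csP' _ _ wN] := polygons_leaf csP.
have wz2 : w != z2.
  by apply: contraNneq wN => ->; rewrite -cat_cons !mem_cat mem_head orbT.
rewrite leaf_step // natrD base (_ : h |: _ = [set h; z2]); last first.
  by apply/setP=> u; rewrite !inE; case: (u =P z2) => [->|_]; rewrite ?andbT ?andbF // [z2 == w]eq_sym wz2.
by rewrite IH // size_rcons eqSS addrA.
Qed.

Lemma two_monogons_sphere phi x y : polygons phi [:: [:: x]; [:: y]] ->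
  [set al in gluings (sides [:: [:: x]; [:: y]]) 2 phi set0 0 | al x == y] = [set tperm x y].
Proof.
move=> csP; case/polygons_cons: (csP) => /polygons_cons[_ _ /=].
rewrite andbT => /eqP py _ _ _ /=; rewrite andbT => /eqP px _ xN.
have xy : x != y by have := xN x; rewrite !inE eqxx => /(_ isT).
have -> : sides [:: [:: x]; [:: y]] = [set x; y] by apply/setP=> u; rewrite !inE.
have tM : tperm x y \in matchings [set x; y].
  apply/matchingsP; split; [exact: tperm_on | | exact: tpermK].
  by move=> u; rewrite !inE => /orP[]/eqP->; rewrite ?tpermL ?tpermR // eq_sym.
apply/setP=> al; rewrite [RHS]in_set1; apply/idP/eqP => [|->].
  move/setIdP=> [/setIdP[/matchingsP[pal alN alK] _] /eqP alx].
  apply/permP=> u; case: tpermP => [->|->|/eqP uz /eqP uw] //; first by rewrite -alx alK.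
  by rewrite (out_perm pal) // !inE negb_or uz uw.
rewrite in_set tpermL eqxx andbT in_set tM andTb; apply/and3P; split.
- apply/connectedP; split=> [|S SA /set0Pn[u uS] pS aS]; first by apply/set0Pn; exists x; rewrite !inE eqxx.
  have tx : tperm x y x = y by rewrite tpermL.
  have /andP[zS wS] : (x \in S) && (y \in S).
    rewrite -[X in _ && (X \in S)]tx closed_mem // andbb.
    have := subsetP SA u uS; rewrite !inE => /orP[]/eqP uE; first by rewrite -uE.
    by rewrite -(closed_mem _ aS) tx -uE.
  by apply/eqP; rewrite eqEsubset SA; apply/subsetP=> v; rewrite !inE => /orP[]/eqP->.
- apply/subsetP=> u; rewrite !inE => /andP[/orP[]/eqP->]; rewrite ?tpermL ?tpermR ?px ?py ?(negPf xy) //.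
  by rewrite eq_sym (negPf xy).
rewrite /euler cards2 xy (_ : norb _ _ = 1%N) //.
rewrite /norb imsetU !imset_set1 (_ : porbit _ y = porbit (tperm x y * phi) x) ?setUid ?cards1 //.
by apply/eqP; rewrite eq_porbit_mem; apply/porbit_iterP; exists 1%N; rewrite /= permM tpermL py.
Qed.

(** The deletion merges both polygons into one, with a mark at each end of the
    edge. The last term comes from annuli that are glued to a circle: without
    one of its edges, a circle is a segment. *)
Lemma nedge_glue phi x c1 y c2 r :
  polygons phi ((x :: c1) :: (y :: c2) :: r) -> (size r).+1 = n ->
  (nedge (sides ((x :: c1) :: (y :: c2) :: r)) (size r).+2 phi g x y)%:R =
  corner_sum (parity_sum (fun p => K (p :: shape r))) (size c1) (size c2)
  + [&& g == 0%N, r == [::] & size c1 == size c2]%:R.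
Proof.
move=> csP rn; set F := parity_sum _.
case: c1 c2 csP => [|h1 c1] [|h2 c2] csP.
- rewrite /= /F /= !addr0 add0r andbT.
  have [/andP[/eqP g0 /eqP r0]|rg] := boolP ((g == 0%N) && (r == [::])).
    move: csP; rewrite g0 r0 => csP; rewrite /nedge two_monogons_sphere // cards1 //.
  rewrite [RHS](_ : _ = 0) //; apply/eqP; rewrite pnatr_eq0; apply/eqP/eq_card0 => al.
  apply/negbTE; apply: contraNN rg.
  case/setIdP=> /setIdP[alM /and3P[/connectedP[_ AP] _ eA]] /eqP alx.
  case/polygons_cons: (csP) => /polygons_cons[rP _ /=].
  rewrite andbT => /eqP py _ yN _ /=; rewrite andbT => /eqP px _ xN.
  have [pal alN alK] := matchingsP _ _ alM.
  have aly : al y = x by rewrite -alx alK.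
  have xy : x != y by have := xN x (mem_head _ _); rewrite notin_cons => /andP[].
  have AE : [set x; y] = sides ([:: x] :: [:: y] :: r).
    apply: AP; first by apply/subsetP=> u; rewrite !inE => /orP[]/eqP->; rewrite eqxx ?orbT.
    + by apply/set0Pn; exists x; rewrite !inE eqxx.
    + by apply/closed_byP=> u; rewrite !inE => /orP[]/eqP->; rewrite ?px ?py eqxx ?orbT.
    by apply/closed_byP=> u; rewrite !inE => /orP[]/eqP->; rewrite ?alx ?aly eqxx ?orbT.
  have r0 : r = [::].
    case: (r) rP xN yN AE => // -[|u c] r'; first by case.
    move=> _ xN yN AE; have : u \in [set x; y] by rewrite AE !mem_sides mem_head !orbT.
    have uF : u \in flatten ((u :: c) :: r') by apply: mem_head.
    rewrite !inE => /orP[]/eqP uE.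
      have /negP[] := xN x (mem_head _ _); rewrite -uE.
      by rewrite in_cons uF orbT.
    by have /negP[] := yN y (mem_head _ _); rewrite -uE.
  rewrite r0 eqxx andbT; move: eA; rewrite /euler -AE cards2 xy r0 /= => /eqP eA.
  have : (norb (al * phi) [set x; y] > 0)%N.
    by rewrite /norb card_gt0; apply/set0Pn; exists (porbit (al * phi) x); rewrite imset_f // !inE eqxx.
  by apply/implyP; apply/implyP => ?; apply/eqP; lia.
- have [csP' [xy px py] xN yN] := polygons_merge (erefl _ : [::] ++ h2 :: c2 != [::]) csP.
  rewrite nedge_merge //= ?andbF !addr0 px py /= ?add0n.
  rewrite (@eq_in_ngluings _ _ _ [set h2]) //; first by rewrite one_mark.
  have {}xN : x \notin sides ((h2 :: c2) :: r) by rewrite in_set; apply: xN.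
  by move=> u uE; rewrite in_set2 in_set1; case: (u =P x) uE xN => // -> ->.
- have c0 : (h1 :: c1) ++ [::] != [::] by [].
  have [csP' [xy px py] xN yN] := polygons_merge c0 csP.
  rewrite nedge_merge // px py cats0 /= ?andbF !addr0 ?addn0.
  rewrite cats0 in csP' yN.
  rewrite (@eq_in_ngluings _ _ _ [set h1]) //; first by rewrite one_mark.
  have {}yN : y \notin sides ((h1 :: c1) :: r) by rewrite in_set; apply: yN.
  by move=> u uE; rewrite in_set2 in_set1; case: (u =P y) uE yN; rewrite ?orbF // => -> ->.
have c0 : (h1 :: c1) ++ h2 :: c2 != [::] by [].
have [csP' [xy px py] xN yN] := polygons_merge c0 csP.
by rewrite nedge_merge // px py /= same_polygon_marks //= eqSS.
Qed.

End OneType.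
End Marks.

(** * Discs and annuli *)

Section UnstableCounts.
Variable D : finType.
Implicit Types (A M : {set D}) (phi al : {perm D}) (x y z h w : D).
Implicit Types (c : seq D) (cs r : seq (seq D)).

(** A vertex that is not a leaf has at least two corners. *)
Lemma norb_leaves A phi al : closed_by phi A -> al \in matchings A ->
  (2 * norb (al * phi) A <= #|A| + #|leaves A phi al|)%N.
Proof.
move=> phA alM; have alA := closed_matching alM; set sg := (al * phi)%g.
have -> : (#|A| + #|leaves A phi al| = \sum_(z in A) (1 + (z \in leaves A phi al)))%N.
  rewrite big_split /= sum1_card; congr addn; rewrite -sum1_card big_mkcond [RHS]big_mkcond.
  by apply: eq_bigr => z _; rewrite inE; case: (z \in A) => //=; case: (_ == z).
rewrite (partition_big_imset (porbit sg)) /= mulnC -sum_nat_const; apply: leq_sum => P.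
case/imsetP=> z zA ->; rewrite (bigD1 z) ?zA ?eqxx //=.
have [zl|zl] := boolP (z \in leaves A phi al); first by rewrite leq_addr.
have sz : phi (al z) != z by move: zl; rewrite inE zA.
rewrite (bigD1 (phi (al z))) /=; last first.
  rewrite !closed_mem // zA sz andbT eq_porbit_mem.
  by apply/porbit_iterP; exists 1%N; rewrite /= permM.
by rewrite addnA; apply: leq_trans (leq_addr _ _); rewrite addn0 add1n; case: (_ \in leaves _ _ _).
Qed.

(** A sphere with one face is glued along a tree, and a tree with an edge has
    two leaves. *)
Lemma gluings_one_face A phi M : closed_by phi A -> (#|M| <= 1)%N ->
  gluings A 1 phi M 0 = set0.
Proof.
move=> phA M1; apply/setP=> al; rewrite [RHS]inE; apply/negbTE/negP.
rewrite in_set => /andP[alM /and3P[_ lM /eqP eA]].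
have := norb_leaves phA alM; have := subset_leq_card lM; lia.
Qed.

Lemma polygons_head phi c r : polygons phi (c :: r) -> polygons phi [:: c].
Proof.
case/polygons_cons=> _ c0 fc uc _; split; first by rewrite /= cats0.
  by rewrite mem_seq1 eq_sym.
by rewrite all_seq1.
Qed.

Lemma nedge_sym A n phi g x y : nedge A n phi g x y = nedge A n phi g y x.
Proof.
apply: eq_card => al; apply/setIdP/setIdP => -[alG /eqP <-]; split=> //;
by case/setIdP: alG => alM _; have [_ _ alK] := matchingsP _ _ alM; rewrite alK.
Qed.

Lemma nedge_self A n phi g x : x \in A -> nedge A n phi g x x = 0%N.
Proof.
move=> xA; apply: eq_card0 => al; apply/negbTE; apply/negP=> /setIdP[/setIdP[alM _]].
by have [_ alN _] := matchingsP _ _ alM; rewrite (negPf (alN x xA)).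
Qed.

Lemma sum_nedge A n phi g x : x \in A ->
  #|gluings A n phi set0 g| = (\sum_(y in A) nedge A n phi g x y)%N.
Proof.
move=> xA; rewrite (@card_sum_unique _ _ (gluings A n phi set0 g) (fun y al => al x == y)).
- rewrite [RHS]big_mkcond; apply: eq_bigr => y _; case: ifP => // yA.
  apply: eq_card0 => al; apply/negbTE; apply/negP=> /setIdP[/setIdP[alM _] /eqP alx].
  by move: yA; rewrite -alx closed_mem ?xA // closed_matching.
- by move=> al _; exists (al x).
by move=> al y y' _ /eqP -> /eqP.
Qed.

Lemma big_sides (R : nmodType) cs (F : D -> R) : uniq (flatten cs) ->
  \sum_(x in sides cs) F x = \sum_(c <- cs) \sum_(x <- c) F x.
Proof.
move=> ucs; rewrite -big_flatten big_uniq //.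
by apply: eq_bigl => x; rewrite inE.
Qed.

(** Along one polygon, [x] is followed by [u] sides, then by the side to which
    it is glued. The cases where these two sides are adjacent contribute
    nothing, since they produce a leaf. *)
Lemma sum_nedge_polygon A n phi g x c : polygons phi [:: x :: c] -> x \in A ->
  {subset x :: c <= A} -> forall F : nat -> nat -> rat,
  (forall k l, (k == 0%N) || (l == 0%N) -> F k l = 0) ->
  (forall h1 c1 y h2 c2, c = (h1 :: c1) ++ y :: h2 :: c2 ->
     (nedge A n phi g x y)%:R = F (size c1).+1 (size c2).+1) ->
  (\sum_(y <- x :: c) nedge A n phi g x y)%:R =
  \sum_(u < size c) F u (size c - u.+1)%N.
Proof.
move=> csP xA cA F F0 FE; rewrite big_cons nedge_self // add0n (big_nth x) big_mkord natr_sum.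
apply: eq_bigr => u _; set y := nth x c u.
have cE : c = take u c ++ y :: drop u.+1 c by rewrite -drop_nth // cat_take_drop.
have s1 : size (take u c) = u by rewrite size_takel // ltnW.
have s2 : size (drop u.+1 c) = (size c - u.+1)%N by rewrite size_drop.
case/polygons_cons: csP => _ _ fc _ _.
have yc : y \in x :: c by rewrite inE mem_nth ?orbT.
case E1: (take u c) s1 cE => [|h1 c1] s1 cE.
  rewrite F0; last by apply/orP; left; apply/eqP; exact: esym s1.
  have py : phi x = y by move: fc; rewrite cE /= => /andP[/eqP].
  by rewrite nedge_sym nedge_next // cA.
case E2: (drop u.+1 c) s2 cE => [|h2 c2] s2 cE.
  rewrite F0; last by apply/orP; right; apply/eqP; exact: esym s2.
  have py : phi y = x.
    by move: fc; rewrite cE fcycle_cons last_cat /= => /andP[_ /eqP].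
  by rewrite nedge_next.
by rewrite (FE _ _ _ _ _ cE); congr (F _ _); [exact: s1 | exact: s2].
Qed.

End UnstableCounts.

Lemma parity_sum0 m : parity_sum (fun _ => 0) m = 0.
Proof.
have [k] := ubnP m; elim: k m => // k IH [|[|m]] //; rewrite ltnS => mk.
by rewrite parity_sumSS IH ?addr0 //; lia.
Qed.

Lemma corner_sum0 F k l : (forall m, F m = 0) -> corner_sum F k l = 0.
Proof. by move=> F0; elim: k l => [|k IH] [|l] /=; rewrite ?IH F0 addr0. Qed.

Lemma ngluings_disc (D : finType) (phi : {perm D}) c :
  polygons phi [:: c] -> ngluings phi [:: c] set0 0 = 0%N.
Proof.
by move=> csP; rewrite /ngluings gluings_one_face ?cards0 // closed_sides.
Qed.

(** Leafless gluings of two polygons into a sphere identify their boundaries. *)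
Lemma ngluings_annulus (D : finType) (phi : {perm D}) c c' :
  polygons phi [:: c; c'] ->
  ngluings phi [:: c; c'] set0 0 = (size c * (size c == size c'))%N.
Proof.
move=> csP; case: c csP => [|x c] csP; first by case: csP => _; rewrite mem_head.
have xA : x \in sides [:: x :: c; c'] by rewrite mem_sides mem_head.
have csA := closed_sides csP.
have glueE y c2 : polygons phi [:: x :: c; y :: c2] ->
    nedge (sides [:: x :: c; y :: c2]) 2 phi 0 x y = (size c == size c2 :> nat).
  move=> cP; have KE (D' : finType) (phi' : {perm D'}) cs : polygons phi' cs ->
      size cs = 1%N -> (ngluings phi' cs set0 0)%:R = 0 :> rat.
    by case: cs => [|d []] // dP _; rewrite ngluings_disc.
  have := @nedge_glue 0 1 (fun=> 0) KE _ _ _ _ _ _ _ cP (erefl _).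
  rewrite corner_sum0 ?add0r /=; first by move/eqP; rewrite eqr_nat => /eqP.
  by move=> m; apply: parity_sum0.
rewrite /ngluings (sum_nedge _ _ _ xA).
have -> : (\sum_(y in sides [:: x :: c; c']) nedge (sides [:: x :: c; c']) 2 phi 0 x y =
  \sum_(y <- x :: c) nedge (sides [:: x :: c; c']) 2 phi 0 x y +
  \sum_(y <- c') nedge (sides [:: x :: c; c']) 2 phi 0 x y)%N.
  rewrite -big_enum /=; case: (csP) => ucs _ _.
  have -> : (\sum_(y <- enum (sides [:: x :: c; c'])) nedge (sides [:: x :: c; c']) 2 phi 0 x y =
     \sum_(y <- flatten [:: x :: c; c']) nedge (sides [:: x :: c; c']) 2 phi 0 x y)%N.
    apply: perm_big; apply: uniq_perm; rewrite ?enum_uniq // => u.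
    by rewrite mem_enum inE.
  by rewrite big_cat /= cats0.
have -> : (\sum_(y <- x :: c) nedge (sides [:: x :: c; c']) 2 phi 0 x y = 0)%N.
  apply/eqP; rewrite -(eqr_nat rat) (@sum_nedge_polygon _ _ _ _ _ _ _ _ _ _ (fun _ _ => 0)) //.
  - by rewrite big1.
  - exact: polygons_head csP.
  - by move=> u uc; rewrite mem_sides uc.
  move=> h1 c1 y h2 c2 cE; move: csP csA; rewrite cE => csP csA.
  rewrite -[2%N]/((size [:: c']).+1) (nedge_split 0 csP) add0n.
  apply/eqP; rewrite pnatr_eq0 sum_nat_eq0; apply/forallP=> B; apply/implyP=> BP.
  rewrite sum_nat_eq0; apply/forallP=> -[[|//] i0]; rewrite subn0 [nat_of_ord _]/= implyTb.
  have [csP' _ _ _] := polygons_split csP.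
  have phA' := closed_sides csP'; set phi' := delete x y phi in phA' BP *.
  set A' := sides _ in phA' BP *; have [BA pB h1B h2B] := and4P BP.
  have pC : closed_by phi' (A' :\: B).
    by apply/closed_byP=> z; rewrite !in_setD !closed_mem.
  have nE : (norb phi' B + norb phi' (A' :\: B) = 3)%N.
    rewrite -norbU //; last by rewrite -setI_eq0; apply/eqP/setP=> u; rewrite !inE; case: (u \in B).
    rewrite (_ : B :|: _ = A') ?norb_sides //.
    apply/setP=> u; rewrite in_setU in_setD; have [uB|//] := boolP (u \in B).
    by rewrite (subsetP BA).
  have nz (S : {set D}) u : u \in S -> (0 < norb phi' S)%N.
    by move=> uS; rewrite /norb card_gt0; apply/set0Pn; exists (porbit phi' u); rewrite imset_f.
  have nB := nz _ _ h1B.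
  have nC : (0 < norb phi' (A' :\: B))%N.
    by apply: (nz _ h2); rewrite in_setD h2B !mem_sides mem_head orbT.
  have [n1|n1] := eqVneq (norb phi' B) 1%N.
    by rewrite n1 gluings_one_face ?cards1 // cards0 mul0n.
  have n2 : norb phi' (A' :\: B) = 1%N by move: nE nB nC n1; lia.
  by rewrite n2 (gluings_one_face pC) ?cards1 // cards0 muln0.
rewrite add0n; transitivity (\sum_(y <- c') nat_of_bool ((size c).+1 == size c'))%N; last first.
  by rewrite big_const_seq count_predT iter_addn_0 mulnC /=; case: eqP => [<-|_]; rewrite ?muln0.
apply: eq_big_seq => y yc'; have [k c2 rotE] := rot_to yc'.
have pE : perm_eq [:: x :: c; c'] [:: c'; x :: c] by rewrite (perm_catC [:: x :: c] [:: c']).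
have cP2 : polygons phi [:: x :: c; y :: c2].
  have := polygons_rot k (polygons_perm pE csP); rewrite rotE.
  by apply: polygons_perm; rewrite (perm_catC [:: y :: c2] [:: x :: c]).
have -> : sides [:: x :: c; c'] = sides [:: x :: c; y :: c2].
  rewrite (sides_perm pE) -(sides_rot k) rotE; apply: sides_perm.
  by rewrite (perm_catC [:: y :: c2] [:: x :: c]).
by rewrite glueE // -(size_rot k c') rotE eqSS.
Qed.

(** * The recursion for gluings of polygons *)

Section TotalRecursion.
Variable K : nat -> seq nat -> rat.
Hypothesis KE : forall g (D : finType) (phi : {perm D}) cs,
  polygons phi cs -> cs != [::] -> (ngluings phi cs set0 g)%:R = K g (shape cs).

Definition values n (b : 'I_n -> nat) (I : {set 'I_n}) := [seq b k | k <- enum I].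

(** The value of [nedge] for one side of face [i] and one side of face [j], in
    terms of the leafless counts [K]. *)
Definition merge_sum n (b : 'I_n -> nat) g (i j : 'I_n) :=
  corner_sum (parity_sum (fun p => K g (p :: values b (~: [set i; j]))))
    (b i).-1 (b j).-1.

(** The value of [nedge] for two sides of face [i] that cut this face into
    polygons with [u] and [v] sides: a lost handle, or a distribution of the
    genus and of the other faces among two components. *)
Definition split_sum n (b : 'I_n -> nat) g (i : 'I_n) (u v : nat) :=
  (if g is g'.+1 then
     parity_sum (fun p => parity_sum (fun q =>
       K g' (q :: p :: values b [set~ i])) v) u else 0) +
  \sum_(I : {set 'I_n} | I \subset [set~ i]) \sum_(g1 < g.+1)
     parity_sum (fun p => K g1 (p :: values b I)) u *
     parity_sum (fun q => K (g - g1) (q :: values b ([set~ i] :\: I))) v.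

Section Faces.
Variables (n : nat) (D : finType).
Implicit Types (phi : {perm D}) (C : 'I_n -> seq D) (I S : {set 'I_n}).

Definition faces C I := [seq C k | k <- enum I].

Lemma shape_faces C I : shape (faces C I) = values (fun k => size (C k)) I.
Proof. by rewrite /shape /faces -map_comp. Qed.

Lemma size_faces C I : size (faces C I) = #|I|.
Proof. by rewrite size_map -cardE. Qed.

Lemma perm_faces_pair C i j : i != j ->
  perm_eq (faces C setT) (C i :: C j :: faces C (~: [set i; j])).
Proof.
move=> ij; apply: (perm_map C (t := i :: j :: enum (~: [set i; j]))).
apply: uniq_perm; rewrite ?enum_uniq //= ?enum_uniq ?andbT.
  by rewrite inE !mem_enum !inE !eqxx ?orbT (negPf ij).
by move=> k; rewrite !inE !mem_enum !inE; case: (k == i); case: (k == j).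
Qed.

Lemma perm_faces_one C i : perm_eq (faces C setT) (C i :: faces C [set~ i]).
Proof.
apply: (perm_map C (t := i :: enum [set~ i])).
apply: uniq_perm; rewrite ?enum_uniq //= ?enum_uniq ?andbT.
  by rewrite !mem_enum !inE !eqxx.
by move=> k; rewrite !inE !mem_enum !inE; case: (k == i).
Qed.

Lemma perm_faces_split C I S : I \subset S ->
  perm_eq (faces C S) (faces C I ++ faces C (S :\: I)).
Proof.
move=> IS; rewrite /faces -map_cat; apply: perm_map.
apply: uniq_perm; rewrite ?enum_uniq //.
  rewrite cat_uniq !enum_uniq andbT /=; apply/hasPn=> k.
  by rewrite !mem_enum inE => /andP[].
move=> k; rewrite mem_cat !mem_enum inE; have [kI|//] := boolP (k \in I).
by rewrite (subsetP IS).
Qed.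

Lemma mem_sides_faces C I u :
  reflect (exists2 k, k \in I & u \in C k) (u \in sides (faces C I)).
Proof.
rewrite inE; apply: (iffP flattenP) => [[c /mapP[k]]|[k kI uk]].
  by rewrite mem_enum => kI -> uk; exists k.
by exists (C k) => //; apply: map_f; rewrite mem_enum.
Qed.

Lemma sides_cat (cs1 cs2 : seq (seq D)) : sides (cs1 ++ cs2) = sides cs1 :|: sides cs2.
Proof. by apply/setP=> u; rewrite !inE flatten_cat mem_cat. Qed.

Lemma polygons_cat phi cs1 cs2 : polygons phi (cs1 ++ cs2) ->
  polygons phi cs1 /\ [disjoint sides cs1 & sides cs2].
Proof.
rewrite /polygons flatten_cat cat_uniq mem_cat all_cat negb_or.
case=> /and3P[u1 hN u2] /andP[n1 n2] /andP[f1 f2]; split; first by split.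
apply/pred0P=> u /=; rewrite !inE; apply/negbTE/andP=> -[uc1 uc2].
by case/hasP: hN; exists u.
Qed.

(** A component of the cut surface that contains [c1] but not [c2] is made of
    whole faces. *)
Lemma component_faces phi c1 c2 C S (R : nmodType) (F : {set D} -> R) h1 h2 :
  polygons phi (c1 :: c2 :: faces C S) -> h1 \in c1 -> h2 \in c2 ->
  \sum_(B : {set D} | [&& B \subset sides (c1 :: c2 :: faces C S), closed_by phi B,
      h1 \in B & h2 \notin B]) F B =
  \sum_(I : {set 'I_n} | I \subset S) F (sides (c1 :: faces C I)).
Proof.
move=> csP h1c h2c; set A := sides _.
have [/polygons_cons[r2P c20 f2 u2 c2N] c10 f1 u1 c1N] := (polygons_cons _ _ _).1 csP.
have [ur _ fr] := r2P.
have fC k : k \in S -> fcycle phi (C k).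
  by move=> kS; apply: (allP fr); apply: map_f; rewrite mem_enum.
have C0 k : k \in S -> exists u, u \in C k.
  move=> kS; have [_ r0 _] := r2P; case E: (C k) => [|u c]; last by exists u; rewrite mem_head.
  by case/negP: r0; rewrite -E; apply: map_f; rewrite mem_enum.
have subP I : I \subset S -> polygons phi (c1 :: faces C I) /\
    [disjoint sides (c1 :: faces C I) & sides (c2 :: faces C (S :\: I))].
  move=> IS; apply: polygons_cat; apply: polygons_perm csP.
  rewrite cat_cons perm_cons; apply: perm_trans (_ : perm_eq _ (c2 :: faces C I ++ faces C (S :\: I))) _.
    by rewrite perm_cons perm_faces_split.
  by rewrite -cat1s catA perm_sym -[c2 :: faces C (S :\: I)]cat1s catA perm_cat2r perm_catC.
have CdI k k' u : k \in S -> k' \in S -> u \in C k -> u \in C k' -> k = k'.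
  move=> kS k'S uk uk'; apply/eqP; apply: contraT => kk'.
  have IS : [set k] \subset S by rewrite sub1set.
  have [_ /pred0P/(_ u)] := subP [set k] IS; rewrite /= !mem_sides.
  rewrite (introT (mem_sides_faces C [set k] u)) ?orbT; last by exists k; rewrite ?inE.
  rewrite (introT (mem_sides_faces C (S :\ k) u)) ?orbT //.
  by exists k'; rewrite // !inE eq_sym kk'.
pose J (B : {set D}) := [set k in S | [forall u, (u \in C k) ==> (u \in B)]].
rewrite (reindex_onto (fun I => sides (c1 :: faces C I)) J) /=; last first.
  move=> B /and4P[BA pB h1B h2B]; apply/setP=> u; rewrite mem_sides.
  have c1B : {subset c1 <= B} by apply: cycle_sub_closed f1 pB h1c h1B.
  apply/orP/idP => [[/c1B //|/mem_sides_faces[k]]|uB].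
    by rewrite inE => /andP[_ /forallP/(_ u)/implyP uk] /uk.
  have := subsetP BA _ uB; rewrite !mem_sides => /or3P[uc|uc|/mem_sides_faces[k kS uk]].
  - by left.
  - by have := cycle_sub_closed f2 pB uc uB h2c; rewrite (negPf h2B).
  right; apply/mem_sides_faces; exists k => //; rewrite inE kS; apply/forallP=> v.
  by apply/implyP=> vk; apply: cycle_sub_closed (fC k kS) pB uk uB _ vk.
apply: eq_bigl => I; apply/andP/idP => [[_ /eqP <-]|IS].
  by apply/subsetP=> k; rewrite inE => /andP[].
have [IP dI] := subP _ IS; split.
  apply/and4P; split.
  - apply/subsetP=> u; rewrite !mem_sides => /orP[->//|/mem_sides_faces[k kI uk]].
    by rewrite (introT (mem_sides_faces C S u)) ?orbT //; exists k => //; apply: (subsetP IS).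
  - exact: closed_sides.
  - by rewrite mem_sides h1c.
  rewrite mem_sides negb_or; apply/andP; split.
    by apply: contraTN h2c => /c1N; rewrite /= mem_cat negb_or => /andP[].
  apply/negP=> /mem_sides_faces[k kI uk]; have := c2N _ h2c.
  case/negP; apply/flattenP; exists (C k) => //; apply: map_f; rewrite mem_enum.
  exact: (subsetP IS).
apply/eqP/setP=> k; rewrite inE; apply/andP/idP => [[kS /forallP kB]|kI].
  have [u uk] := C0 k kS; have := kB u; rewrite uk mem_sides /= => /orP[uc|].
    have := c1N u uc; case/negP => /=; rewrite mem_cat; apply/orP; right.
    by apply/flattenP; exists (C k) => //; apply: map_f; rewrite mem_enum.
  by case/mem_sides_faces=> k' k'I uk'; rewrite (CdI k k' u) // (subsetP IS).
split; first exact: (subsetP IS).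
apply/forallP=> u; apply/implyP=> uk; rewrite mem_sides; apply/orP; right.
by apply/mem_sides_faces; exists k.
Qed.

Section OneSystem.
Variables (phi : {perm D}) (C : 'I_n -> seq D) (g : nat).
Hypothesis CP : polygons phi (faces C setT).
Hypothesis gn : (g, n) != (0, 2)%N.
Local Notation A := (sides (faces C setT)).
Local Notation b := (fun k => size (C k)).

Lemma nedge_merge_sum i j x y : i != j -> x \in C i -> y \in C j ->
  (nedge A n phi g x y)%:R = merge_sum b g i j.
Proof.
move=> ij xi yj; set r := faces C (~: [set i; j]).
have rn : (size r).+2 = n.
  by have := perm_size (perm_faces_pair C ij); rewrite size_faces cardsT card_ord.
have P1 := polygons_perm (perm_faces_pair C ij) CP.
have [k1 c1 E1] := rot_to xi; have [k2 c2 E2] := rot_to yj.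
have sw c c' : perm_eq (c :: c' :: r) (c' :: c :: r).
  by apply/seq.permP=> a /=; rewrite addnCA.
have P2 : polygons phi ((x :: c1) :: (y :: c2) :: r).
  rewrite -E1 -E2; apply: polygons_rot; apply: polygons_perm (sw _ _) _.
  by apply: polygons_rot; apply: polygons_perm (sw _ _) _.
have -> : A = sides ((x :: c1) :: (y :: c2) :: r).
  rewrite (sides_perm (perm_faces_pair C ij)) -E1 -E2 sides_rot (sides_perm (sw _ _)).
  by rewrite -(sides_rot k2) (sides_perm (sw _ _)).
have KE' (D' : finType) (phi' : {perm D'}) cs : polygons phi' cs ->
    size cs = (size r).+1 -> (ngluings phi' cs set0 g)%:R = K g (shape cs).
  by move=> cP cn; apply: KE cP _; rewrite -size_eq0 cn.
have := nedge_glue KE' P2 (erefl _); rewrite rn => ->.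
have -> : [&& g == 0%N, r == [::] & size c1 == size c2] = false.
  by apply/negbTE; apply: contra gn => /and3P[/eqP-> r0 _]; rewrite -rn (eqP r0).
rewrite addr0 /merge_sum /r shape_faces.
by rewrite -(size_rot k1 (C i)) -(size_rot k2 (C j)) E1 E2.
Qed.

Lemma nedge_split_sum i x : x \in C i ->
  (\sum_(y <- C i) nedge A n phi g x y)%:R =
  \sum_(u < (b i).-1) split_sum b g i u (b i - u.+2)%N.
Proof.
move=> xi; set r := faces C [set~ i].
have rn : (size r).+1 = n.
  by have := perm_size (perm_faces_one C i); rewrite size_faces cardsT card_ord.
have P1 := polygons_perm (perm_faces_one C i) CP.
have [k c E] := rot_to xi.
have P2 : polygons phi ((x :: c) :: r) by rewrite -E; apply: polygons_rot.
have AE : A = sides ((x :: c) :: r).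
  by rewrite (sides_perm (perm_faces_one C i)) -E sides_rot.
have bi : b i = (size c).+1 by rewrite -(size_rot k (C i)) E.
have pC : perm_eq (C i) (x :: c) by rewrite -E perm_sym perm_rot.
rewrite (perm_big _ pC) /= AE (@sum_nedge_polygon _ _ _ _ _ _ _ _ _ _ (split_sum b g i)).
- by rewrite bi; apply: eq_bigr => u _; rewrite subSS.
- exact: polygons_head P2.
- by rewrite mem_sides mem_head.
- by move=> u uc; rewrite mem_sides uc.
- move=> p q pq; rewrite /split_sum big1 ?addr0.
    by case: (g) => // g'; case/orP: pq => /eqP -> //=; apply: parity_sum0.
  move=> I _; rewrite big1 // => g1 _.
  by case/orP: pq => /eqP ->; rewrite /= ?mul0r ?mulr0.
move=> h1 c1 y h2 c2 cE; move: P2 {AE pC E bi}; rewrite cE => P2.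
have := nedge_split g P2; rewrite /= rn => ->.
have [P3 _ _ _] := polygons_split P2; set phi' := delete x y phi in P3 *.
rewrite natrD /split_sum; congr (_ + _).
  case: (g) => // g'; rewrite (@two_marks g' (size r).+2 (K g') _ _ _ _ _ _ _ _ P3) //.
    by rewrite /r shape_faces.
  by move=> D' phi1 cs cP cn; apply: KE cP _; rewrite -size_eq0 cn.
rewrite natr_sum (component_faces _ P3) ?mem_head //.
apply: eq_bigr => I IS; rewrite natr_sum; apply: eq_bigr => g1 _; rewrite natrM.
set A' := sides ((h1 :: c1) :: (h2 :: c2) :: _).
have pp : perm_eq ((h1 :: c1) :: (h2 :: c2) :: r)
    (((h1 :: c1) :: faces C I) ++ ((h2 :: c2) :: faces C ([set~ i] :\: I))).
  rewrite cat_cons perm_cons; apply: perm_trans (_ : perm_eq _ ((h2 :: c2) :: faces C I ++ faces C ([set~ i] :\: I))) _.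
    by rewrite perm_cons perm_faces_split.
  by rewrite -cat1s catA perm_sym -[(h2 :: c2) :: faces C (_ :\: I)]cat1s catA perm_cat2r perm_catC.
have [Q1 dis] := polygons_cat (polygons_perm pp P3).
have Q2 : polygons phi' ((h2 :: c2) :: faces C ([set~ i] :\: I)).
  have := polygons_perm _ (polygons_perm pp P3) => /(_ _ (permEl (perm_catC _ _))).
  by case/polygons_cat.
have -> : A' :\: sides ((h1 :: c1) :: faces C I) = sides ((h2 :: c2) :: faces C ([set~ i] :\: I)).
  rewrite /A' (sides_perm pp) sides_cat setDUl setDv set0U; apply/setDidPl.
  by rewrite disjoint_sym.
rewrite !norb_sides //; congr (_ * _).
  rewrite -/(ngluings phi' ((h1 :: c1) :: faces C I) [set h1] g1).
  rewrite (@one_mark g1 (#|I|).+1 (K g1) _ _ _ _ _ _ Q1) ?size_faces ?shape_faces //.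
  by move=> D' phi1 cs cP cn; apply: KE cP _; rewrite -size_eq0 cn.
rewrite -/(ngluings phi' ((h2 :: c2) :: faces C ([set~ i] :\: I)) [set h2] (g - g1)).
rewrite (@one_mark (g - g1) (#|[set~ i] :\: I|).+1 (K (g - g1)) _ _ _ _ _ _ Q2) ?size_faces ?shape_faces //.
by move=> D' phi1 cs cP cn; apply: KE cP _; rewrite -size_eq0 cn.
Qed.

(** Both sides count the pairs of a leafless gluing and a side [x]: on the
    right, they are sorted by the face of [x] and by the side to which [x] is
    glued. *)
Lemma polygon_recursion : (0 < n)%N ->
  (\sum_i b i)%:R * K g (values b setT) =
  \sum_i \sum_(j | j != i) (b i * b j)%:R * merge_sum b g i j +
  \sum_i (b i)%:R * \sum_(u < (b i).-1) split_sum b g i u (b i - u.+2)%N.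
Proof.
move=> n0; have uC : uniq (flatten (faces C setT)) by case: CP.
have bigA (F : D -> nat) : (\sum_(x in A) F x = \sum_i \sum_(x <- C i) F x)%N.
  by rewrite big_sides // big_map big_enum /=; apply: eq_bigl => k; rewrite inE.
have cA : #|A| = (\sum_i b i)%N.
  by rewrite -sum1_card bigA; apply: eq_bigr => i _; rewrite sum1_size.
have sn : size (faces C setT) = n by rewrite size_faces cardsT card_ord.
rewrite -(shape_faces C) -(KE g CP) -?size_eq0 ?sn -?lt0n // -cA -natrM mulnC.
have -> : (ngluings phi (faces C setT) set0 g * #|A| =
    \sum_(x in A) \sum_(y in A) nedge A n phi g x y)%N.
  rewrite mulnC -sum_nat_const; apply: eq_bigr => x xA; rewrite -sum_nedge //.
  by rewrite /ngluings sn.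
rewrite bigA natr_sum -big_split /=; apply: eq_bigr => i _.
transitivity (\sum_(x <- C i) (\sum_(j | j != i) (b j)%:R * merge_sum b g i j +
   \sum_(u < (b i).-1) split_sum b g i u (b i - u.+2)%N)); last first.
  rewrite big_const_seq count_predT iter_addr_0 -[LHS]mulr_natl mulrDr; congr (_ + _).
  by rewrite mulr_sumr; apply: eq_bigr => j _; rewrite natrM mulrA.
rewrite natr_sum; apply: eq_big_seq => x xi; rewrite bigA (bigD1 i) //= addnC natrD.
rewrite nedge_split_sum //; congr (_ + _); rewrite natr_sum; apply: eq_bigr => j ji.
rewrite natr_sum (eq_big_seq (fun=> merge_sum b g i j)); last first.
  by move=> y yj; apply: nedge_merge_sum; rewrite 1?eq_sym.
by rewrite big_const_seq count_predT iter_addr_0 mulr_natl.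
Qed.

End OneSystem.
End Faces.
End TotalRecursion.

(** * Isomorphism classes as orbits of relabelling *)

Local Close Scope ring_scope.

Section Isomorphisms.
Implicit Types (T : finType).

Lemma transitive_connected T (s t : {perm T}) :
  [transitive <<[set s; t]>>%g, on [set: T] | 'P] = connected [set: T] s t.
Proof.
apply/idP/connectedP => [tr|[T0 TP]].
  have T0 : [set: T] != set0 by case/imsetP: tr => x xT _; apply/set0Pn; exists x.
  split=> // S _ /set0Pn[x xS] sS tS; apply/eqP; rewrite eqEsubset subsetT.
  rewrite -(atransP tr x (in_setT _)) acts_sub_orbit ?xS //.
  rewrite gen_subG; apply/subsetP=> h; rewrite !inE => /orP[]/eqP ->;
  by rewrite ?inE; apply/subsetP=> u uS; rewrite inE /= closed_mem.
have /set0Pn[x _] := T0; apply/imsetP; exists x => //; apply/esym/TP.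
- exact: subsetT.
- by apply/set0Pn; exists x; apply: orbit_refl.
- apply/closed_byP=> u ux; rewrite -(orbit_eqP ux).
  by apply: (mem_orbit 'P); apply: mem_gen; rewrite !inE eqxx.
apply/closed_byP=> u ux; rewrite -(orbit_eqP ux).
by apply: (mem_orbit 'P); apply: mem_gen; rewrite !inE eqxx orbT.
Qed.

Lemma porbits_card_conj T (s s' h : {perm T}) :
  (forall x, h (s x) = s' (h x)) ->
  (forall x, porbit s' (h x) = h @: porbit s x) /\ #|porbits s'| = #|porbits s|.
Proof.
move=> hs; have hE k x : h (iter k s x) = iter k s' (h x).
  by elim: k => //= k IH; rewrite hs IH.
have pE x : porbit s' (h x) = h @: porbit s x.
  apply/setP=> u; apply/porbit_iterP/imsetP => [[k ->]|[v /porbit_iterP[k ->] ->]].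
    by exists (iter k s x); rewrite ?hE //; apply/porbit_iterP; exists k.
  by exists k; rewrite hE.
split=> //; rewrite -[RHS](card_imset _ (imset_inj (@perm_inj _ h))).
apply: eq_card => P; apply/imsetP/imsetP => [[u _ ->]|[_ /imsetP[x _ ->] ->]].
  exists (porbit s (h^-1 u)%g); first exact: imset_f.
  by rewrite -pE permKV.
by exists (h x); rewrite ?pE.
Qed.

Section Fat.
Variables (n e : nat).
Implicit Types (G H : fatdata n e) (h : {perm 'I_(e.*2)}).

Lemma is_fatgraphP G :
  reflect [/\ forall x, tau1 G x != x, involutive (tau1 G),
              connected setT (tau0 G) (tau1 G), forall x, (2 < #|porbit (tau0 G) x|)%N &
              (forall x y, (lab G x == lab G y) = (y \in porbit (tau2 G) x)) /\
              (forall i, exists x, lab G x = i)]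
          (is_fatgraph G).
Proof.
rewrite /is_fatgraph transitive_connected.
apply: (iffP and5P) => [[/forallP i1 con /forall_inP v3 /forallP l1 /forallP l2]|].
  split=> //.
  - by move=> x; have /andP[] := i1 x.
  - by move=> x; have /andP[_ /eqP] := i1 x.
  - by move=> x; apply: v3; apply: imset_f.
  split=> [x y|i]; last by have /existsP[x /eqP] := l2 i; exists x.
  by have /forallP/(_ y)/eqP -> := l1 x; rewrite eq_porbit_mem porbit_sym.
case=> i1 i2 con v3 [l1 l2]; split=> //.
- by apply/forallP=> x; rewrite i1 i2 eqxx.
- by apply/forall_inP=> _ /imsetP[x _ ->].
- by apply/forallP=> x; apply/forallP=> y; rewrite l1 eq_porbit_mem porbit_sym.
by apply/forallP=> i; have [x xi] := l2 i; apply/existsP; exists x; rewrite xi.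
Qed.

Lemma is_isomP G H h :
  reflect [/\ forall x, h (tau0 G x) = tau0 H (h x), forall x, h (tau1 G x) = tau1 H (h x) &
              forall x, lab H (h x) = lab G x] (is_isom G H h).
Proof.
apply: (iffP forallP) => [hP|[h0 h1 h2] x]; last by rewrite h0 h1 h2 !eqxx.
by split=> x; have /and3P[/eqP ? /eqP ? /eqP ?] := hP x.
Qed.

Lemma isom_tau2 G H h : is_isom G H h -> forall x, h (tau2 G x) = tau2 H (h x).
Proof. by case/is_isomP=> h0 h1 _ x; rewrite !permM h0 h1. Qed.

Lemma isom_fatgraphs G H h g : is_isom G H h -> G \in fatgraphs n e g -> H \in fatgraphs n e g.
Proof.
move=> hP; have h2P := isom_tau2 hP; have [h0P h1P hl] := is_isomP _ _ _ hP.
rewrite !inE => /andP[/is_fatgraphP[i1 i2 con v3 [l1 l2]] gG].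
have [p0 c0] := porbits_card_conj h0P; have [p1 c1] := porbits_card_conj h1P.
have [p2 c2] := porbits_card_conj h2P.
apply/andP; split; last by rewrite /has_genus /X0 /X1 /X2 c0 c1 c2.
have hK x : exists y, x = h y by exists (h^-1 x)%g; rewrite permKV.
apply/is_fatgraphP; split.
- by move=> x; have [y ->] := hK x; rewrite -h1P (inj_eq perm_inj).
- by move=> x; have [y ->] := hK x; rewrite -!h1P i2.
- have [T0 TP] := connectedP _ _ _ con; apply/connectedP; split=> // S _ /set0Pn[x xS] cS0 cS1.
  have <- : h @: (h @^-1: S) = S.
    by apply/setP=> u; apply/imsetP/idP => [[v]|uS]; [rewrite inE => vS -> | exists (h^-1 u)%g; rewrite ?inE permKV].
  rewrite (TP (h @^-1: S)) ?subsetT //.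
  + by apply/setP=> u; rewrite [RHS]inE; apply/imsetP; exists (h^-1 u)%g; rewrite ?permKV.
  + by apply/set0Pn; exists (h^-1 x)%g; rewrite inE permKV.
  + by apply/closed_byP=> u; rewrite !inE h0P (closed_mem _ cS0).
  by apply/closed_byP=> u; rewrite !inE h1P (closed_mem _ cS1).
- by move=> x; have [y ->] := hK x; rewrite p0 card_imset //; apply: perm_inj.
split=> [x y|i].
  have [u ->] := hK x; have [v ->] := hK y.
  by rewrite !hl l1 p2 mem_imset //; apply: perm_inj.
by have [x xi] := l2 i; exists (h x); rewrite hl.
Qed.

Lemma Aut_fatE G : is_fatgraph G -> Aut_fat G = [set h | is_isom G G h].
Proof.
case/is_fatgraphP=> i1 i2 con v3 [l1 l2]; apply/setP=> h; rewrite !inE.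
apply/andP/is_isomP => [[/forallP hP /forall_inP hX]|hP].
  split=> x; try by have /andP[/eqP ? /eqP ?] := hP x.
  apply/eqP; rewrite eq_sym l1.
  have /eqP <- : h @: porbit (tau2 G) x == porbit (tau2 G) x by apply: hX; apply: imset_f.
  by apply: imset_f; apply: porbit_id.
have h2P : forall x, h (tau2 G x) = tau2 G (h x) by apply: isom_tau2; apply/is_isomP.
case: hP => h0 h1 hl; split; first by apply/forallP=> x; rewrite h0 h1 !eqxx.
apply/forall_inP=> _ /imsetP[x _ ->].
have [<- _] := porbits_card_conj h2P.
by rewrite eq_porbit_mem porbit_sym -l1 hl.
Qed.

(** The action of the permutations of the oriented edges, whose orbits are the
    isomorphism classes and whose stabilizers are the automorphism groups. *)
Definition relabel G h : fatdata n e :=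
  (((tau0 G) ^ h)%g, ((tau1 G) ^ h)%g, [ffun x => lab G (h^-1 x)%g]).

Lemma is_isom_relabel G h : is_isom G (relabel G h) h.
Proof.
apply/is_isomP; split=> x; rewrite /relabel /tau0 /tau1 /lab /= ?permJ //.
by rewrite ffunE permK.
Qed.

Lemma is_isom_inj G H H' h : is_isom G H h -> is_isom G H' h -> H = H'.
Proof.
case/is_isomP=> a0 a1 a2 /is_isomP[b0 b1 b2].
case: H H' a0 a1 a2 b0 b1 b2 => [[H0 H1] Hl] [[K0 K1] Kl].
rewrite /tau0 /tau1 /lab /= => a0 a1 a2 b0 b1 b2.
congr (_, _, _); [apply/permP | apply/permP | apply/ffunP] => x;
rewrite -[x](permKV h); by rewrite -?a0 -?a1 ?a2 -?b0 -?b1 ?b2.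
Qed.

Lemma card_isom G H h0 : is_isom G H h0 -> #|[set h | is_isom G H h]| = #|[set h | is_isom G G h]|.
Proof.
move=> h0P; have [a0 a1 a2] := is_isomP _ _ _ h0P.
rewrite -[RHS](card_imset _ (mulIg h0)).
apply: eq_card => h; rewrite inE; apply/is_isomP/imsetP => [[c0 c1 c2]|[k]].
  exists (h * h0^-1)%g; last by rewrite mulgKV.
  rewrite inE; apply/is_isomP; split=> x; rewrite !permM.
  - by apply: (@perm_inj _ h0); rewrite a0 !permKV c0.
  - by apply: (@perm_inj _ h0); rewrite a1 !permKV c1.
  by rewrite -a2 permKV c2.
rewrite inE => /is_isomP[c0 c1 c2] ->.
by split=> x; rewrite !permM ?c0 ?c1 ?a0 ?a1 ?a2 ?c2.
Qed.

Lemma orbit_stabilizer G g : G \in fatgraphs n e g ->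
  (#|[set H in fatgraphs n e g | Defs.isom G H]| * #|Aut_fat G| = (e.*2)`!)%N.
Proof.
move=> GD; have fG : is_fatgraph G by move: GD; rewrite inE => /andP[].
have <- : #|[set: {perm 'I_(e.*2)}]| = (e.*2)`!.
  by rewrite -[in RHS](card_ord e.*2) -(cardsT 'I_(e.*2)) -card_perm; apply: eq_card => h; rewrite !inE; apply/esym/subsetP=> x _; rewrite inE.
rewrite (@card_sum_unique _ _ [set: {perm 'I_(e.*2)}] (fun H h => is_isom G H h)); first last.
- by move=> h H H' _; apply: is_isom_inj.
- by move=> h _; exists (relabel G h); apply: is_isom_relabel.
rewrite Aut_fatE // -sum_nat_const big_mkcond; apply: eq_bigr => H _.
rewrite (_ : [set h in setT | is_isom G H h] = [set h | is_isom G H h]); last first.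
  by apply/setP=> h; rewrite !inE.
case: ifP => [|HN].
  by rewrite inE => /andP[_ /existsP[h hP]]; rewrite (card_isom hP).
apply/esym/eq_card0 => h; rewrite inE; apply: contraFF HN => hP.
by rewrite inE (isom_fatgraphs hP) //; apply/existsP; exists h.
Qed.

(** By the orbit-stabilizer theorem, the sum over the isomorphism classes
    weighted by 1 / #|Aut| is the sum over all fatgraph structures on the given
    oriented edges, divided by the number of their permutations. *)
Lemma transversal_sum g (f : fatdata n e -> nat) :
  (forall G H h, is_isom G H h -> f G = f H) ->
  (\sum_(G in transversal (equivalence_partition (@Defs.isom n e) (fatgraphs n e g))
       (fatgraphs n e g)) (#|Aut_fat G|%:R^-1 * (f G)%:R) : rat)%R =
  (((e.*2)`!)%:R^-1 * (\sum_(G in fatgraphs n e g) f G)%:R)%R.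
Proof.
move=> fE; set F := fatgraphs n e g; set P := equivalence_partition _ _.
have eqv := @isom_equivalence n e F.
have PF : partition P F := equivalence_partitionP eqv.
have [/eqP cP tP _] := and3P PF.
have tr := transversalP PF; set X := transversal P F in tr *.
have XF : {subset X <= F} by apply/subsetP; apply: (transversal_sub tr).
have pbE G : G \in F -> pblock P G = [set H in F | Defs.isom G H].
  move=> GF; apply/setP=> H; rewrite in_set; apply/idP/andP => [HG|[HF GH]].
    have HF : H \in F by rewrite -cP; apply/bigcupP; exists (pblock P G) => //; apply: pblock_mem; rewrite cP.
    by rewrite HF -(pblock_equivalence_partition eqv GF HF) HG.
  by rewrite (pblock_equivalence_partition eqv GF HF).
have -> : (\sum_(G in F) f G = \sum_(G in X) #|pblock P G| * f G)%N.
  rewrite -cP (big_trivIset _ tP) /= -{1}(pblock_transversal tr) big_imset /=; last first.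
    exact: (pblock_inj tr).
  apply: eq_bigr => G GX; rewrite -sum_nat_const. apply: eq_bigr => H.
  rewrite pbE ?XF // inE => /andP[_ /existsP[h hP]].
  by rewrite (fE _ _ _ hP).
rewrite natr_sum mulr_sumr; apply: eq_bigr => G GX.
have GF := XF _ GX; have := orbit_stabilizer GF; rewrite -pbE // => <-.
have a0 : (#|Aut_fat G|%:R != 0 :> rat)%R.
  rewrite pnatr_eq0 -lt0n; apply/card_gt0P; exists 1%g.
  have fG : is_fatgraph G by move: GF; rewrite inE => /andP[].
  rewrite Aut_fatE // inE.
  by apply/is_isomP; split=> x; rewrite !perm1.
have p0 : (#|pblock P G|%:R != 0 :> rat)%R.
  rewrite pnatr_eq0 -lt0n; apply/card_gt0P; exists G; rewrite pbE // inE GF.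
  by apply/existsP; exists 1%g; apply/is_isomP; split=> x; rewrite !perm1.
by rewrite !natrM; field; rewrite a0 p0.
Qed.

End Fat.
End Isomorphisms.

(** * Edge lengths *)

Section EdgeLengths.
Variables (n e : nat).
Implicit Types (G H : fatdata n e) (b : n.-tuple nat).

(** The two orientations of an edge have the same length; the sum over a face
    then counts an edge twice when both its sides lie on that face, as
    [incidence] does. *)
Definition lengths G b : {set {ffun 'I_(e.*2) -> 'I_(\sum_i tnth b i).+1}} :=
  [set l : {ffun 'I_(e.*2) -> 'I_(\sum_i tnth b i).+1} |
    [forall d, (0 < l d)%N && (l (tau1 G d) == l d)] &&
           [forall i, (\sum_(d | lab G d == i) l d)%N == tnth b i]].

Lemma lengthsP G b (l : {ffun 'I_(e.*2) -> 'I_(\sum_i tnth b i).+1}) :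
  reflect [/\ forall d, (0 < l d)%N, forall d, l (tau1 G d) = l d &
              forall i, (\sum_(d | lab G d == i) l d)%N = tnth b i]
          (l \in lengths G b).
Proof.
rewrite inE; apply: (iffP andP) => [[/forallP lP /forallP sP]|[l0 l1 sP]].
  by split=> [d|d|i]; [have /andP[] := lP d | have /andP[_ /eqP] := lP d | apply/eqP].
by split; apply/forallP=> d; rewrite ?l0 ?l1 ?sP eqxx.
Qed.

Lemma NGammaE G b : NGamma G b = #|lengths G b|.
Proof.
have X1d d : porbit (tau1 G) d \in X1 G by apply: imset_f.
pose k d : 'I_#|X1 G| := enum_rank_in (X1d d) (porbit (tau1 G) d).
have kK d : enum_val (k d) = porbit (tau1 G) d by rewrite enum_rankK_in.
have kE (d : 'I_(e.*2)) (j : 'I_#|X1 G|) : (d \in (enum_val j : {set _})) = (k d == j).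
  rewrite -(inj_eq enum_val_inj) kK; have /imsetP[u _ ->] := enum_valP j.
  by rewrite eq_porbit_mem.
have kex (j : 'I_#|X1 G|) : exists d, k d = j.
  have /imsetP[u _ uE] := enum_valP j; exists u; apply/eqP.
  by rewrite -kE uE porbit_id.
pose F (x : 'cV['I_(\sum_i tnth b i)%N.+1]_#|X1 G|) := [ffun d => x (k d) ord0].
have Finj : injective F.
  move=> x y /ffunP xy; apply/matrixP=> j j'; rewrite (ord1 j').
  by have [d <-] := kex j; have := xy d; rewrite !ffunE.
have sumE (x : 'cV['I_(\sum_i tnth b i)%N.+1]_#|X1 G|) i :
  ((incidence G *m map_mx val x)%R i ord0 = \sum_(d | lab G d == i) F x d)%N.
  rewrite mxE [RHS](partition_big k xpredT) //=; apply: eq_bigr => j _.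
  rewrite !mxE -sum1_card big_distrl /=.
  apply: eq_big => [d|d]; first by rewrite !inE kE andbC.
  by rewrite inE kE => /andP[/eqP dj _]; rewrite /F ffunE dj; apply: mul1n.
rewrite /NGamma -(card_imset _ Finj); apply: eq_card => l.
apply/imsetP/lengthsP => [[x]|[l0 l1 sP]].
  rewrite inE => /andP[/forallP x0 /eqP xb] ->; split=> [d|d|i].
  - by rewrite ffunE; apply: x0.
  - rewrite !ffunE; congr (x _ ord0); apply: enum_val_inj; rewrite !kK.
    by apply/eqP; rewrite eq_porbit_mem; apply/porbit_iterP; exists 1.
  by rewrite -sumE xb mxE.
have lporb d d' : d' \in porbit (tau1 G) d -> l d' = l d.
  by case/porbit_iterP=> m ->; elim: m => //= m; rewrite l1.
pose x : 'cV['I_(\sum_i tnth b i)%N.+1]_#|X1 G| :=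
  (\col_j odflt ord0 (omap l [pick d in (enum_val j : {set _})]))%R.
have xE d : x (k d) ord0 = l d.
  rewrite mxE; case: pickP => [d'|/(_ d)]; last by rewrite kK porbit_id.
  by rewrite kK => /lporb.
have lE : l = F x by apply/ffunP=> d; rewrite ffunE xE.
exists x => //; rewrite inE; apply/andP; split.
  by apply/forallP=> j; have [d <-] := kex j; rewrite xE; apply: l0.
apply/eqP/matrixP=> i j; rewrite (ord1 j) sumE -lE mxE; exact: sP.
Qed.

Lemma lengths_isom G H h b : is_isom G H h -> #|lengths G b| = #|lengths H b|.
Proof.
move=> hP; have [h0 h1 hl] := is_isomP _ _ _ hP.
pose F (l : {ffun 'I_(e.*2) -> 'I_(\sum_i tnth b i).+1}) := [ffun d => l (h^-1 d)%g].
have Finj : injective F.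
  by move=> l l' /ffunP ll'; apply/ffunP=> d; have := ll' (h d); rewrite !ffunE permK.
rewrite -(card_imset _ Finj); apply: eq_card => l.
have h1V d : (h^-1 (tau1 H d) = tau1 G (h^-1 d))%g.
  by apply: (@perm_inj _ h); rewrite h1 !permKV.
apply/imsetP/lengthsP => [[l' /lengthsP[a0 a1 a2] ->]|[a0 a1 a2]].
  split=> [d|d|i]; rewrite ?ffunE // ?h1V //.
  rewrite -a2 (reindex_inj (@perm_inj _ h)) /=; apply: eq_big => d; first by rewrite hl.
  by rewrite ffunE permK.
exists [ffun d => l (h d)]; last by apply/ffunP=> d; rewrite !ffunE permKV.
apply/lengthsP; split=> [d|d|i]; rewrite ?ffunE ?h1 //.
rewrite -a2 [RHS](reindex_inj (@perm_inj _ h)) /=; apply: eq_big => d; first by rewrite hl.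
by rewrite ffunE.
Qed.

End EdgeLengths.

Lemma latN_sum g n (b : n.-tuple nat) : stable g n ->
  latN g b = (\sum_(e < 6 * g + 3 * n)
    ((e.*2)`!)%:R^-1 * (\sum_(G in fatgraphs n e g) #|lengths G b|)%:R)%R.
Proof.
move=> st; rewrite /latN st; apply: eq_bigr => e _.
rewrite -transversal_sum; last by move=> G H h; apply: lengths_isom.
by apply: eq_bigr => G _; rewrite NGammaE.
Qed.

(** * Bivalent vertices of a gluing *)

Lemma card_bij_rel (S T : finType) (X : {set S}) (Y : {set T}) (R : S -> T -> Prop) :
  (forall x, x \in X -> exists2 y, y \in Y & R x y) ->
  (forall y, y \in Y -> exists2 x, x \in X & R x y) ->
  (forall x y y', x \in X -> y \in Y -> y' \in Y -> R x y -> R x y' -> y = y') ->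
  (forall x x' y, x \in X -> x' \in X -> y \in Y -> R x y -> R x' y -> x = x') ->
  #|X| = #|Y|.
Proof.
have half (S' T' : finType) (X' : {set S'}) (Y' : {set T'}) (R' : S' -> T' -> Prop) :
    (forall x, x \in X' -> exists2 y, y \in Y' & R' x y) ->
    (forall x x' y, x \in X' -> x' \in X' -> y \in Y' -> R' x y -> R' x' y -> x = x') ->
    #|X'| <= #|Y'|.
  move=> ex inj; have [->|[x0 x0X]] := set_0Vmem X'; first by rewrite cards0.
  have exf x : exists y, (x \in X' -> y \in Y' /\ R' x y).
    have [/ex[y yY xy]|xX] := boolP (x \in X'); first by exists y.
    by have [y _ _] := ex _ x0X; exists y.
  have [f fP] := fin_all_exists exf.
  rewrite -(card_in_imset (f := f)).
    by apply/subset_leq_card/subsetP=> _ /imsetP[x /fP[fY _] ->].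
  move=> x x' xX x'X E; have [fY Rf] := fP _ xX; have [_ Rf'] := fP _ x'X.
  by apply: inj xX x'X fY Rf _; rewrite E.
move=> exX exY injY injX; apply/eqP; rewrite eqn_leq (half _ _ _ _ R) //=.
apply: (half _ _ _ _ (fun y x => R x y)) => //.
by move=> y y' x yY y'Y xX; apply: injY.
Qed.

(** All cycles have exactly two elements. *)
Lemma norb_two_cycles (D : finType) (s : {perm D}) (S : {set D}) : closed_by s S ->
  {in S, forall z, s (s z) = z} -> {in S, forall z, s z != z} ->
  (norb s S).*2 = #|S|.
Proof.
move=> cS s2 s1; rewrite -[RHS]sum1_card (partition_big_imset (porbit s)) /=.
rewrite -muln2 /norb -sum_nat_const; apply: eq_bigr => _ /imsetP[z zS ->].
rewrite (eq_bigl (mem [set z; s z])) => [|u]; first by rewrite sum1_card cards2 eq_sym s1.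
rewrite eq_porbit_mem !inE; apply/andP/orP => [[_ /porbit_iterP[k ->]]|[]/eqP->].
- elim: k => [|k IH]; first by left.
  by case: IH => /= /eqP ->; [right | left; rewrite s2].
- by rewrite zS porbit_id.
by rewrite closed_mem // zS; split=> //; apply/porbit_iterP; exists 1.
Qed.

(** The corners at vertices that are not bivalent, in a gluing without leaves;
    these are the starting points of the oriented edges of the underlying
    fatgraph. *)
Definition corners (D : finType) (A : {set D}) (s : {perm D}) := [set z in A | s (s z) != z].

Section Corners.
Variables (D : finType) (A : {set D}) (s : {perm D}).
Hypothesis cA : closed_by s A.
Local Notation X := (corners A s).

Lemma closed_corners : closed_by s X.
Proof. by apply/closed_byP=> z; rewrite !inE closed_mem // (inj_eq perm_inj). Qed.

Lemma norb_corners : {in A, forall z, s z != z} ->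
  ((norb s A).*2 = (norb s X).*2 + (#|A| - #|X|))%N.
Proof.
move=> s1; have XA : X \subset A by apply/subsetP=> z; rewrite inE => /andP[].
have AE : A = X :|: (A :\: X).
  by apply/setP=> z; rewrite in_setU in_setD; have [/(subsetP XA) ->|] := boolP (z \in X).
have cX := closed_corners.
have dX : [disjoint X & A :\: X].
  by apply/pred0P=> z /=; rewrite in_setD; case: (z \in X).
rewrite [in LHS]AE norbU //.
rewrite doubleD; congr (_ + _); rewrite norb_two_cycles.
- by rewrite cardsD (setIidPr XA).
- by apply/closed_byP=> z; rewrite !in_setD !closed_mem.
- by move=> z; rewrite !inE => /andP[+ zA]; rewrite zA /= negbK => /eqP.
by move=> z; rewrite in_setD => /andP[_]; apply: s1.
Qed.

End Corners.

Section Leafless.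
Variables (D : finType) (A : {set D}) (n g : nat) (phi al : {perm D}).
Hypothesis phA : closed_by phi A.
Hypothesis alU : al \in gluings A n phi set0 g.
Local Notation sg := (al * phi)%g.

Lemma gluingP : [/\ al \in matchings A, connected A phi al & euler A n phi al g].
Proof. by case/setIdP: alU => ? /and3P[]. Qed.

Lemma gluing_leafless : {in A, forall z, sg z != z}.
Proof.
move=> z zA; case/setIdP: alU => _ /and3P[_ /subsetP lP _]; rewrite permM.
by apply/negP=> lz; have := lP z; rewrite !inE zA lz => /(_ isT).
Qed.

Lemma gluing_closed : closed_by sg A.
Proof.
by have [alM _ _] := gluingP; apply/closed_byP=> z; rewrite permM !closed_mem // closed_matching.
Qed.

(** If all vertices on a face are bivalent, then this face and the one glued to
    it form a sphere cut along a circle, and stability excludes that. *)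
Lemma face_meets_corners x : stable g n -> x \in A ->
  exists2 y, y \in porbit phi x & y \in corners A sg.
Proof.
move=> st xA; have [alM con eA] := gluingP; have [pal alN alK] := matchingsP _ _ alM.
have [y /andP[yx yX]|none] := pickP [pred y in porbit phi x | y \in corners A sg]; first by exists y.
have CA y : y \in porbit phi x -> y \in A by case/porbit_iterP=> k ->; rewrite closed_iter.
have C2 y : y \in porbit phi x -> sg (sg y) = y.
  by move=> yx; have := none y; rewrite /= yx inE CA // => /negbT; rewrite negbK => /eqP.
have cC : closed_by phi (porbit phi x).
  by apply/closed_byP=> y /porbit_iterP[k ->]; apply/porbit_iterP; exists k.+1.
have turn y : y \in porbit phi x -> phi (al (phi y)) = al y.
  move=> yx; have := C2 (phi y); rewrite closed_mem // => /(_ yx); rewrite !permM => E.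
  by rewrite -[phi (al (phi y))]alK; congr (al _); apply: (@perm_inj _ phi).
have [_ AP] := connectedP _ _ _ con.
have SE : porbit phi x :|: al @: porbit phi x = A.
  apply: AP.
  - rewrite subUset; apply/andP; split; apply/subsetP=> y; first exact: CA.
    by case/imsetP=> z /CA zA ->; rewrite perm_closed.
  - by apply/set0Pn; exists x; rewrite inE porbit_id.
  - apply/closed_byP=> y; rewrite !inE => /orP[yx|/imsetP[z zx ->]].
      by rewrite closed_mem // yx.
    have zE : z = phi (phi^-1 z)%g by rewrite permKV.
    have zx' : (phi^-1 z)%g \in porbit phi x by rewrite -(closed_mem _ cC) permKV.
    by rewrite [in phi _]zE turn // imset_f ?orbT.
  apply/closed_byP=> y; rewrite !inE => /orP[yx|/imsetP[z zx ->]].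
    by rewrite imset_f ?orbT.
  by rewrite alK zx.
have X0 : corners A sg = set0.
  apply/setP=> y; rewrite [RHS]inE inE -SE inE.
  apply/negbTE; rewrite negb_and negbK -implybE; apply/implyP=> /orP[/C2->//|/imsetP[z zx ->]].
  by rewrite !permM alK turn.
have := norb_corners gluing_closed gluing_leafless; rewrite X0 cards0 /norb imset0 cards0.
move: eA st; rewrite /euler /stable /norb => /eqP; lia.
Qed.

End Leafless.

(** * From metric fatgraphs to gluings *)

Section Tower.
Variables (D : finType) (A : {set D}) (phi : {perm D}) (n : nat) (lb : D -> 'I_n).
Variables (b : n.-tuple nat) (e : nat).
Hypothesis phA : closed_by phi A.
Hypothesis lbP : {in A &, forall x y, (lb x == lb y) = (y \in porbit phi x)}.
Hypothesis lbb : forall i, #|[set x in A | lb x == i]| = tnth b i.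
Local Notation B := (\sum_i tnth b i)%N.
Local Notation lenT := {ffun 'I_(e.*2) -> 'I_B.+1}.
Implicit Types (G : fatdata n e) (l : lenT) (j : {ffun 'I_(e.*2) -> D}) (al : {perm D}).

Lemma card_labelled : #|A| = B.
Proof.
rewrite -sum1_card (partition_big lb xpredT) //=; apply: eq_bigr => i _.
by rewrite -lbb -sum1_card; apply: eq_bigl => x; rewrite inE.
Qed.

(** [j] places the oriented edges of a metric fatgraph at the lattice points
    of the faces, so that lengths are distances along the faces. *)
Definition placement G l j := [forall d,
  [&& j d \in A, lb (j d) == lab G d & j (tau2 G d) == iter (l d) phi (j d)]].

Lemma placementP G l j :
  reflect [/\ forall d, j d \in A, forall d, lb (j d) = lab G d &
              forall d, j (tau2 G d) = iter (l d) phi (j d)] (placement G l j).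
Proof.
apply: (iffP forallP) => [jP|[j1 j2 j3] d]; last by rewrite j1 j2 j3 !eqxx.
by split=> d; have /and3P[? /eqP ? /eqP ?] := jP d.
Qed.

(** Traversing an edge in the other direction: [al] reverses the unit sides. *)
Definition reverses G l j al := forall d k, (k < l d)%N ->
  al (iter k phi (j d)) = iter (l d - k.+1) phi (j (tau1 G d)).

Section OnePlacement.
Variables (G : fatdata n e) (l : lenT) (j : {ffun 'I_(e.*2) -> D}).
Hypotheses (fG : is_fatgraph G) (lG : l \in lengths G b) (jG : placement G l j).

Let l_gt0 d : (0 < l d)%N. Proof. by have [l0 _ _] := lengthsP _ _ lG. Qed.
Let l_tau1 d : l (tau1 G d) = l d. Proof. by have [_ l1 _] := lengthsP _ _ lG. Qed.
Let l_sum i : (\sum_(d | lab G d == i) l d)%N = tnth b i.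
Proof. by have [_ _ ls] := lengthsP _ _ lG. Qed.
Let jA d : j d \in A. Proof. by have [j1 _ _] := placementP _ _ _ jG. Qed.
Let j_lab d : lb (j d) = lab G d. Proof. by have [_ j2 _] := placementP _ _ _ jG. Qed.
Let j_tau2 d : j (tau2 G d) = iter (l d) phi (j d).
Proof. by have [_ _ j3] := placementP _ _ _ jG. Qed.
Let tau1K : involutive (tau1 G). Proof. by have [_ ? _ _ _] := is_fatgraphP _ fG. Qed.
Let tau1N d : tau1 G d != d. Proof. by have [? _ _ _ _] := is_fatgraphP _ fG. Qed.

Lemma tower_cover z : z \in A -> exists d k, (k < l d)%N /\ z = iter k phi (j d).
Proof.
move=> zA; pose S := [set z | [exists d, exists k : 'I_(l d), z == iter k phi (j d)]].
have SP u : reflect (exists d k, (k < l d)%N /\ u = iter k phi (j d)) (u \in S).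
  rewrite inE; apply: (iffP existsP) => [[d /existsP[k /eqP uE]]|[d [k [kl ->]]]].
    by exists d, k; split.
  by exists d; apply/existsP; exists (Ordinal kl).
have cS : closed_by phi S.
  apply/closed_byP=> u /SP[d [k [kl ->]]]; apply/SP.
  have [kl'|kl'] := ltnP k.+1 (l d); first by exists d, k.+1.
  have lE : nat_of_ord (l d) = k.+1 by apply/eqP; rewrite eqn_leq kl kl'.
  by exists (tau2 G d), 0%N; split=> //=; rewrite j_tau2 lE.
apply/SP; have [_ _ _ _ [_ /(_ (lb z))[d dz]]] := is_fatgraphP _ fG.
have : z \in porbit phi (j d) by rewrite -lbP // j_lab dz.
case/porbit_iterP=> k ->; rewrite closed_iter //; apply/SP.
by exists d, 0%N; split.
Qed.

Local Notation P := [set p : 'I_(e.*2) * 'I_B.+1 | (p.2 < l p.1)%N].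
Local Notation f := (fun p : 'I_(e.*2) * 'I_B.+1 => iter p.2 phi (j p.1)).

Let le_B d : (l d <= B)%N. Proof. by rewrite -ltnS. Qed.

Lemma card_tower (l' : lenT) (Q : pred 'I_(e.*2)) :
  #|[set p : 'I_(e.*2) * 'I_B.+1 | Q p.1 && (p.2 < l' p.1)%N]| = (\sum_(d | Q d) l' d)%N.
Proof.
rewrite -sum1_card (eq_bigl (fun p : 'I_(e.*2) * 'I_B.+1 => Q p.1 && (p.2 < l' p.1)%N)); last by move=> p; rewrite inE.
rewrite -(pair_big_dep Q (fun d (k : 'I_B.+1) => (k < l' d)%N) (fun _ _ => 1%N)) /=.
apply: eq_bigr => d _.
by rewrite -(big_ord_widen _ (fun=> 1%N)) ?sum1_card ?card_ord // ltnW.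
Qed.

(** The lattice points on the oriented edges cover [A], and there are as many
    of them as elements of [A]. *)
Lemma tower_inj d k d' k' : (k < l d)%N -> (k' < l d')%N ->
  iter k phi (j d) = iter k' phi (j d') -> d = d' /\ k = k'.
Proof.
have PE : P = [set p : 'I_(e.*2) * 'I_B.+1 | xpredT p.1 && (p.2 < l p.1)%N] by apply/setP=> p; rewrite !inE.
have cP : #|P| = #|A|.
  rewrite PE; apply: etrans (card_tower l xpredT) _.
  rewrite card_labelled (partition_big (lab G) xpredT) //=.
  by apply: eq_bigr => i _; rewrite -l_sum.
have imP : f @: P = A.
  apply/setP=> z; apply/imsetP/idP => [[p _ ->]|/tower_cover[d0 [k0 [kl ->]]]].
    by rewrite closed_iter.
  have kB : (k0 < B.+1)%N by apply: leq_trans kl (leq_trans (le_B d0) _).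
  by exists (d0, Ordinal kB); rewrite ?inE.
have /imset_injP injf : #|f @: P| == #|P| by rewrite imP cP.
move=> kl kl' E.
have kB : (k < B.+1)%N by apply: leq_trans kl (leq_trans (le_B d) _).
have kB' : (k' < B.+1)%N by apply: leq_trans kl' (leq_trans (le_B d') _).
have [] : (d, Ordinal kB) = (d', Ordinal kB') by apply: injf; rewrite ?inE.
by move=> -> ->.
Qed.

Lemma placement_inj : injective j.
Proof. by move=> d d' E; have [] := @tower_inj d 0 d' 0 (l_gt0 d) (l_gt0 d') E. Qed.

(** The gluing of the unit sides defined by the metric fatgraph. *)
Lemma reversal_exists : exists2 al, al \in matchings A & reverses G l j al.
Proof.
pose h z := if [pick p in P | f p == z] is Some p
  then iter (l p.1 - p.2.+1) phi (j (tau1 G p.1)) else z.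
have hE d k : (k < l d)%N -> h (iter k phi (j d)) = iter (l d - k.+1) phi (j (tau1 G d)).
  move=> kl; rewrite /h; case: pickP => [p /andP[]|/(_ (d, inord k))].
    by rewrite inE => pl /eqP /(tower_inj pl kl)[-> ->].
  have kB : (k < B.+1)%N by apply: leq_trans kl (leq_trans (le_B d) _).
  by rewrite inE /= inordK // kl eqxx.
have hC z : z \notin A -> h z = z.
  move=> zA; rewrite /h; case: pickP => // p /andP[_ /eqP zE].
  by move: zA; rewrite -zE closed_iter // jA.
have lk d k : (k < l d)%N -> (l d - k.+1 < l (tau1 G d))%N by rewrite l_tau1; lia.
have hK : involutive h.
  move=> z; have [/tower_cover[d [k [kl ->]]]|zA] := boolP (z \in A); last by rewrite !hC.
  rewrite hE // hE ?lk // l_tau1 tau1K (_ : (l d - (l d - k.+1).+1 = k)%N) //; lia.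
exists (perm (inv_inj hK)); last by move=> d k kl; rewrite permE hE.
apply/matchingsP; split=> [|z zA|z]; rewrite ?permE //.
  by apply/subsetP=> z; rewrite inE permE; apply: contraNT => /hC ->.
have [d [k [kl ->]]] := tower_cover zA; rewrite hE //; apply/eqP=> E.
by have [E1 _] := tower_inj (lk d k kl) kl E; have := tau1N d; rewrite E1 eqxx.
Qed.

Section OneReversal.
Variable al : {perm D}.
Hypotheses (alM : al \in matchings A) (alR : reverses G l j al).
Local Notation sg := (al * phi)%g.
Local Notation X := (corners A sg).

Lemma vertex_at_start d : sg (j d) = j (tau0 G d).
Proof.
rewrite permM (_ : al (j d) = iter (l d - 1) phi (j (tau1 G d))); last exact: (alR (l_gt0 d)).
rewrite -iterS -subSn // subn1 /= -(l_tau1 d) -j_tau2.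
by rewrite permM tau1K.
Qed.

Lemma vertex_inside d k : (0 < k < l d)%N ->
  sg (iter k phi (j d)) = iter (l d - k) phi (j (tau1 G d)).
Proof. by case/andP=> k0 kl; rewrite permM alR // -iterS -subSn // subSS. Qed.

(** Vertices of a fatgraph have valency greater than two. *)
Lemma start_corner d : j d \in X.
Proof.
rewrite inE jA /= !vertex_at_start (inj_eq placement_inj).
have [_ _ _ /(_ d) v3 _] := is_fatgraphP _ fG.
apply: contraTN v3 => /eqP t2; rewrite -leqNgt.
apply: leq_trans (subset_leq_card (_ : _ \subset [set d; tau0 G d])) (leq_trans (leq_card_setU _ _) _).
  apply/subsetP=> u /porbit_iterP[k ->]; rewrite !inE.
  by elim: k => [|k /orP[]/eqP IH] /=; rewrite ?IH ?t2 eqxx ?orbT.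
by rewrite !cards1.
Qed.

Lemma inside_not_corner d k : (0 < k < l d)%N -> iter k phi (j d) \notin X.
Proof.
move=> /[dup] kl /andP[k0 kl']; rewrite inE closed_iter // jA /= negbK vertex_inside //.
rewrite vertex_inside l_tau1; last by lia.
by rewrite tau1K (_ : (l d - (l d - k) = k)%N) //; lia.
Qed.

Lemma corners_placement : X = j @: setT.
Proof.
apply/setP=> z; apply/idP/imsetP => [zX|[d _ ->]]; last exact: start_corner.
have /tower_cover[d [[|k] [kl zE]]] : z \in A by move: zX; rewrite inE => /andP[].
  by exists d.
by move: zX; rewrite zE (negPf (inside_not_corner _)).
Qed.

Lemma reversal_leafless z : z \in A -> sg z != z.
Proof.
case/tower_cover=> d [[|k] [kl ->]].
  rewrite vertex_at_start (inj_eq placement_inj).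
  have := start_corner d; rewrite inE !vertex_at_start (inj_eq placement_inj) => /andP[_].
  by apply: contraNneq => E; rewrite !E.
rewrite vertex_inside //; apply/eqP=> E.
have lk : (l d - k.+1 < l (tau1 G d))%N by rewrite l_tau1; lia.
by have [E1 _] := tower_inj lk kl E; have := tau1N d; rewrite E1 eqxx.
Qed.

Lemma reversal_connected : connected A phi al.
Proof.
have [_ _ /connectedP[T0 TP] _ _] := is_fatgraphP _ fG.
have alA := closed_matching alM.
apply/connectedP; split=> [|S SA /set0Pn[z zS] pS aS].
  by have /set0Pn[d _] := T0; apply/set0Pn; exists (j d).
have SE : [set d | j d \in S] = setT.
  apply: TP; first exact: subsetT.
  - have [d [k [_ zE]]] := tower_cover (subsetP SA _ zS).
    by apply/set0Pn; exists d; rewrite inE -(closed_iter k _ pS) -zE.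
  - by apply/closed_byP=> d; rewrite !inE -vertex_at_start permM !closed_mem.
  apply/closed_byP=> d; rewrite !inE => dS.
  by rewrite -(closed_iter (l d - 1) _ pS) -(alR (l_gt0 d)) closed_mem.
apply/eqP; rewrite eqEsubset SA; apply/subsetP=> u uA.
have [d [k [_ ->]]] := tower_cover uA; rewrite closed_iter //.
by have := in_setT d; rewrite -SE inE.
Qed.

Lemma reversal_norb : (norb sg A).*2 = (#|X0 G|.*2 + (B - e.*2))%N.
Proof.
have alA := closed_matching alM.
have cA : closed_by sg A by apply/closed_byP=> z; rewrite permM !closed_mem.
rewrite norb_corners //; last exact: reversal_leafless.
rewrite card_labelled corners_placement (card_imset _ placement_inj) cardsT card_ord.
congr (_.*2 + _)%N; rewrite /norb /X0 /porbits -imset_comp.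
have pE d : porbit sg (j d) = j @: porbit (tau0 G) d.
  have itE k : iter k sg (j d) = j (iter k (tau0 G) d).
    by elim: k => //= k ->; rewrite vertex_at_start.
  apply/setP=> z; apply/porbit_iterP/imsetP => [[k ->]|[u /porbit_iterP[k ->] ->]].
    by rewrite itE; eexists; last reflexivity; apply/porbit_iterP; exists k.
  by exists k; rewrite itE.
rewrite -[RHS](card_imset _ (imset_inj placement_inj)) -imset_comp.
apply: eq_card => S; apply/imsetP/imsetP => -[d _ ->]; exists d => //=; by rewrite pE.
Qed.

Lemma reversal_euler g : euler A n phi al g = has_genus g G.
Proof.
rewrite /euler /has_genus (card_X1 fG) (card_X2 fG) card_labelled.
have := reversal_norb; have : (e.*2 <= B)%N.
  rewrite -card_labelled -[e.*2]card_ord -(card_imset _ placement_inj).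
  by apply/subset_leq_card/subsetP=> _ /imsetP[d _ ->].
move: (norb _ _) B #|X0 G|; clear=> v s c se vE; apply/eqP/eqP; lia.
Qed.

Lemma reversal_gluing g : (al \in gluings A n phi set0 g) = has_genus g G.
Proof.
rewrite in_set alM reversal_connected reversal_euler /=.
suff -> : leaves A phi al \subset set0 by [].
apply/subsetP=> z; rewrite !inE => /andP[zA]; have := reversal_leafless zA.
by rewrite permM => /negPf->.
Qed.

End OneReversal.
End OnePlacement.

Lemma reversal_unique G l j al al' : is_fatgraph G -> l \in lengths G b -> placement G l j ->
  al \in matchings A -> al' \in matchings A ->
  reverses G l j al -> reverses G l j al' -> al = al'.
Proof.
move=> fG lG jG alM al'M alR al'R; apply/permP=> z.
have [zA|zA] := boolP (z \in A).
  by have [d [k [kl ->]]] := tower_cover fG lG jG zA; rewrite alR // al'R.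
have [pal _ _] := matchingsP _ _ alM; have [pal' _ _] := matchingsP _ _ al'M.
by rewrite (out_perm pal) // (out_perm pal').
Qed.

(** The oriented edges start at the corners of the gluing, so that lengths are
    distances between successive corners, and the three permutations can be
    read off the positions [j]. *)
Lemma metric_unique G G' l l' j al : is_fatgraph G -> is_fatgraph G' ->
  l \in lengths G b -> l' \in lengths G' b -> placement G l j -> placement G' l' j ->
  al \in matchings A -> reverses G l j al -> reverses G' l' j al -> (G, l) = (G', l').
Proof.
move=> fG fG' lG lG' jG jG' alM alR alR'.
have jI := placement_inj fG lG jG.
have [_ j2 j3] := placementP _ _ _ jG; have [_ j2' j3'] := placementP _ _ _ jG'.
have t0 : tau0 G =1 tau0 G'.
  move=> d; apply: jI; rewrite -(vertex_at_start fG lG jG alR).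
  by rewrite (vertex_at_start fG' lG' jG' alR').
have ll' : forall d, l d = l' d :> nat.
  move=> d; apply/eqP; rewrite eqn_leq; have [l0 _ _] := lengthsP _ _ lG.
  have [l0' _ _] := lengthsP _ _ lG'.
  apply/andP; split; rewrite leqNgt; apply/negP => lt.
    have := @inside_not_corner _ _ _ fG lG jG _ alM alR d (l' d); rewrite l0' lt => /(_ isT).
    by rewrite -j3' (start_corner fG' lG' jG' alR').
  have := @inside_not_corner _ _ _ fG' lG' jG' _ alM alR' d (l d); rewrite l0 lt => /(_ isT).
  by rewrite -j3 (start_corner fG lG jG alR).
have t2 : tau2 G =1 tau2 G' by move=> d; apply: jI; rewrite j3 j3' ll'.
have t1 : tau1 G =1 tau1 G'.
  by move=> d; have := t2 d; rewrite !permM t0 => /perm_inj.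
have lE : l = l' by apply/ffunP=> d; apply/val_inj/ll'.
rewrite lE; congr (_, _); case: G G' {fG fG' lG lG' jG jG' alR alR' j3 j3' t2} j2 j2' t0 t1 => [[G0 G1] Gl] [[G0' G1'] Gl'].
rewrite /tau0 /tau1 /lab /= => j2 j2' t0 t1.
congr (_, _, _); [exact/permP | exact/permP | apply/ffunP=> d; by rewrite -j2 -j2'].
Qed.

End Tower.

(** * From gluings to metric fatgraphs *)

Section Smoothing.
Variables (D : finType) (A : {set D}) (phi : {perm D}) (n : nat) (lb : D -> 'I_n).
Variables (b : n.-tuple nat) (e : nat).
Hypothesis phA : closed_by phi A.
Hypothesis lbP : {in A &, forall x y, (lb x == lb y) = (y \in porbit phi x)}.
Hypothesis lbb : forall i, #|[set x in A | lb x == i]| = tnth b i.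
Hypothesis b_gt0 : positive b.
Variables (g : nat) (al : {perm D}) (j : {ffun 'I_(e.*2) -> D}).
Hypotheses (st : stable g n) (alU : al \in gluings A n phi set0 g).
Hypotheses (jI : injective j) (jX : j @: setT = corners A (al * phi)%g).
Local Notation B := (\sum_i tnth b i)%N.
Local Notation sg := (al * phi)%g.
Local Notation X := (corners A sg).

Let alM : al \in matchings A. Proof. by case: (gluingP alU). Qed.
Let alA : closed_by al A := closed_matching alM.
Let alK : involutive al. Proof. by case: (matchingsP _ _ alM). Qed.
Let alN : {in A, forall z, al z != z}. Proof. by case: (matchingsP _ _ alM). Qed.
Let sgA : closed_by sg A := gluing_closed phA alU.
Let sgN : {in A, forall z, sg z != z} := gluing_leafless alU.
Let sgX : closed_by sg X := closed_corners sgA.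
Let X2 z : z \in A -> z \notin X -> sg (sg z) = z.
Proof. by move=> zA; rewrite inE zA /= negbK => /eqP. Qed.

Let jX' d : j d \in X. Proof. by rewrite -jX imset_f. Qed.
Let jA d : j d \in A. Proof. by have := jX' d; rewrite inE => /andP[]. Qed.

(** The distance along a face to the next corner; the implication makes the
    minimum exist for every [z]. *)
Let ret_ex (z : D) : exists k, (0 < k)%N && ((z \in X) ==> (iter k phi z \in X)).
Proof.
exists #|porbit phi z|; rewrite iter_porbit implybb andbT card_gt0.
by apply/set0Pn; exists z; apply: porbit_id.
Qed.
Let ret z := ex_minn (ret_ex z).

Let retP z : z \in X -> [/\ (0 < ret z)%N, iter (ret z) phi z \in X &
  forall k, (0 < k)%N -> iter k phi z \in X -> (ret z <= k)%N].
Proof.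
move=> zX; rewrite /ret; case: ex_minnP => k /andP[k0]; rewrite zX /= => kX kmin.
by split=> // m m0 mX; apply: kmin; rewrite m0.
Qed.

Let ret_le z : z \in X -> (ret z <= B)%N.
Proof.
move=> zX; have [_ _ rmin] := retP zX.
apply: leq_trans (rmin #|porbit phi z| _ _) _.
- by rewrite card_gt0; apply/set0Pn; exists z; apply: porbit_id.
- by rewrite iter_porbit.
rewrite -(card_labelled lbb); apply/subset_leq_card/subsetP=> _ /porbit_iterP[k ->].
by rewrite closed_iter //; move: zX; rewrite inE => /andP[].
Qed.

(** The oriented edge that starts at the corner [z]; the default [d] is only
    used away from the corners. *)
Let pull z d := odflt d [pick d' | j d' == z].
Let pullK z d : z \in X -> j (pull z d) = z.
Proof.
rewrite -jX => /imsetP[d' _ ->]; rewrite /pull; case: pickP => [u /eqP //|/(_ d')].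
by rewrite eqxx.
Qed.

Let t0f d := pull (sg (j d)) d.
Let t0fE d : j (t0f d) = sg (j d). Proof. by rewrite pullK // closed_mem. Qed.
Let t0f_inj : injective t0f.
Proof. by move=> d d' E; apply: jI; apply: (@perm_inj _ sg); rewrite -!t0fE E. Qed.
Let t0 := perm t0f_inj.
Let t0E d : j (t0 d) = sg (j d). Proof. by rewrite permE t0fE. Qed.

Let t2f d := pull (iter (ret (j d)) phi (j d)) d.
Let t2fE d : j (t2f d) = iter (ret (j d)) phi (j d).
Proof. by rewrite pullK //; have [_ ? _] := retP (jX' d). Qed.

Let iter_phi_inj k : injective (iter k phi).
Proof. by elim: k => [|k IH] x y //= /perm_inj /IH. Qed.

Let return_inj d k d' k' : (k < ret (j d))%N -> (k' < ret (j d'))%N ->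
  iter k phi (j d) = iter k' phi (j d') -> d = d' /\ k = k'.
Proof.
wlog kk' : d k d' k' / (k <= k')%N => [W|] kr kr' E.
  have [/W|/ltnW/W W'] := leqP k k'; first exact.
  by have [-> ->] := W' _ _ kr' kr (esym E).
move: E; rewrite -(subnKC kk') iterD => /iter_phi_inj E.
have [_ _ rmin] := retP (jX' d').
have [k0|k0] := posnP (k' - k)%N.
  by move: E; rewrite k0 addn0 => /jI.
have := rmin _ k0; rewrite -E => /(_ (jX' d)); lia.
Qed.

Let t2f_inj : injective t2f.
Proof.
move=> d d' E; have [r0 _ _] := retP (jX' d); have [r0' _ _] := retP (jX' d').
have {}E : iter (ret (j d)) phi (j d) = iter (ret (j d')) phi (j d') by rewrite -!t2fE E.
have [] // := @return_inj d (ret (j d)).-1 d' (ret (j d')).-1.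
- by rewrite prednK.
- by rewrite prednK.
by apply: (@perm_inj _ phi); rewrite -!iterS !prednK.
Qed.
Let t2 := perm t2f_inj.
Let t2E d : j (t2 d) = iter (ret (j d)) phi (j d). Proof. by rewrite permE t2fE. Qed.

Let t1 : {perm 'I_(e.*2)} := (t2 * t0^-1)%g.
Let t0t1 d : t0 (t1 d) = t2 d. Proof. by rewrite permM permKV. Qed.

(** Between two corners all vertices are bivalent, so that the other side of an
    edge is traversed backwards, one step at a time. *)
Let walk d k : (k < ret (j d))%N ->
  al (iter k phi (j d)) = iter (ret (j d) - k.+1) phi (j (t1 d)).
Proof.
move=> kr; have [m mE] : exists m, (m = ret (j d) - k.+1)%N by eexists.
have [r0 _ rmin] := retP (jX' d).
rewrite -mE; elim: m k kr mE => [|m IH] k kr mE.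
  have -> : k = (ret (j d)).-1 by lia.
  apply: (@perm_inj _ sg); rewrite permM alK -iterS prednK // -t2E -t0t1 t0E //.
have kr' : (k.+1 < ret (j d))%N by rewrite -subn_gt0 -mE.
have kX : iter k.+1 phi (j d) \notin X by apply: contraTN kr' => /(rmin k.+1 isT); rewrite -leqNgt.
have kA : iter k.+1 phi (j d) \in A by rewrite closed_iter.
rewrite iterS -(IH k.+1 kr'); last by rewrite subnS -mE.
rewrite -[RHS](permM al phi); apply: (@perm_inj _ al); rewrite alK.
by apply: (@perm_inj _ phi); rewrite -[RHS](permM al phi) X2.
Qed.

Let ret_t1 d : ret (j (t1 d)) = ret (j d).
Proof.
have [r0 _ rmin] := retP (jX' d); have [r0' rX' rmin'] := retP (jX' (t1 d)).
apply/eqP; rewrite eqn_leq; apply/andP; split.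
  apply: rmin' => //; rewrite -(prednK r0) iterS -subn1 -(walk r0) /=.
  by rewrite -[phi (al _)](permM al phi) closed_mem.
rewrite leqNgt; apply/negP=> lt; move: rX'; set m := ret (j (t1 d)) in r0' lt *.
have kr : (ret (j d) - m < ret (j d))%N by lia.
have kX : iter (ret (j d) - m) phi (j d) \notin X.
  by apply: contraTN kr => /rmin; rewrite -leqNgt; apply; lia.
rewrite -(prednK r0') iterS; have -> : m.-1 = (ret (j d) - (ret (j d) - m).+1)%N by lia.
by rewrite -(walk kr) -[phi (al _)](permM al phi) closed_mem ?(negPf kX).
Qed.

Let t1K : involutive t1.
Proof.
move=> d; apply: (@perm_inj _ t0); apply: jI; rewrite t0t1 t2E ret_t1 t0E.
have [r0 _ _] := retP (jX' d).
by rewrite -(prednK r0) iterS -subn1 -(walk r0) /= permM.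
Qed.

(** If [t1] fixed [d], then the middle of this edge would be a side glued to
    itself, if its length is odd, or a leaf, if its length is even. *)
Let t1N d : t1 d != d.
Proof.
apply/eqP=> E; have [r0 _ _] := retP (jX' d); set L := ret (j d) in r0 *.
have [oL|oL] := boolP (odd L).
  have kr : (L./2 < L)%N by rewrite -[X in (_ < X)%N]odd_double_half oL; lia.
  have := walk kr; rewrite E; have -> : (ret (j d) - L./2.+1 = L./2)%N.
    by rewrite -/L -[X in (X - _)%N]odd_double_half oL; lia.
  by move/eqP; rewrite (negPf (alN _)) // closed_iter.
have LE : L = L./2.*2 by rewrite -[LHS]odd_double_half (negPf oL).
(* the two sides at the middle of the edge *)
have kr : (L./2 < L)%N by lia.
have := walk kr; rewrite E; have -> : (ret (j d) - L./2.+1 = L./2.-1)%N by rewrite -/L; lia.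
move=> E2; have := sgN (x := iter L./2 phi (j d)); rewrite closed_iter // => /(_ (jA d)).
by rewrite permM E2 -iterS prednK ?eqxx //; lia.
Qed.

Let G : fatdata n e := (t0, t1, [ffun d => lb (j d)]).
Let l : {ffun 'I_(e.*2) -> 'I_B.+1} := [ffun d => inord (ret (j d))].

Let lE d : l d = ret (j d) :> nat.
Proof. by rewrite ffunE inordK // ltnS ret_le. Qed.

Let tau2E d : tau2 G d = t2 d. Proof. by rewrite permM /G /tau0 /tau1 /= t0t1. Qed.

Let lb_iter k z : z \in A -> lb (iter k phi z) = lb z.
Proof.
move=> zA; have itA : iter k phi z \in A by rewrite closed_iter.
by apply/eqP; rewrite eq_sym lbP //; apply/porbit_iterP; exists k.
Qed.

Let placed : placement A phi lb G l j.
Proof.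
apply/placementP; split=> [d|d|d]; [exact: jA | by rewrite /lab ffunE | ].
by rewrite tau2E t2E lE.
Qed.

Let meets i : exists d, lb (j d) = i.
Proof.
have /card_gt0P[x] : (0 < #|[set x in A | lb x == i]|)%N by rewrite lbb.
rewrite inE => /andP[xA /eqP <-]; have [y yx] := face_meets_corners phA alU st xA.
rewrite -jX => /imsetP[d _ yE]; exists d; rewrite -yE.
by case/porbit_iterP: yx => k ->; rewrite lb_iter.
Qed.

Let cover z : z \in A -> exists d k, (k < l d)%N /\ z = iter k phi (j d).
Proof.
move=> zA; pose S := [set z | [exists d, exists k : 'I_(l d), z == iter k phi (j d)]].
have SP u : reflect (exists d k, (k < l d)%N /\ u = iter k phi (j d)) (u \in S).
  rewrite inE; apply: (iffP existsP) => [[d /existsP[k /eqP uE]]|[d [k [kl ->]]]].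
    by exists d, k; split.
  by exists d; apply/existsP; exists (Ordinal kl).
have cS : closed_by phi S.
  apply/closed_byP=> u /SP[d [k [kl ->]]]; apply/SP.
  have [kl'|kl'] := ltnP k.+1 (l d); first by exists d, k.+1.
  have kE : ret (j d) = k.+1 by rewrite -lE; apply/eqP; rewrite eqn_leq kl kl'.
  exists (t2 d), 0%N; split=> /=; last by rewrite t2E kE.
  by rewrite lE; have [] := retP (jX' (t2 d)).
apply/SP; have [d dz] := meets (lb z).
have : z \in porbit phi (j d) by rewrite -lbP // dz.
case/porbit_iterP=> k ->; rewrite closed_iter //; apply/SP.
by exists d, 0%N; split=> //; rewrite lE; have [] := retP (jX' d).
Qed.

Let l_lengths : l \in lengths G b.
Proof.
apply/lengthsP; split=> [d|d|i].
- by rewrite lE; have [] := retP (jX' d).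
- by apply: val_inj; rewrite /= !lE /tau1 /= ret_t1.
rewrite -lbb -(card_tower l (fun d => lab G d == i)).
rewrite -(card_in_imset (f := fun p : 'I_(e.*2) * 'I_B.+1 => iter p.2 phi (j p.1))).
  apply: eq_card => z; rewrite inE; apply/imsetP/andP => [[p]|[zA /eqP zi]].
    rewrite inE ffunE => /andP[/eqP <- _] ->.
    by rewrite closed_iter // jA lb_iter // eqxx.
  have [d [k [kl zE]]] := cover zA.
  have kB : (k < B.+1)%N by apply: leq_trans kl (ltnW (ltn_ord (l d))).
  exists (d, Ordinal kB) => //; rewrite inE kl andbT ffunE /= -zi zE lb_iter //.
move=> [d k] [d' k']; rewrite !inE /= !lE => /andP[_ kl] /andP[_ kl'] E.
by have [-> /val_inj ->] := return_inj kl kl' E.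
Qed.

Let fat : is_fatgraph G.
Proof.
apply/is_fatgraphP; split.
- exact: t1N.
- exact: t1K.
- have [A0 AP] := connectedP _ _ _ (let: And3 _ c _ := gluingP alU in c).
  have [d0 _] : exists d : 'I_(e.*2), True.
    by have /set0Pn[z /cover[d _]] := A0; exists d.
  apply/connectedP; split=> [|S _ /set0Pn[d1 d1S] c0 c1]; first by apply/set0Pn; exists d0.
  have c2 d : (t2 d \in S) = (d \in S) by rewrite -t0t1 (closed_mem _ c0) (closed_mem _ c1).
  pose S' := [set z | [exists d in S, exists k : 'I_(l d), z == iter k phi (j d)]].
  have SP u : reflect (exists d k, [/\ d \in S, (k < l d)%N & u = iter k phi (j d)]) (u \in S').
    rewrite inE; apply: (iffP exists_inP) => [[d dS /existsP[k /eqP uE]]|[d [k [dS kl ->]]]].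
      by exists d, k; split.
    by exists d => //; apply/existsP; exists (Ordinal kl).
  have l0 d : (0 < l d)%N by rewrite lE; have [] := retP (jX' d).
  have S'A : S' = A.
    apply: AP.
    + by apply/subsetP=> u /SP[d [k [_ _ ->]]]; rewrite closed_iter.
    + by apply/set0Pn; exists (j d1); apply/SP; exists d1, 0%N; split.
    + apply/closed_byP=> u /SP[d [k [dS kl ->]]]; apply/SP.
      have [kl'|kl'] := ltnP k.+1 (l d); first by exists d, k.+1.
      have kE : ret (j d) = k.+1 by rewrite -lE; apply/eqP; rewrite eqn_leq kl kl'.
      by exists (t2 d), 0%N; split; rewrite ?c2 //= t2E kE.
    apply/closed_byP=> u /SP[d [k [dS kl ->]]]; apply/SP.
    exists (t1 d), (l d - k.+1)%N; split; first by rewrite (closed_mem _ c1).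
      by rewrite !lE ret_t1 ltn_subrL; have [-> _ _] := retP (jX' d).
    by rewrite lE walk // -lE.
  apply/eqP; rewrite eqEsubset subsetT; apply/subsetP=> d _.
  have : j d \in S' by rewrite S'A.
  case/SP=> d' [k [d'S kl E]]; have [] := @return_inj d 0 d' k; rewrite -?lE //.
  by move=> ->.
- move=> d; rewrite /tau0 /=.
  have n1 : t0 d != d by apply: contraNneq (sgN (jA d)) => E; rewrite -t0E E.
  have n2 : t0 (t0 d) != d.
    by have := jX' d; rewrite inE -!t0E (inj_eq jI) => /andP[].
  have n3 : t0 (t0 d) != t0 d by rewrite (inj_eq perm_inj).
  apply: leq_trans (subset_leq_card (_ : [set d; t0 d; t0 (t0 d)] \subset _)).
    rewrite setUC cardsU1 !inE negb_or n2 n3 cards2 eq_sym n1 //.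
  by apply/subsetP=> u; rewrite !inE => /orP[/orP[]|]/eqP->; apply/porbit_iterP;
    [exists 0%N | exists 1%N | exists 2%N].
split=> [d d'|i]; last by have [d dE] := meets i; exists d; rewrite ffunE.
rewrite !ffunE lbP //; apply/porbit_iterP/porbit_iterP => -[k]; last first.
  move->; elim: k => [|k [m mE]] /=; first by exists 0%N.
  by rewrite tau2E t2E mE -iterD; eexists.
have [m] := ubnP k; elim: m k d => // m IH k d; rewrite ltnS => km E.
have [k0|k0] := posnP k.
  by exists 0%N; apply: jI; rewrite E k0.
have [r0 _ rmin] := retP (jX' d).
have rk : (ret (j d) <= k)%N by apply: rmin => //; rewrite -E.
have km' : (k - ret (j d) < m)%N by apply: leq_trans km; rewrite ltn_subrL r0 k0.
have E' : j d' = iter (k - ret (j d)) phi (j (t2 d)) by rewrite t2E -iterD subnK.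
have [q qE] := IH _ _ km' E'.
by exists q.+1; rewrite iterSr tau2E.
Qed.

Lemma smoothing_exists : exists G l, [/\ G \in fatgraphs n e g, l \in lengths G b,
  placement A phi lb G l j & reverses phi G l j al].
Proof.
have alR : reverses phi G l j al by move=> d k; rewrite lE => /walk.
exists G, l; split=> //; rewrite inE fat -(reversal_gluing phA lbP lbb fat l_lengths placed alM alR).
exact: alU.
Qed.

End Smoothing.

(** * Gluings count lattice points *)

Section Placements.
Variables (D : finType) (A : {set D}) (phi : {perm D}) (n : nat) (lb : D -> 'I_n).
Variables (b : n.-tuple nat) (e : nat).
Hypothesis phA : closed_by phi A.
Hypothesis lbP : {in A &, forall x y, (lb x == lb y) = (y \in porbit phi x)}.
Hypothesis lbb : forall i, #|[set x in A | lb x == i]| = tnth b i.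
Local Notation B := (\sum_i tnth b i)%N.

Lemma face_period r i : r \in [set x in A | lb x == i] -> iter (tnth b i) phi r = r.
Proof.
rewrite inE => /andP[rA /eqP ri]; rewrite -lbb -[RHS](iter_porbit phi r).
congr (iter _ _ _); apply: eq_card => x; rewrite inE.
apply/andP/idP => [[xA xi]|xr]; first by rewrite -lbP // ri eq_sym.
have xA : x \in A by case/porbit_iterP: xr => k ->; rewrite closed_iter.
by rewrite xA -ri eq_sym lbP.
Qed.

(** A placement is determined by the position of one oriented edge on each
    face, and this position is arbitrary. *)
Lemma card_placements (G : fatdata n e) (l : {ffun 'I_(e.*2) -> 'I_B.+1}) :
  is_fatgraph G -> l \in lengths G b ->
  #|[set j | placement A phi lb G l j]| = (\prod_i tnth b i)%N.
Proof.
move=> fG /lengthsP[l0 l1 ls].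
have [_ _ _ _ [labP labS]] := is_fatgraphP _ fG.
have [d0 d0P] := fin_all_exists labS.
set f := tau2 G; have fI : injective f by apply: perm_inj.
have labf k d : lab G (iter k f d) = lab G d.
  by apply/eqP; rewrite eq_sym labP; apply/porbit_iterP; exists k.
have con d : fconnect f (d0 (lab G d)) d.
  have : d \in porbit f (d0 (lab G d)) by rewrite -labP d0P.
  by case/porbit_iterP=> k {2}->; apply: fconnect_iter.
(* [d0 i] is the edge at which face [i] is rooted, [m d] the number of edges
   and [off d] the distance from this root to [d]. *)
pose m d := findex f (d0 (lab G d)) d.
have mE d : iter (m d) f (d0 (lab G d)) = d by apply: iter_findex.
pose off d := (\sum_(k < m d) l (iter k f (d0 (lab G d))))%N.
pose F (j : {ffun 'I_(e.*2) -> D}) := [ffun i => j (d0 i)].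
have iterE j k d : placement A phi lb G l j ->
    j (iter k f d) = iter (\sum_(k' < k) l (iter k' f d)) phi (j d).
  case/placementP=> _ _ jf; elim: k => [|k IH]; first by rewrite big_ord0.
  by rewrite big_ord_recr /= jf IH addnC iterD.
have Finj : {in [set j | placement A phi lb G l j] &, injective F}.
  move=> j j'; rewrite !inE => jP j'P /ffunP E; apply/ffunP=> d.
  by rewrite -(mE d) !iterE //; have := E (lab G d); rewrite !ffunE => ->.
rewrite -(card_in_imset Finj).
have -> : (\prod_i tnth b i)%N = #|family (fun i => mem [set x in A | lb x == i])|.
  rewrite card_family foldrE big_map big_enum /=.
  by apply: eq_bigr => i _; rewrite -lbb.
apply: eq_card => r; apply/imsetP/familyP => [[j]|rP].
  rewrite inE => /placementP[jA jl _] -> i; rewrite ffunE !inE jA jl d0P eqxx //.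
have rA i : r i \in A by have := rP i; rewrite !inE => /andP[].
have rl i : lb (r i) = i by have := rP i; rewrite !inE => /andP[_ /eqP].
exists [ffun d => iter (off d) phi (r (lab G d))]; last first.
  apply/ffunP=> i; rewrite !ffunE /off /m d0P findex0 big_ord0 //.
rewrite inE; apply/placementP; split=> d; rewrite !ffunE.
- by rewrite closed_iter.
- have itA : iter (off d) phi (r (lab G d)) \in A by rewrite closed_iter.
  apply/eqP; rewrite -[X in _ == X]rl eq_sym lbP //.
  by apply/porbit_iterP; exists (off d).
rewrite -/f (labf 1 d) -iterD; set i := lab G d.
have mN : (m d < fingraph.order f (d0 i))%N by apply: findex_max.
have lf : lab G (f d) = i by apply: (labf 1).
have sumE : (l d + off d = \sum_(k < (m d).+1) l (iter k f (d0 i)))%N.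
  by rewrite big_ord_recr /= addnC -/i mE.
have [mN'|mN'] := ltnP (m d).+1 (fingraph.order f (d0 i)).
  congr (iter _ _ _); rewrite sumE /off lf.
  have -> // : m (f d) = (m d).+1.
  by rewrite /m lf -[X in findex _ _ (f X)](mE d) -iterS findex_iter.
have mE' : (m d).+1 = fingraph.order f (d0 i) by apply/eqP; rewrite eqn_leq mN mN'.
have fd : f d = d0 i by rewrite -[X in f X](mE d) -iterS mE' iter_order.
have -> : off (f d) = 0%N by rewrite /off /m lf fd findex0 big_ord0.
rewrite sumE mE' /= -[LHS](@face_period (r i) i) ?inE ?rA ?rl ?eqxx //.
congr (iter _ _ _); apply: etrans (esym (ls i)) _.
have -> : (\sum_(k < fingraph.order f (d0 i)) l (iter k f (d0 i)) = \sum_(d' <- fingraph.orbit f (d0 i)) l d')%N.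
  rewrite (big_nth (d0 i)) size_orbit big_mkord; apply: eq_bigr => k _.
  by rewrite /fingraph.orbit nth_traject.
rewrite (big_uniq _ (orbit_uniq f (d0 i))) /=; apply: eq_bigl => d'.
rewrite -fconnect_orbit; apply/eqP/idP => [<-|/iter_findex <-]; first exact: con.
by rewrite labf d0P.
Qed.

End Placements.

Section LatticeCount.
Variables (D : finType) (A : {set D}) (phi : {perm D}) (n : nat) (lb : D -> 'I_n).
Variables (b : n.-tuple nat).
Hypothesis phA : closed_by phi A.
Hypothesis lbP : {in A &, forall x y, (lb x == lb y) = (y \in porbit phi x)}.
Hypothesis lbb : forall i, #|[set x in A | lb x == i]| = tnth b i.
Hypothesis b_gt0 : positive b.
Variable g : nat.
Hypothesis st : stable g n.
Local Notation B := (\sum_i tnth b i)%N.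
Local Notation U := (gluings A n phi set0 g).
Local Notation cor al := (corners A (al * phi)%g).

(** Both sides count the gluings whose corners are named by the oriented edges
    ([T] below). A name for each corner is the same as a metric fatgraph placed
    along the faces ([W] below), where a fatgraph can be rotated arbitrarily
    along each face. *)
Lemma card_subdivisions e :
  (#|[set al in U | #|cor al| == e.*2]| * (e.*2)`! =
   (\prod_i tnth b i) * \sum_(G in fatgraphs n e g) #|lengths G b|)%N.
Proof.
pose T := [set t : {ffun 'I_(e.*2) -> D} * {perm D} |
  [&& t.2 \in U, injectiveb t.1 & t.1 @: setT == cor t.2]].
pose W := [set w : (fatdata n e * {ffun 'I_(e.*2) -> 'I_B.+1}) * {ffun 'I_(e.*2) -> D} |
  [&& w.1.1 \in fatgraphs n e g, w.1.2 \in lengths w.1.1 b &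
      placement A phi lb w.1.1 w.1.2 w.2]].
transitivity #|T|.
  rewrite (@card_sum_unique _ _ T (fun al t => t.2 == al)); first last.
  - by move=> t al al' _ /eqP <- /eqP.
  - by move=> t _; exists t.2.
  rewrite -sum_nat_const [LHS]big_mkcond /=; apply: eq_bigr => al _.
  rewrite in_set; case alU: (al \in U) => /=; last first.
    apply/esym/eq_card0 => t; apply/negbTE/negP=> /setIdP[]; rewrite in_set.
    by case/and3P=> tU _ _ /eqP tal; rewrite -tal tU in alU.
  have -> : #|[set t in T | t.2 == al]| =
      #|[set j : {ffun 'I_(e.*2) -> D} | injectiveb j && (j @: setT == cor al)]|.
    rewrite -[RHS](card_imset _ (f := fun j => (j, al))); last by move=> j j' [].
    apply: eq_card => -[j al']; apply/setIdP/imsetP => [[]|[j']].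
      rewrite in_set => /and3P[/= _ jI jX] /eqP aE.
      by exists j; rewrite -?aE // in_set jI jX.
    by rewrite in_set => /andP[jI jX] [-> ->]; rewrite in_set /= alU jI jX.
  case: eqP => cX; last first.
    apply/esym/eq_card0 => j; rewrite inE; apply/negP=> /andP[/injectiveP jI /eqP jX].
    by apply: cX; rewrite -jX card_imset // cardsT card_ord.
  have <- : (#|cor al| ^_ #|'I_(e.*2)| = (e.*2)`!)%N by rewrite card_ord cX ffactnn.
  rewrite -card_inj_ffuns_on.
  apply: eq_card => j; rewrite !inE andbC; case jI: (injectiveb j) => //=.
  have jI' := injectiveP _ jI; apply/ffun_onP/eqP => [jX|jX d]; last by rewrite -jX imset_f.
  apply/eqP; rewrite eqEcard card_imset // cardsT card_ord cX leqnn andbT.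
  by apply/subsetP=> _ /imsetP[d _ ->]; apply: jX.
transitivity #|W|; last first.
  rewrite (@card_sum_unique _ _ W (fun p w => w.1 == p)); first last.
  - by move=> w p p' _ /eqP <- /eqP.
  - by move=> w _; exists w.1.
  have -> : (\sum_(G in fatgraphs n e g) #|lengths G b| =
      \sum_(p : fatdata n e * {ffun 'I_(e.*2) -> 'I_B.+1} |
         (p.1 \in fatgraphs n e g) && (p.2 \in lengths p.1 b)) 1)%N.
    rewrite -(pair_big_dep (mem (fatgraphs n e g)) (fun G l => l \in lengths G b) (fun _ _ => 1%N)) /=.
    by apply: eq_bigr => G _; rewrite sum1_card.
  rewrite big_distrr /= [RHS]big_mkcond; apply: eq_bigr => -[G l] _ /=.
  have [/andP[GF lG]|N] := boolP (_ && _); last first.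
    apply/eq_card0 => w; apply: contraNF N => /setIdP[]; rewrite in_set.
    by case/and3P=> a1 a2 _ /eqP wE; move: a1 a2; rewrite wE => /= -> ->.
  have fG : is_fatgraph G by move: GF; rewrite inE => /andP[].
  rewrite muln1 -(card_placements phA lbP lbb fG lG).
  rewrite -[RHS](card_imset _ (f := fun j => ((G, l), j))); last by move=> j j' [].
  apply: eq_card => -[p j]; apply/setIdP/imsetP => [[]|[j']].
    rewrite in_set => /and3P[/= _ _ jP] /eqP pE.
    by move: jP; rewrite pE => jP; exists j; rewrite ?in_set.
  by rewrite in_set => jP [-> ->]; rewrite in_set /= GF lG jP.
apply/esym/(@card_bij_rel _ _ W T
  (fun w t => w.2 = t.1 /\ reverses phi w.1.1 w.1.2 w.2 t.2)).
- move=> [[G l] j]; rewrite in_set => /and3P[/= GF lG jP].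
  have /andP[fG gG] : is_fatgraph G && has_genus g G by move: GF; rewrite in_set.
  have [al alM alR] := reversal_exists phA lbP lbb fG lG jP.
  exists (j, al); last by split.
  rewrite in_set /= (reversal_gluing phA lbP lbb fG lG jP alM alR) gG /=.
  rewrite (corners_placement phA lbP lbb fG lG jP alM alR) eqxx andbT.
  exact/injectiveP/(placement_inj phA lbP lbb fG lG jP).
- move=> [j al]; rewrite in_set => /and3P[/= alU /injectiveP jI /eqP jX].
  have [G [l [GF lG jP alR]]] := smoothing_exists phA lbP lbb b_gt0 st alU jI jX.
  by exists ((G, l), j); [rewrite in_set /= GF lG jP | split].
- move=> [[G l] j] [j1 al1] [j2 al2] wW t1 t2 [/= E1 r1] [/= E2 r2].
  rewrite in_set in wW; rewrite in_set in t1; rewrite in_set in t2.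
  have /and3P[/= GF lG jP] := wW; have /and3P[/= a1 _ _] := t1; have /and3P[/= a2 _ _] := t2.
  have fG : is_fatgraph G by move: GF; rewrite in_set => /andP[].
  have [m1 _ _] := gluingP a1; have [m2 _ _] := gluingP a2.
  by rewrite -E1 -E2 (reversal_unique lbP fG lG jP m1 m2 r1 r2).
move=> [[G l] j] [[G' l'] j'] [j1 al] w1 w2 t [/= E1 r1] [/= E2 r2].
rewrite in_set in w1; rewrite in_set in w2; rewrite in_set in t.
have /and3P[/= GF lG jP] := w1; have /and3P[/= GF' lG' jP'] := w2; have /and3P[/= aU _ _] := t.
have fG : is_fatgraph G by move: GF; rewrite in_set => /andP[].
have fG' : is_fatgraph G' by move: GF'; rewrite in_set => /andP[].
have [m1 _ _] := gluingP aU; rewrite E2 -E1 in jP' r2 *.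
by rewrite (metric_unique phA lbP lbb fG fG' lG lG' jP jP' m1 r1 r2).
Qed.

(** The sides of the polygons are distinguishable, so that gluings have no
    automorphisms; compared to fatgraphs with lattice edge lengths, they are
    rooted at a unit step of each face, which explains the product. *)
Lemma card_gluings_latN : (#|U|%:R = (\prod_i tnth b i)%:R * latN g b :> rat)%R.
Proof.
rewrite latN_sum // mulr_sumr.
transitivity (\sum_(e < 6 * g + 3 * n) #|[set al in U | #|cor al| == e.*2]|%:R : rat)%R; last first.
  apply: eq_bigr => e _; have := congr1 (fun k => k%:R : rat)%R (card_subdivisions e).
  rewrite !natrM => E; rewrite mulrCA -E mulrC mulrK // unitfE pnatr_eq0 -lt0n fact_gt0 //.
rewrite -natr_sum; congr (_%:R)%R; apply: card_sum_unique => [al alU|al e e' _]; last first.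
  by move=> /eqP -> /eqP; rewrite -!muln2 => /eqP; rewrite eqn_pmul2r // => /eqP/val_inj.
have [alM _ eA] := gluingP alU.
have sgA := gluing_closed phA alU; have sgN := gluing_leafless alU.
have XA : (#|cor al| <= #|A|)%N.
  by apply/subset_leq_card/subsetP=> z; rewrite inE => /andP[].
have ev : (#|cor al| = (#|cor al|./2).*2)%N.
  have := norb_corners sgA sgN; move: eA; rewrite /euler => /eqP.
  move: (norb _ _) (norb _ _) XA; move: #|A| #|cor al|; clear=> a c v w; lia.
set e := (#|cor al|./2)%N in ev.
have : (0 < #|[set al in U | #|cor al| == e.*2]| * (e.*2)`!)%N.
  by rewrite muln_gt0 fact_gt0 andbT; apply/card_gt0P; exists al; rewrite inE alU -ev eqxx.
rewrite card_subdivisions muln_gt0 => /andP[_]; rewrite lt0n sum_nat_eq0 negb_forall.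
case/existsP=> G; rewrite negb_imply => /andP[GF _].
by exists (Ordinal (fatgraph_edges GF)); rewrite /= -ev.
Qed.

End LatticeCount.

(** * Identities between sums over lengths *)

Local Open Scope ring_scope.

Section SumIdentities.
Implicit Types (f F : nat -> rat).

Definition same_parity (p m : nat) := (p <= m)%N && ~~ odd (m - p).

Lemma parity_sumE f m M : (m < M)%N ->
  parity_sum f m = \sum_(p < M | (0 < p)%N && same_parity p m) f p.
Proof.
have [k] := ubnP m; elim: k m => // k IH [|[|m]] mk mM.
- by rewrite big_pred0 // => -[[|p] pM].
- rewrite (bigD1 (Ordinal mM)) //= big1 ?addr0 // => p /andP[/andP[p0 /andP[p1 _]]].
  by rewrite -val_eqE /= => pN; move: p0 p1 pN; lia.
rewrite parity_sumSS (bigD1 (Ordinal mM)) /=; last by rewrite /same_parity subnn leqnn.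
congr (_ + _); rewrite IH; [|by lia|by lia]; apply: eq_bigl => -[p pM].
by rewrite -val_eqE /= /same_parity; lia.
Qed.

Lemma parity_sumZ f a m : parity_sum (fun p => a * f p) m = a * parity_sum f m.
Proof. by rewrite !(@parity_sumE _ m m.+1) // mulr_sumr. Qed.

Lemma parity_sumD f f' m :
  parity_sum (fun p => f p + f' p) m = parity_sum f m + parity_sum f' m.
Proof. by rewrite !(@parity_sumE _ m m.+1) // big_split. Qed.

Lemma eq_parity_sum f f' m :
  (forall p, (0 < p)%N -> f p = f' p) -> parity_sum f m = parity_sum f' m.
Proof.
by move=> E; rewrite !(@parity_sumE _ m m.+1) //; apply: eq_bigr => p /andP[p0 _]; apply: E.
Qed.

Lemma parity_sum_delta (c : nat) m : (0 < c)%N ->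
  parity_sum (fun p => (p == c)%:R) m = (same_parity c m)%:R.
Proof.
move=> c0; rewrite (@parity_sumE _ m (m + c).+1) ?ltnS ?leq_addr //.
have cM : (c < (m + c).+1)%N by rewrite ltnS leq_addl.
rewrite big_mkcond (bigD1 (Ordinal cM)) //= c0 eqxx big1 ?addr0 => [|p].
  by case: (same_parity c m).
by rewrite -val_eqE /= => /negPf->; case: ifP.
Qed.

Lemma parity_sum_exchange (h : nat -> nat -> rat) u v :
  parity_sum (fun p => parity_sum (h p) v) u =
  parity_sum (fun q => parity_sum (h^~ q) u) v.
Proof.
rewrite (@parity_sumE _ u u.+1) // (@parity_sumE _ v v.+1) //.
under eq_bigr do rewrite (@parity_sumE _ v v.+1) //.
under [RHS]eq_bigr do rewrite (@parity_sumE _ u u.+1) //.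
by rewrite exchange_big.
Qed.

Lemma corner_sumC F k l : corner_sum F k l = corner_sum F l k.
Proof. by elim: k l => [|k IH] [|l] //=; rewrite ?addn0 // addnC IH. Qed.

Lemma corner_sumZ F a k l : corner_sum (fun m => a * F m) k l = a * corner_sum F k l.
Proof. by elim: k l => [|k IH] [|l] //=; rewrite ?IH ?mulrDr ?mulr0. Qed.

Lemma eq_corner_sum F F' k l : F =1 F' -> corner_sum F k l = corner_sum F' k l.
Proof. by move=> E; elim: k l => [|k IH] [|l] //=; rewrite ?IH E. Qed.

(** The kernel of the first term of the recursion, where [q = s - p] is
    even. *)
Definition merge_kernel F (s : nat) : rat :=
  \sum_(p < s.+1) \sum_(q < s.+1 | [&& 0 < p, 0 < q, p + q == s & ~~ odd q]%N)
    q%:R * F p.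

(** [q] is determined by [p]. *)
Lemma merge_kernelE F s M : (s <= M)%N ->
  merge_kernel F s = \sum_(p < M | (0 < p)%N && same_parity p s) (s - p)%N%:R * F p.
Proof.
move=> sM; pose G p := if (0 < p)%N && same_parity p s then (s - p)%N%:R * F p else 0.
rewrite [RHS]big_mkcond /= -/(G _).
have -> : merge_kernel F s = \sum_(p < s.+1) G p.
  apply: eq_bigr => -[p ps] _ /=; have ps' : (p <= s)%N by [].
  rewrite /G /same_parity ps' andTb.
  have sp : (s - p < s.+1)%N by lia.
  have [/andP[p0 ev]|N] := boolP ((0 < p)%N && ~~ odd (s - p)); last first.
    by rewrite big_pred0 // => -[q qs] /=; apply/negbTE; apply: contra N; lia.
  have [sp0|sp0] := posnP (s - p)%N.
    rewrite sp0 mul0r big_pred0 // => -[q qs] /=; apply/negbTE; lia.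
  rewrite (big_pred1 (Ordinal sp)) // => -[q qs]; rewrite /= -val_eqE /=; lia.
have -> : \sum_(p < s.+1) G p = \sum_(p < s) G p.
  by rewrite big_ord_recr /= [G s](_ : _ = 0) ?addr0 // /G subnn mul0r; case: ifP.
rewrite (big_ord_widen _ G sM) big_mkcond /=; apply: eq_bigr => -[p pM] _ /=.
case: ltnP => // sp; rewrite /G /same_parity; case: ifP => // /andP[_ /andP[ps _]].
by rewrite (_ : s - p = 0)%N ?mul0r //; lia.
Qed.

Lemma merge_kernelSS F s : merge_kernel F s.+2 = merge_kernel F s + 2 * parity_sum F s.
Proof.
rewrite !(@merge_kernelE _ _ s.+2) ?(@parity_sumE _ _ s.+2) //; last by lia.
rewrite mulr_sumr big_mkcond [X in _ = X + _]big_mkcond [X in _ = _ + X]big_mkcond -big_split /=.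
apply: eq_bigr => -[p pM] _ /=; rewrite /same_parity.
have [ps|ps] := leqP p s; last first.
  rewrite /= andbF addr0 (_ : p = s.+1); last by lia.
  by rewrite subSn // subnn andbF.
have -> : (s.+2 - p = (s - p) + 2)%N by lia.
rewrite oddD addbF (_ : (p <= s.+2)%N) /=; last by lia.
by case: ifP; rewrite ?addr0 // natrD mulrDl.
Qed.

Lemma merge_kernel01 F : merge_kernel F 0 = 0 /\ merge_kernel F 1 = 0.
Proof.
split; rewrite (@merge_kernelE _ _ 1) // big_pred0 // => -[[|p] pM] //=.
Qed.

(** Contribution of the splittings of a face of length [a] that separate an
    annulus whose other face has length [c]. *)
Definition annulus_sum F (a c : nat) : rat :=
  \sum_(u < a.-1) (same_parity c u)%:R * parity_sum F (a - u.+2)%N.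

Lemma annulus_sum_small F a c : (a <= c.+1)%N -> annulus_sum F a c = 0.
Proof.
move=> ac; rewrite /annulus_sum big1 // => -[u ua] _ /=.
by rewrite (_ : same_parity c u = false) ?mul0r // /same_parity; apply/negbTE; lia.
Qed.

Lemma annulus_sumS F a c : annulus_sum F a.+1 c.+1 = annulus_sum F a c.
Proof.
case: a => [|a]; first by rewrite !annulus_sum_small.
rewrite /annulus_sum /= big_ord_recl /= mul0r add0r.
by apply: eq_bigr => u _; rewrite /same_parity /= /bump /= add1n subSS.
Qed.

Lemma annulus_sum1 F a : annulus_sum F a.+3 1 = annulus_sum F a.+1 1 + parity_sum F a.
Proof.
rewrite /annulus_sum /= big_ord_recl [X in X * _](_ : _ = 0) // mul0r add0r.
rewrite big_ord_recl [X in X * _](_ : _ = 1) // mul1r addrC; congr (_ + _); last first.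
  by congr parity_sum; rewrite /= /bump /=; lia.
apply: eq_bigr => u _; congr (_%:R * parity_sum F _).
by rewrite /= /bump /= !add1n /same_parity; lia.
Qed.

(** Decreasing [a] and [c] by one takes the first terms off both corner sums
    and leaves the annulus sums unchanged, which reduces the identity to
    [c = 1]; there, [a] is decreased by two. *)
Lemma merge_identity F a c : (0 < a)%N -> (0 < c)%N ->
  corner_sum (parity_sum F) a.-1 c.-1 + corner_sum (parity_sum F) c.-1 a.-1 +
  2 * annulus_sum F a c + 2 * annulus_sum F c a = merge_kernel F (a + c).
Proof.
have [q0 q1] := merge_kernel01 F.
wlog ca : a c / (c <= a)%N => [W|] a0 c0.
  have [/W|/ltnW/W W'] := leqP c a; first exact.
  by rewrite addnC -W' // addrAC [X in X + _ + _]addrC.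
rewrite (@annulus_sum_small _ c a) ?mulr0 ?addr0; last by lia.
rewrite [X in _ + X + _]corner_sumC.
have cs0 k : corner_sum (parity_sum F) k 0 = parity_sum F k.
  by case: k => [|k] /=; rewrite addr0 ?addn0.
case: c c0 ca => // c _; elim: c a a0 => [|c IH] a a0 ca.
  have [k] := ubnP a; elim: k a a0 {ca} => // k IHk [|[|[|a]]] // _ ak.
  - by rewrite annulus_sum_small // merge_kernelSS q0 !cs0; ring.
  - by rewrite annulus_sum_small // merge_kernelSS q1 !cs0; ring.
  rewrite annulus_sum1 [(a.+3 + 1)%N](_ : _ = (a.+1 + 1).+2)%N; last by lia.
  rewrite merge_kernelSS -IHk //; last by lia.
  rewrite !cs0 addn1 -[a.+3.-1]/(a.+2) -[a.+1.-1]/a. by ring.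
case: a a0 ca => // a _ ca; have [a1 ca'] : (0 < a)%N /\ (c < a)%N by lia.
rewrite annulus_sumS [(a.+1 + c.+2)%N](_ : _ = (a + c.+1).+2)%N; last by lia.
rewrite merge_kernelSS -IH //.
by case: a a1 {ca ca'} => // a _ /=; ring.
Qed.

Lemma count_parity m p :
  \sum_(u < m) (same_parity p u : nat) = uphalf (m - p) :> nat.
Proof.
elim: m => [|m IH]; first by rewrite big_ord0.
rewrite big_ord_recr /= IH /same_parity; have [pm|pm] := leqP p m; last first.
  by have [-> ->] : (m - p = 0)%N /\ (m.+1 - p = 0)%N by lia.
by rewrite subSn //=; lia.
Qed.

(** For given [p] and [q] the summation index [u] takes r / 2 values, where
    [r = s - p - q]: those between [p] and [s - q - 2] with the parity of
    [p]. *)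
Lemma split_identity (f : nat -> nat -> rat) s :
  \sum_(u < s.-1) parity_sum (fun p => parity_sum (f p) (s - u.+2)%N) u =
  2^-1 * \sum_(p < s.+1) \sum_(q < s.+1)
    \sum_(r < s.+1 | [&& 0 < p, 0 < q, 0 < r, p + q + r == s & ~~ odd r]%N)
      r%:R * f p q.
Proof.
transitivity (\sum_(p < s.+1) \sum_(q < s.+1) \sum_(u < s.-1)
   ([&& 0 < p, 0 < q, same_parity p u & same_parity q (s - u.+2)]%N)%:R * f p q).
  under [RHS]eq_bigr do rewrite exchange_big.
  rewrite [RHS]exchange_big /=; apply: eq_bigr => -[u us] _ /=.
  rewrite (@parity_sumE _ _ s.+1); last by lia.
  rewrite big_mkcond; apply: eq_bigr => p _.
  case: ifP => [/andP[-> pu]|N]; last first.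
    rewrite big1 // => q _; rewrite (_ : [&& _, _, _ & _] = false) ?mul0r //.
    by apply: contraFF N => /and4P[-> _ ->].
  rewrite (@parity_sumE _ _ s.+1); last by lia.
  rewrite big_mkcond; apply: eq_bigr => q _; rewrite pu /=.
  by case: ifP; rewrite ?mul1r ?mul0r.
rewrite mulr_sumr; apply: eq_bigr => -[p ps] _ /=; rewrite mulr_sumr; apply: eq_bigr => -[q qs] _ /=.
rewrite -mulr_suml -natr_sum.
have [/andP[p0 q0]|N] := boolP ((0 < p) && (0 < q))%N; last first.
  rewrite big1 ?mul0r => [|u _]; last by rewrite andbA (negPf N).
  by rewrite big_pred0 ?mulr0 // => r; apply: contraNF N => /and3P[-> ->].
set c := (\sum_(u < s.-1) _)%N.
have cE : c = (if (p + q < s)%N && ~~ odd (s - (p + q)) then (s - (p + q))./2 else 0)%N.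
  rewrite /c; case: ifP => [/andP[pqs ev]|N].
    have -> : (s - (p + q))./2 = uphalf (s.-1 - q - p).
      rewrite (_ : s - (p + q) = (s.-1 - q - p).+1)%N; last by lia.
      by rewrite uphalf_half; move: ev; lia.
    rewrite -count_parity (big_ord_widen s.-1 (fun u => nat_of_bool (same_parity p u))); last by lia.
    rewrite [RHS]big_mkcond /=; apply: eq_bigr => -[u us] _ /=; rewrite p0 q0 /=.
    rewrite /same_parity; case: ltnP => u1; last by lia.
    by move: ev; lia.
  by rewrite big1 // => -[u us] _ /=; rewrite /same_parity; lia.
have [/andP[pqs ev]|N] := boolP ((p + q < s)%N && ~~ odd (s - (p + q))).
  have rs : (s - (p + q) < s.+1)%N by lia.
  rewrite (big_pred1 (Ordinal rs)) => [|[r rs']]; last by rewrite /= -val_eqE /=; lia.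
  rewrite cE pqs ev /= mulrA; congr (_ * _).
  have E : (s - (p + q))%N = ((s - (p + q))./2).*2 by lia.
  rewrite [in RHS]E -mul2n natrM mulKf //.
rewrite cE (negPf N) mul0r big_pred0 ?mulr0 // => -[r rs] /=.
by apply/negbTE; apply: contra N => /and5P[_ _ r0 /eqP <- ev]; rewrite addKn ev; lia.
Qed.

End SumIdentities.

(** * Gluings of polygons in terms of the lattice count *)

(** [latN] on sequences, which frees it from the dependency on the length. *)
Definition latNs g (s : seq nat) : rat := latN g (in_tuple s).

Lemma latN_seq g m (t : m.-tuple nat) : latN g t = latNs g t.
Proof.
case: t => s sm; rewrite /latNs /=; have E : size s = m by apply/eqP.
by case: m / E sm => sm; congr (latN g _); apply: val_inj.
Qed.

(** Two polygons with the same number [a] of sides are glued to a circle in [a]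
    ways; circles are the only leafless gluings that do not come from a stable
    fatgraph. *)
Definition annuli g (s : seq nat) : rat :=
  match g, s with 0%N, [:: a; c] => (a * (a == c))%:R | _, _ => 0 end.

(** The leafless gluings of polygons with [s] sides, stable or not. *)
Definition gluing_count g (s : seq nat) : rat :=
  (\prod_(c <- s) c)%:R * latNs g s + annuli g s.

Section FaceLabels.
Variable D : finType.
Implicit Types (phi : {perm D}) (cs : seq (seq D)).

(** The labels of faces are their positions in the list, as a label must be an
    element of an ordinal type. *)
Definition face_index cs (x : D) := find (fun c => x \in c) cs.

Lemma face_index_lt cs x : x \in sides cs -> (face_index cs x < size cs)%N.
Proof. by rewrite inE -has_find => /flattenP[c ccs xc]; apply/hasP; exists c. Qed.

Lemma mem_face_index cs x : x \in sides cs -> x \in nth [::] cs (face_index cs x).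
Proof. by move/face_index_lt; rewrite -has_find => /(nth_find [::]). Qed.

Lemma face_indexE cs i x : uniq (flatten cs) -> x \in nth [::] cs i ->
  face_index cs x = i.
Proof.
elim: cs i => [|c cs IH] [|i] //=; rewrite cat_uniq => /and3P[_ hN ucs].
  by rewrite /face_index /= => ->.
move=> xi; rewrite /face_index /=; case: ifP => [xc|_]; last by congr S; apply: IH.
case/hasP: hN; exists x => //; apply/flattenP; exists (nth [::] cs i) => //.
by apply: mem_nth; rewrite ltnNge; apply: contraTN xi => /(nth_default [::]) ->.
Qed.

Lemma gluing_countE g phi cs : polygons phi cs -> cs != [::] ->
  (ngluings phi cs set0 g)%:R = gluing_count g (shape cs).
Proof.
move=> csP cs0; have [ucs csN fcs] := csP.
have [st|/negbTE st] := boolP (stable g (size (shape cs))); last first.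
  rewrite /gluing_count /latNs /latN st mulr0 add0r.
  move: st cs0 csP; rewrite /stable size_map; case: g => [|g]; last first.
    by case: cs {ucs csN fcs} => // c cs; rewrite /=; lia.
  case: cs {ucs csN fcs} => [|c [|c' [|c'' cs]]] //= _ _ csP.
    by rewrite ngluings_disc.
  by rewrite ngluings_annulus.
have n0 : (0 < size (shape cs))%N by rewrite size_map lt0n size_eq0.
pose lb x : 'I_(size (shape cs)) := insubd (Ordinal n0) (face_index cs x).
have lbE x : x \in sides cs -> lb x = face_index cs x :> nat.
  move=> xA; have lt : (face_index cs x < size (shape cs))%N.
    by rewrite size_map face_index_lt.
  by rewrite val_insubd lt.
have phA := closed_sides csP.
have lbmem x y : x \in sides cs -> y \in sides cs ->
    (lb x == lb y) = (y \in nth [::] cs (face_index cs x)).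
  move=> xA yA; rewrite -val_eqE /= !lbE //; apply/eqP/idP => [->|yx].
    exact: mem_face_index.
  by rewrite (face_indexE ucs yx).
have lbP : {in sides cs &, forall x y, (lb x == lb y) = (y \in porbit phi x)}.
  move=> x y xA yA; rewrite lbmem //.
  have fx : fcycle phi (nth [::] cs (face_index cs x)).
    by apply: (allP fcs); apply: mem_nth; apply: face_index_lt.
  by rewrite (porbit_cycle fx (mem_face_index xA)) inE.
have lbb i : #|[set x in sides cs | lb x == i]| = tnth (in_tuple (shape cs)) i.
  have ics : (i < size cs)%N by have := ltn_ord i; rewrite [X in (_ < X)%N]size_map.
  rewrite (tnth_nth 0%N) /= (nth_map [::]) //.
  have ui : uniq (nth [::] cs i).
    have ici := mem_nth [::] ics; case/(nthP [::]): ici => k kcs <-.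
    have : subseq (nth [::] cs k) (flatten cs).
      elim: (cs) k {kcs} => [|c cs' IH] [|k] //=; first exact: prefix_subseq.
      exact: subseq_trans (IH k) (suffix_subseq _ _).
    by move/subseq_uniq; apply.
  rewrite -(card_uniqP ui); apply: eq_card => x; rewrite inE.
  apply/andP/idP => [[xA /eqP <-]|xi].
    by rewrite lbE //; apply: mem_face_index.
  have xA : x \in sides cs by rewrite inE; apply/flattenP; exists (nth [::] cs i) => //; apply: mem_nth.
  by split=> //; rewrite -val_eqE /= lbE // (face_indexE ucs xi).
have b0 : positive (in_tuple (shape cs)).
  move=> i; rewrite (tnth_nth 0%N) /=.
  have ics : (i < size cs)%N by have := ltn_ord i; rewrite [X in (_ < X)%N]size_map.
  rewrite (nth_map [::]) // lt0n size_eq0; apply: contraNneq csN => <-.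
  exact: mem_nth.
have -> : ngluings phi cs set0 g = #|gluings (sides cs) (size (shape cs)) phi set0 g|.
  by rewrite size_map.
rewrite (card_gluings_latN phA lbP lbb b0 st).
rewrite /gluing_count (_ : annuli g (shape cs) = 0) ?addr0.
  by rewrite (big_tnth _ _ (shape cs)).
move: st; rewrite /stable /annuli; case: (g) => // ; case: (shape cs) => [|a [|c []]] //.
Qed.

End FaceLabels.

Lemma uniq_flatten_map (I T : eqType) (C : I -> seq T) (s : seq I) : uniq s ->
  (forall i, uniq (C i)) -> (forall i j x, x \in C i -> x \in C j -> i = j) ->
  uniq (flatten (map C s)).
Proof.
move=> us uC dC; elim: s us => //= i s IH /andP[is_ us].
rewrite cat_uniq uC IH // andbT; apply/hasPn=> x /flattenP[_ /mapP[j js ->] xj].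
by apply: contra is_ => xi; rewrite (dC i j x).
Qed.

(** Each polygon consists of the successive elements of an ordinal type. *)
Lemma polygons_exist n (b : n.-tuple nat) : positive b ->
  exists (D : finType) (phi : {perm D}) (C : 'I_n -> seq D),
    polygons phi (faces C setT) /\ forall i, size (C i) = tnth b i.
Proof.
move=> b0; pose D := {i : 'I_n & 'I_(tnth b i)}.
pose sh (x : D) : D := Tagged (fun i => 'I_(tnth b i)) (ordS (tagged x)).
have shI : injective sh.
  move=> [i k] [i' k'] E; have /= ii' := congr1 tag E; case: i' / ii' k' E => k' /eqP.
  by rewrite eq_Tagged /= => /eqP/ordS_inj ->.
pose phi : {perm D} := perm shI.
pose x0 i : D := Tagged (fun i => 'I_(tnth b i)) (Ordinal (b0 i)).
pose C i := fingraph.orbit phi (x0 i).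
have tagi k x : tag (iter k phi x) = tag x.
  by elim: k => //= k <-; rewrite permE.
have memC i y : (y \in C i) = (tag y == i).
  rewrite -fconnect_orbit; apply/idP/eqP => [/iter_findex <-|]; first by rewrite tagi.
  case: y => i' k /= E; case: i / E.
  suff -> : existT (fun i => 'I_(tnth b i)) i' k = iter k phi (x0 i') by apply: fconnect_iter.
  have H m (mb : (m < tnth b i')%N) : iter m phi (x0 i') = Tagged (fun i => 'I_(tnth b i)) (Ordinal mb).
    elim: m mb => [|m IH] mb /=; first by congr Tagged; apply: val_inj.
    rewrite (IH (ltnW mb)) permE /sh /=; congr Tagged; apply: val_inj => /=.
    by rewrite modn_small.
  by rewrite (H _ (ltn_ord k)); congr existT; apply: val_inj.
have uC i : uniq (C i) by apply: orbit_uniq.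
have sC i : size (C i) = tnth b i.
  have /perm_size -> : perm_eq (C i) [seq Tagged (fun i => 'I_(tnth b i)) k | k <- enum 'I_(tnth b i)].
    apply: uniq_perm => //; first by rewrite map_inj_uniq ?enum_uniq // => k k' /eqP; rewrite eq_Tagged => /eqP.
    move=> y; rewrite memC; apply/eqP/mapP => [|[k _ ->] //].
    by case: y => i' k /= E; case: i / E; exists k; rewrite ?mem_enum.
  by rewrite size_map size_enum_ord.
exists D, phi, C; split=> //; split.
- apply: uniq_flatten_map => //; first exact: enum_uniq.
  by move=> i j x; rewrite !memC => /eqP <- /eqP.
- apply/mapP=> -[i _ E]; have := b0 i; by rewrite -sC -E.
by apply/allP=> c /mapP[i _ ->]; apply: cycle_orbit; apply: perm_inj.
Qed.

(** * The recursion for the lattice count *)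

Lemma annuli0 g s : (g, size s) != (0, 2)%N -> annuli g s = 0.
Proof. by case: g => // ; case: s => [|a [|c []]]. Qed.

Lemma sum_reflect (h : nat -> nat -> rat) m :
  \sum_(u < m.-1) h u (m - u.+2)%N = \sum_(u < m.-1) h (m - u.+2)%N u.
Proof.
rewrite (reindex_inj rev_ord_inj) /=; apply: eq_bigr => -[u um] _ /=.
by congr h; lia.
Qed.

Lemma sum_neq_lt n (X : 'I_n -> 'I_n -> rat) :
  \sum_(i < n) \sum_(j < n | j != i) X i j =
  \sum_(i < n) \sum_(j < n | (i < j)%N) (X i j + X j i).
Proof.
under [RHS]eq_bigr do rewrite big_split.
rewrite big_split /= [X in _ = _ + X](exchange_big_dep xpredT) //= -big_split.
apply: eq_bigr => i _; rewrite (bigID (fun j : 'I_n => (i < j)%N)) /=; congr (_ + _).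
  by apply: eq_bigl => j; rewrite -val_eqE /=; lia.
by apply: eq_bigl => j; rewrite -val_eqE /=; lia.
Qed.

Section CountSums.
Variables (n : nat) (c : 'I_n -> nat).
Hypothesis c0 : forall i, (0 < c i)%N.
Implicit Types (I S : {set 'I_n}) (g : nat).

Definition weight I := (\prod_(k in I) c k)%N.

(** The number of leafless gluings with a face of length [p] and the faces in
    [I], divided by the lengths of the latter; annuli are treated apart. *)
Definition marked g I (p : nat) : rat := p%:R * latNs g (p :: values c I).

Definition loop_count g S (p q : nat) : rat :=
  if g is g'.+1 then latNs g' (p :: q :: values c S) else 0.

Definition split_count g S (p q : nat) : rat :=
  \sum_(g1 < g.+1) \sum_(I : {set 'I_n} | I \subset S)
    latNs g1 (p :: values c I) * latNs (g - g1)%N (q :: values c (S :\: I)).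

(** The part of a component with one marked face that consists of annuli. It is
    nonzero only in genus 0 and with a single other face. *)
Definition annulus_mark g I (u : nat) : rat :=
  \sum_(j | I == [set j]) ((g == 0%N) && same_parity (c j) u)%:R.

Lemma size_values I : size (values c I) = #|I|.
Proof. by rewrite size_map -cardE. Qed.

Lemma prod_values I : (\prod_(x <- values c I) x)%N = weight I.
Proof. by rewrite big_map big_enum. Qed.

Lemma weight_gt0 I : (weight I)%:R != 0 :> rat.
Proof. by rewrite pnatr_eq0 -lt0n; apply: prodn_cond_gt0. Qed.

Lemma weightD i S : i \in S -> weight S = (c i * weight (S :\ i))%N.
Proof. exact: big_setD1. Qed.

Lemma merge_count g i j : i != j -> (g, n) != (0, 3)%N ->
  merge_sum gluing_count c g i j = (weight (~: [set i; j]))%:R *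
    corner_sum (parity_sum (marked g (~: [set i; j]))) (c i).-1 (c j).-1.
Proof.
move=> ij gn; rewrite -corner_sumZ; apply: eq_corner_sum => m.
rewrite -parity_sumZ; apply: eq_parity_sum => p _.
rewrite /gluing_count big_cons prod_values annuli0 ?addr0; last first.
  apply: contra gn; rewrite /= size_values => /eqP[-> E].
  by have := cardsC [set i; j]; rewrite cards2 ij card_ord E => <-.
by rewrite /marked natrM; ring.
Qed.

Lemma loop_sum g S u v : (g, #|S|) != (0, 0)%N ->
  parity_sum (fun p => parity_sum (fun q =>
    gluing_count g (q :: p :: values c S)) v) u =
  (weight S)%:R * parity_sum (fun p => parity_sum (fun q =>
    (p * q)%:R * latNs g (q :: p :: values c S)) v) u.
Proof.
move=> gS; rewrite -parity_sumZ; apply: eq_parity_sum => p _.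
rewrite -parity_sumZ; apply: eq_parity_sum => q _.
rewrite /gluing_count !big_cons prod_values annuli0 ?addr0 /= ?size_values //.
by rewrite !natrM; ring.
Qed.

Lemma marked_sum g I u :
  parity_sum (fun p => gluing_count g (p :: values c I)) u =
  (weight I)%:R * (parity_sum (marked g I) u + annulus_mark g I u).
Proof.
rewrite mulrDr -parity_sumZ.
rewrite (@eq_parity_sum _ (fun p => (weight I)%:R * marked g I p + annuli g (p :: values c I))); last first.
  by move=> p _; rewrite /gluing_count big_cons prod_values /marked natrM; congr (_ + _); ring.
rewrite parity_sumD; congr (_ + _).
have [gI|gI] := eqVneq (g, #|I|) (0, 1)%N; last first.
  rewrite (@eq_parity_sum _ (fun p => 0 * 0)) ?parity_sumZ; last first.
    by move=> p _; rewrite mul0r annuli0 //= size_values.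
  rewrite mul0r /annulus_mark big1 ?mulr0 // => j /eqP Ij; move: gI.
  by rewrite Ij cards1 xpair_eqE eqxx andbT => /negPf ->.
case: gI => -> /eqP/cards1P[j ->].
rewrite /annulus_mark (big_pred1 j) => [|k]; last first.
  by apply/eqP/eqP => [/set1_inj|->].
rewrite eqxx /= -parity_sum_delta // -parity_sumZ; apply: eq_parity_sum => p _.
rewrite /values enum_set1 /= /weight big_set1 -natrM.
by case: eqP => [->|]; rewrite ?muln1 ?muln0.
Qed.

(** Two annuli only meet in a sphere with three holes. *)
Lemma annulus_markM g g1 S I u v : (g1 <= g)%N -> I \subset S ->
  (g, #|S|) != (0, 2)%N ->
  annulus_mark g1 I u * annulus_mark (g - g1) (S :\: I) v = 0.
Proof.
move=> g1g IS gS; apply/eqP; apply: contraNT gS; rewrite mulf_eq0 negb_or => /andP[].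
rewrite /annulus_mark; case: (g1 =P 0%N) => [->|_]; last by rewrite big1 ?eqxx.
rewrite subn0; case: (g =P 0%N) => [->|_]; last first.
  by move=> _; rewrite [X in X != 0]big1 ?eqxx.
have [/cards1P[j Ij]|NI] := boolP (#|I| == 1%N); last first.
  by rewrite big_pred0 ?eqxx // => j; apply: contraNF NI => /eqP ->; rewrite cards1.
have [/cards1P[k Ik]|NI] := boolP (#|S :\: I| == 1%N); last first.
  move=> _; rewrite big_pred0 ?eqxx // => k.
  by apply: contraNF NI => /eqP ->; rewrite cards1.
by move=> _ _; rewrite -(cardsID I S) (setIidPr IS) Ik Ij !cards1.
Qed.

Lemma annulus_mark_sum (f : nat -> {set 'I_n} -> rat) g S u :
  \sum_(I : {set 'I_n} | I \subset S) \sum_(g1 < g.+1)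
    annulus_mark g1 I u * f (g - g1)%N (S :\: I) =
  \sum_(j in S) (same_parity (c j) u)%:R * f g (S :\ j).
Proof.
transitivity (\sum_(I : {set 'I_n} | I \subset S) \sum_(j | I == [set j])
    (same_parity (c j) u)%:R * f g (S :\: I)).
  apply: eq_bigr => I _; rewrite big_ord_recl /= subn0 big1 ?addr0 => [|g1 _].
    by rewrite /annulus_mark mulr_suml.
  by rewrite /annulus_mark big1 ?mul0r.
rewrite (exchange_big_dep (mem S)) /= => [|I j IS /eqP Ij]; last first.
  by rewrite (subsetP IS) // Ij set11.
apply: eq_bigr => j jS; rewrite (big_pred1 [set j]) // => I /=.
by apply/andP/eqP => [[_ /eqP]|->] //; rewrite sub1set jS eqxx.
Qed.

(** The substitution exchanges both components. *)
Lemma sum_complement (f : nat -> nat -> {set 'I_n} -> {set 'I_n} -> rat) g S :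
  \sum_(I : {set 'I_n} | I \subset S) \sum_(g1 < g.+1) f g1 (g - g1)%N I (S :\: I) =
  \sum_(I : {set 'I_n} | I \subset S) \sum_(g1 < g.+1) f (g - g1)%N g1 (S :\: I) I.
Proof.
have DD I : I \subset S -> S :\: (S :\: I) = I.
  by move=> IS; rewrite setDDr setDv set0U; apply/setIidPr.
rewrite (reindex_onto (fun I => S :\: I) (fun I => S :\: I)) /=; last by move=> I /DD.
rewrite (eq_bigl (fun I => I \subset S)) => [|I]; last first.
  apply/andP/idP => [[_ /eqP <-]|/DD ->]; first exact: subsetDl.
  by rewrite subsetDl eqxx.
apply: eq_bigr => I IS; rewrite DD // (reindex_inj rev_ord_inj) /=.
apply: eq_bigr => -[g1 g1g] _ /=; rewrite subSS.
by congr f; lia.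
Qed.

(** A component that has a leafless gluing is stable or an annulus; annuli on
    either side contribute the last two sums, and two annuli at once are
    impossible. *)
Lemma splitting_sum g S u v : (g, #|S|) != (0, 2)%N ->
  \sum_(I : {set 'I_n} | I \subset S) \sum_(g1 < g.+1)
    parity_sum (fun p => gluing_count g1 (p :: values c I)) u *
    parity_sum (fun q => gluing_count (g - g1) (q :: values c (S :\: I))) v =
  (weight S)%:R *
  (\sum_(I : {set 'I_n} | I \subset S) \sum_(g1 < g.+1)
     parity_sum (marked g1 I) u * parity_sum (marked (g - g1) (S :\: I)) v +
   (\sum_(j in S) (same_parity (c j) u)%:R * parity_sum (marked g (S :\ j)) v +
    \sum_(j in S) (same_parity (c j) v)%:R * parity_sum (marked g (S :\ j)) u)).
Proof.
move=> gS; pose P w g I := parity_sum (marked g I) w.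
rewrite -(annulus_mark_sum (P v)) -(annulus_mark_sum (P u)).
rewrite (sum_complement (fun g1 g2 I J => annulus_mark g1 I v * P u g2 J)).
rewrite -!big_split /= mulr_sumr; apply: eq_bigr => I IS.
rewrite -!big_split /= mulr_sumr; apply: eq_bigr => -[g1 g1g] _ /=.
rewrite !marked_sum; have := @annulus_markM g g1 S I u v g1g IS gS.
have -> : weight S = (weight I * weight (S :\: I))%N.
  by rewrite {1}/weight (big_setID I) /= (setIidPr IS).
rewrite /P natrM => /= Z.
by set W := _%:R; set W' := _%:R; ring: Z.
Qed.

Lemma parity_sum_big (T : finType) (Q : pred T) (f : T -> nat -> rat) m :
  parity_sum (fun p => \sum_(t | Q t) f t p) m = \sum_(t | Q t) parity_sum (f t) m.
Proof.
rewrite (@parity_sumE _ m m.+1) // exchange_big /=.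
by apply: eq_bigr => t _; rewrite (@parity_sumE _ m m.+1).
Qed.

Lemma split_count_sum g S u v :
  parity_sum (fun p => parity_sum (fun q => (p * q)%:R * split_count g S p q) v) u =
  \sum_(I : {set 'I_n} | I \subset S) \sum_(g1 < g.+1)
    parity_sum (marked g1 I) u * parity_sum (marked (g - g1) (S :\: I)) v.
Proof.
rewrite (@eq_parity_sum _ (fun p => \sum_(g1 < g.+1) \sum_(I : {set 'I_n} | I \subset S)
   parity_sum (marked (g - g1) (S :\: I)) v * marked g1 I p)) => [|p _].
  rewrite parity_sum_big exchange_big /=; apply: eq_bigr => g1 _.
  rewrite parity_sum_big; apply: eq_bigr => I _.
  by rewrite parity_sumZ mulrC.
rewrite (@eq_parity_sum _ (fun q => \sum_(g1 < g.+1) \sum_(I : {set 'I_n} | I \subset S)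
   marked g1 I p * marked (g - g1) (S :\: I) q)) => [|q _].
  rewrite parity_sum_big; apply: eq_bigr => g1 _.
  rewrite parity_sum_big; apply: eq_bigr => I _.
  by rewrite parity_sumZ mulrC.
rewrite /split_count mulr_sumr; apply: eq_bigr => g1 _.
rewrite mulr_sumr; apply: eq_bigr => I _.
by rewrite /marked natrM; ring.
Qed.

Definition cut_count g i : rat :=
  \sum_(p < (c i).+1) \sum_(q < (c i).+1)
    \sum_(r < (c i).+1 | [&& 0 < p, 0 < q, 0 < r, p + q + r == c i & ~~ odd r]%N)
      (p * q * r)%:R * (loop_count g [set~ i] p q + split_count g [set~ i] p q).

(** The annuli split off from face [i] give the annulus sums; the factor 2
    accounts for the order of both components. These sums complete the merging
    terms in [merge_identity]. *)
Lemma cut_sum g i : (g, n) != (0, 3)%N -> (g, n) != (1, 1)%N ->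
  \sum_(u < (c i).-1) split_sum gluing_count c g i u (c i - u.+2)%N =
  (weight [set~ i])%:R * (2^-1 * cut_count g i +
    \sum_(j | j != i) 2 * annulus_sum (marked g (~: [set i; j])) (c i) (c j)).
Proof.
move=> gn03 gn11; set S := [set~ i].
have cS : #|S|.+1 = n by rewrite cardsC1 card_ord prednK // (leq_ltn_trans _ (ltn_ord i)).
pose f p q : rat := (p * q)%:R * (loop_count g S p q + split_count g S p q).
have -> : cut_count g i = \sum_(p < (c i).+1) \sum_(q < (c i).+1)
    \sum_(r < (c i).+1 | [&& 0 < p, 0 < q, 0 < r, p + q + r == c i & ~~ odd r]%N)
      r%:R * f p q.
  apply: eq_bigr => p _; apply: eq_bigr => q _; apply: eq_bigr => r _.
  by rewrite /f natrM; ring.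
rewrite -split_identity.
pose X u v := \sum_(j in S) (same_parity (c j) u)%:R * parity_sum (marked g (S :\ j)) v.
have XE : \sum_(u < (c i).-1) X u (c i - u.+2)%N =
    \sum_(j | j != i) annulus_sum (marked g (~: [set i; j])) (c i) (c j).
  rewrite exchange_big /= (eq_bigl (fun j => j != i)) => [|j]; last by rewrite !inE.
  apply: eq_bigr => j _; apply: eq_bigr => u _.
  by rewrite (_ : ~: [set i; j] = S :\ j) //; apply/setP=> k; rewrite !inE negb_or andbC.
pose L u v := parity_sum (fun p => parity_sum (fun q => (p * q)%:R * loop_count g S p q) v) u.
have LE : \sum_(u < (c i).-1) L u (c i - u.+2)%N = \sum_(u < (c i).-1)
    (if g is g'.+1 then parity_sum (fun p => parity_sum (fun q =>
       (p * q)%:R * latNs g' (q :: p :: values c S)) (c i - u.+2)%N) u else 0).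
  rewrite /L /loop_count; case: (g) => [|g'].
    apply: eq_bigr => u _; rewrite (@eq_parity_sum _ (fun p => 0 * 0)) ?parity_sumZ ?mul0r //.
    move=> p _; rewrite (@eq_parity_sum _ (fun p => 0 * 0)) ?parity_sumZ ?mul0r //.
    by move=> q _; rewrite mulr0.
  rewrite (sum_reflect (fun u v => parity_sum (fun p => parity_sum (fun q =>
    (p * q)%:R * latNs g' (p :: q :: values c S)) v) u)).
  apply: eq_bigr => u _; rewrite parity_sum_exchange.
  apply: eq_parity_sum => p _; apply: eq_parity_sum => q _.
  by rewrite mulnC.
rewrite -mulr_sumr -XE [in RHS](eq_bigr (fun u : 'I_(c i).-1 => L u (c i - u.+2)%N +
   parity_sum (fun p => parity_sum (fun q => (p * q)%:R * split_count g S p q)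
     (c i - u.+2)%N) u)); last first.
  move=> u _; rewrite -parity_sumD; apply: eq_parity_sum => p _.
  by rewrite -parity_sumD; apply: eq_parity_sum => q _; rewrite -mulrDr.
rewrite [Z in _ = _ * (Z + _)]big_split /= LE mulr_natl mulr2n {2}(sum_reflect X) -!big_split /=.
rewrite mulr_sumr; apply: eq_bigr => u _.
rewrite split_count_sum /split_sum splitting_sum; last first.
  by apply: contra gn03 => /eqP[-> E]; rewrite -cS E.
rewrite !mulrDr addrA; congr (_ + _ + _).
case: (g) gn11 => [|g'] gn11; first by rewrite mulr0.
rewrite loop_sum //; apply: contra gn11 => /eqP[-> E].
by rewrite -cS E.
Qed.

(** Each term is a multiple of the product of all lengths, by which the
    recursion for gluings is divided. Ordered pairs of faces are then grouped
    into unordered ones, and each group is a [merge_kernel] by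
    [merge_identity]. *)
Lemma count_recursion g :
  (g, n) != (0, 3)%N -> (g, n) != (1, 1)%N -> (g, n) != (0, 2)%N ->
  (\sum_i c i)%:R * gluing_count g (values c setT) =
  \sum_i \sum_(j | j != i) (c i * c j)%:R * merge_sum gluing_count c g i j +
  \sum_i (c i)%:R * \sum_(u < (c i).-1) split_sum gluing_count c g i u (c i - u.+2)%N ->
  (\sum_i c i)%:R * latNs g (values c setT) =
  \sum_(i < n) \sum_(j < n | (i < j)%N) merge_kernel (marked g (~: [set i; j])) (c i + c j) +
  2^-1 * \sum_i cut_count g i.
Proof.
move=> gn03 gn11 gn02 E; apply: (mulfI (weight_gt0 setT)).
transitivity ((\sum_i c i)%:R * gluing_count g (values c setT)).
  rewrite /gluing_count annuli0 ?size_values ?cardsT ?card_ord //.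
  by rewrite addr0 prod_values; ring.
pose F i j := marked g (~: [set i; j]).
pose X i j := corner_sum (parity_sum (F i j)) (c i).-1 (c j).-1 +
              2 * annulus_sum (F i j) (c i) (c j).
have -> : \sum_(i < n) \sum_(j < n | (i < j)%N) merge_kernel (F i j) (c i + c j) =
    \sum_(i < n) \sum_(j < n | j != i) X i j.
  rewrite sum_neq_lt; apply: eq_bigr => i _; apply: eq_bigr => j _.
  rewrite -merge_identity // /X (_ : F j i = F i j); last by rewrite /F setUC.
  by ring.
rewrite E [X in _ * (_ + X)]mulr_sumr -!big_split /= [RHS]mulr_sumr.
apply: eq_bigr => i _; rewrite cut_sum //.
have wi : weight setT = (c i * weight [set~ i])%N.
  by rewrite (@weightD i) ?inE //; congr (_ * weight _)%N; apply/setP=> k; rewrite !inE andbT.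
set B := \sum_(j < n | _) 2 * _; set Y := \sum_(j < n | _) X i j.
suff : \sum_(j < n | j != i) (c i * c j)%:R * merge_sum gluing_count c g i j +
    (weight setT)%:R * B = (weight setT)%:R * Y.
  move=> H; rewrite -[RHS]/((weight setT)%:R * (Y + 2^-1 * cut_count g i)).
  rewrite [in RHS]mulrDr -H -[LHS]/(_ + (c i)%:R * ((weight [set~ i])%:R * (2^-1 * cut_count g i + B))).
  by rewrite wi natrM; ring.
rewrite !mulr_sumr -big_split; apply: eq_bigr => j ji /=.
have wij : weight setT = (c i * c j * weight (~: [set i; j]))%N.
  rewrite wi (@weightD j) ?inE // mulnA; congr (_ * weight _)%N.
  by apply/setP=> k; rewrite !inE negb_or andbC.
rewrite (merge_count _ gn03) 1?eq_sym // wij natrM -/(F i j) -[RHS]/(_ * (_ + _)).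
by ring.
Qed.

End CountSums.

Lemma values_tnth n (b : n.-tuple nat) : values (tnth b) setT = b.
Proof. by rewrite -[RHS]map_tnth_enum /values enum_setT enumT. Qed.

Lemma latN_recursion : satisfies_recursion latN.
Proof.
move=> g n b n0 st gn03 gn11 b0.
have gn02 : (g, n) != (0, 2)%N.
  by apply: contraTneq st => -[-> ->].
have [D [phi [C [CP sC]]]] := polygons_exist b0.
pose c k := size (C k); have c0 k : (0 < c k)%N by rewrite /c sC.
have cE I : values c I = values (tnth b) I by apply: eq_map.
have latE g' I p : latN g' [tuple of p :: subtup b I] = latNs g' (p :: values c I).
  by rewrite latN_seq cE.
have KE g' (D' : finType) (phi' : {perm D'}) cs : polygons phi' cs -> cs != [::] ->
    (ngluings phi' cs set0 g')%:R = gluing_count g' (shape cs).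
  exact: gluing_countE.
have := count_recursion c0 gn03 gn11 gn02 (polygon_recursion KE CP gn02 n0).
rewrite cE values_tnth -latN_seq.
rewrite (_ : \sum_i c i = \sum_i tnth b i)%N; last by apply: eq_bigr => i _; apply: sC.
move=> ->.
congr (_ + _ * _).
  apply: eq_bigr => i _; apply: eq_bigr => j _.
  rewrite /merge_kernel /glue_term /c !sC; apply: eq_bigr => p _; apply: eq_bigr => q _.
  by rewrite latE /marked natrM; ring.
apply: eq_bigr => i _; rewrite /cut_count /cut_term /c sC.
apply: eq_bigr => p _; apply: eq_bigr => q _; apply: eq_bigr => r _.
congr (_ * (_ + _)).
  by rewrite /loop_count /loop_term; case: (g) => // g'; rewrite latN_seq cE.
apply: eq_bigr => g1 _; apply: eq_bigr => I _.
by rewrite !latE.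
Qed.

(** * Uniqueness *)

Lemma positiveP m (t : m.-tuple nat) : positive t <-> {in t, forall x, (0 < x)%N}.
Proof.
split=> [t0 x /tnthP[i ->]|t0 i]; [exact: t0|exact/t0/mem_tnth].
Qed.

Lemma positive_cons m p (t : m.-tuple nat) :
  (0 < p)%N -> positive t -> positive [tuple of p :: t].
Proof.
by move=> p0 /positiveP t0; apply/positiveP=> x; rewrite inE => /predU1P[->|/t0].
Qed.

Lemma positive_subtup n (b : n.-tuple nat) (I : {set 'I_n}) :
  positive b -> positive (subtup b I).
Proof. by move=> b0; apply/positiveP=> x /mapP[i _ ->]. Qed.

Lemma latN_unstable : vanishes_unstable latN.
Proof. by move=> g n b _ /negbTE st _; rewrite /latN st. Qed.

(** Every term on the right involves only pairs [(g, n)] with smaller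
    [2 * g + n]: a component of a splitting that is not smaller leaves an
    unstable one behind. *)
Lemma recursion_unique (M N : lattice_family) :
  vanishes_unstable M -> vanishes_unstable N ->
  satisfies_recursion M -> satisfies_recursion N ->
  agree_at M N 0 3 -> agree_at M N 1 1 ->
  forall g n, (1 <= n)%N -> agree_at M N g n.
Proof.
move=> Mv Nv Mr Nr E03 E11 g n; have [k] := ubnP (2 * g + n).
elim: k g n => // k IH g n gnk n0 b b0.
have [st|st] := boolP (stable g n); last by rewrite Mv ?Nv.
have [gn|gn03] := eqVneq (g, n) (0, 3)%N.
  by case: gn b b0 {gnk n0 st} => -> -> b b0; apply: E03.
have [gn|gn11] := eqVneq (g, n) (1, 1)%N.
  by case: gn b b0 {gnk n0 st gn03} => -> -> b b0; apply: E11.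
have s0 : (\sum_i tnth b i)%N%:R != 0 :> rat.
  rewrite pnatr_eq0 -lt0n (bigD1 (Ordinal n0)) //=.
  exact: leq_trans (b0 _) (leq_addr _ _).
apply: (mulfI s0); rewrite Mr // Nr //.
have cS i : #|[set~ i : 'I_n]|.+1 = n by rewrite cardsC1 card_ord prednK.
congr (_ + _ * _).
  apply: eq_bigr => i _; apply: eq_bigr => j ij.
  apply: eq_bigr => p _; apply: eq_bigr => q /andP[p0 _]; congr (_ * _).
  apply: IH => //; last exact/positive_cons/positive_subtup.
  have := cardsC [set i; j]; rewrite cards2 card_ord -val_eqE /= neq_ltn ij /=.
  by move: gnk; set m := #|_|; clear; lia.
apply: eq_bigr => i _; apply: eq_bigr => p _; apply: eq_bigr => q _.
apply: eq_bigr => r /and3P[p0 q0 _]; congr (_ * (_ + _)).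
  rewrite /loop_term; case: g gnk {st gn03 gn11} => // g' gnk.
  apply: IH => //; last exact/positive_cons/positive_cons/positive_subtup.
  by move: gnk (cS i); set m := #|_|; clear; lia.
apply: eq_bigr => -[g1 g1g] _; apply: eq_bigr => I IS /=.
have cI : (#|I| + #|[set~ i] :\: I|).+1 = n.
  by rewrite -[RHS](cS i) -(cardsID I [set~ i]) (setIidPr IS).
have pI : positive [tuple of val p :: subtup b I].
  exact/positive_cons/positive_subtup.
have pJ : positive [tuple of val q :: subtup b ([set~ i] :\: I)].
  exact/positive_cons/positive_subtup.
have [st1|st1] := boolP (stable g1 #|I|.+1); last by rewrite Mv // Nv // !mul0r.
have [st2|st2] := boolP (stable (g - g1) #|[set~ i] :\: I|.+1); last first.
  by rewrite [X in _ * X]Mv // [X in _ = _ * X]Nv // !mulr0.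
move: gnk cI st1 st2; rewrite /stable => gnk cI st1 st2.
congr (_ * _); apply: IH => //.
  by move: gnk g1g cI st2; set m := #|I|; set m' := #|_|; clear; lia.
by move: gnk g1g cI st1; set m := #|I|; set m' := #|_|; clear; lia.
Qed.

Theorem theorem4 :
  satisfies_recursion latN /\
  (forall M : lattice_family,
     vanishes_unstable M ->
     agree_at M latN 0 3 ->
     agree_at M latN 1 1 ->
     satisfies_recursion M ->
     forall g n : nat, (1 <= n)%N -> agree_at M latN g n).
Proof.
split=> [|M Mv E03 E11 Mr]; first exact: latN_recursion.
exact: recursion_unique Mv latN_unstable Mr latN_recursion E03 E11.
Qed.
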